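(* Let $W$ be a complex vector space of dimension 6, let $e_1,\ldots,e_6$ be a basis of $W^*$, and let $\mathbb{P}(A)\subset\mathbb{P}(\bigwedge^2W^* )$ be a stable 4-dimensional linear system of skew-symmetric forms of generic rank less than or equal to four. Then $\mathbb{P}(A)$ is $SL(W)$-equivalent to one of the following two spaces: $$\text{(a)}\quad \langle e_1\wedge e_4+e_2\wedge e_5,\ e_1\wedge e_6+e_3\wedge e_5,\ e_2\wedge e_6-e_3\wedge e_4,\ e_1\wedge e_2,\ e_4\wedge e_5\rangle$$ or $$\text{(b)}\quad \langle e_1\wedge e_4+e_2\wedge e_5,\ e_1\wedge e_6+e_3\wedge e_5,\ e_2\wedge e_6-e_3\wedge e_4,\ (e_1-e_5)\wedge(e_2+e_4),\ (e_1-e_5)\wedge(e_3+e_6)\rangle.$$ Furthermore, in case (a) $\mathbb{P}(A)$ meets the Grassmannian $\mathrm{Gr}(2,W^* )$ along a smooth conic isomorphic to $\mathbb{P}^2\cap\mathrm{Gr}(2,4)$ (a plane section of $\mathrm{Gr}(2,4)\subset\mathbb{P}^5$); in case (b) $\mathbb{P}(A)$ intersects $\mathrm{Gr}(2,W^* )$ along a pair of disjoint lines.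
   Context: The base field is $\mathbb{C}$. $\mathbb{P}(\bigwedge^2 W^* )\simeq\mathbb{P}^{14}$ is the projective space of lines in the space $\bigwedge^2W^*$ of skew-symmetric bilinear forms on $W$. The rank of a form is the (even) rank of the corresponding $6\times 6$ skew-symmetric matrix. $\mathrm{Gr}(2,W^* )=\{\omega: \mathrm{rk}(\omega)=2\}$ is the Plücker-embedded Grassmannian of 2-dimensional subspaces of $W^*$. An $n$-dimensional linear system of skew-symmetric forms (linear space) is $\mathbb{P}(A)\subset \mathbb{P}(\bigwedge^2W^* )$ with $A\subset\bigwedge^2W^*$ a linear subspace of dimension $n+1$; it has generic rank $\le 4$ if its generic element has rank $\le4$, equivalently if $\mathbb{P}(A)$ is contained in the Pfaffian hypersurface $\mathrm{Pf}=\{\omega: \mathrm{rk}(\omega)\le 4\}$. Angle brackets denote (projective) linear span. Action and stability: $g\in GL(W)$ acts on forms by $M_\omega\mapsto gM_\omega g^T$ on the representing skew-symmetric matrices, hence on linear subspaces; two linear spaces are $SL(W)$-equivalent if they lie in the same $SL(W)$-orbit. Let $V_{n+1}$ be a complex vector space of dimension $n+1$. Choosing an injective linear map $\phi:V_{n+1}\to\bigwedge^2W^*$ with image $A$, one regards $A$ as a vector of $V_{n+1}^*\otimes\bigwedge^2W^*$, on which $SL(W)$ acts through the second factor. $\mathbb{P}(A)$ is stable if the orbit $SL(W)\cdot A$ is closed in $V_{n+1}^*\otimes\bigwedge^2W^*$ and the stabilizer of $A$ (as a vector of this space) in $SL(W)$ is finite; this does not depend on the choice of $\phi$. *)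

(* Defs.v *)
From HB Require Import structures.
From mathcomp Require Import all_boot all_order all_algebra.
From mathcomp Require Export reals.
From mathcomp Require Export complex.
From mathcomp Require mpoly.

Set Implicit Arguments.
Unset Strict Implicit.
Unset Printing Implicit Defensive.

Import GRing.Theory.
Local Open Scope ring_scope.

Section ZariskiClosed.
Variables (K : fieldType) (U : vectType K).

(* Coordinates are taken in the basis [vbasis {:U}]; the notion does not depend
   on the basis, since a linear change of coordinates preserves polynomials. *)
Definition zariski_closed (X : U -> Prop) : Prop :=
  exists I : mpoly.mpoly (\dim {:U}) K -> Prop,
    forall x : U,
      X x <-> forall p, I p ->
                mpoly.meval (fun i => coord (vbasis {:U}) i x) p = 0.

End ZariskiClosed.

Section SkewForms.
Variables (K : fieldType) (W : vectType K).

Definition dual := 'Hom(W, K^o).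

(* A bilinear form w on W is the linear map u |-> w(u, _) from W to W^*. *)
Definition bform := 'Hom(W, dual).

Definition skew (w : bform) : Prop := forall u v : W, w u v = - w v u.

(* The rank of the Gram matrix of w in any basis of W. *)
Definition form_rank (w : bform) : nat := \dim (limg w).

Section Wedge.
Variables a b : dual.

Definition wedge_fun (u : W) : dual := (a u : K) *: b - (b u : K) *: a.

Fact wedge_fun_is_linear : linear wedge_fun.
Proof.
move=> k u v; rewrite /wedge_fun (linearP a) (linearP b) /= !scalerDl scalerBr !scalerA.
by rewrite opprD addrACA.
Qed.
HB.instance Definition _ :=
  GRing.isSemilinear.Build K W dual _ wedge_fun
    (GRing.semilinear_linear wedge_fun_is_linear).

Definition wedge : bform := linfun wedge_fun.

Lemma wedgeE u v : wedge u v = (a u : K) * b v - (b u : K) * a v.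
Proof.
by rewrite lfunE /= /wedge_fun !(add_lfunE, opp_lfunE, scale_lfunE).
Qed.

End Wedge.

(* The second exterior power of a subspace F of W^*. *)
Definition ext2 (F : {vspace dual}) : {vspace bform} :=
  <<[seq wedge a b | a <- vbasis F, b <- vbasis F]>>%VS.

(* Cones over Gr(2, W^* ) and over Gr(2, F), origin removed. *)
Definition in_Gr2 (w : bform) : Prop := skew w /\ form_rank w = 2%N.
Definition in_Gr2_of (F : {vspace dual}) (w : bform) : Prop :=
  w \in ext2 F /\ form_rank w = 2%N.

(* P(A) is an n-dimensional linear system of skew-symmetric forms. *)
Definition linear_system (n : nat) (A : {vspace bform}) : Prop :=
  \dim A = n.+1 /\ (forall w, w \in A -> skew w).

(* P(A) is contained in the Pfaffian hypersurface. *)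
Definition generic_rank_le4 (A : {vspace bform}) : Prop :=
  forall w, w \in A -> (form_rank w <= 4)%N.

Definition inSL (g : 'End(W)) : Prop :=
  \det (passmx.mxof (vbasis {:W}) (vbasis {:W}) g) = 1.

(* (g . w)(u, v) = w (g^-1 u, g^-1 v), see actE.  If h is the matrix of the
   induced action of g on W^*, the matrix M of w is sent to h M h^T. *)
Section Action.
Variables (g : 'End(W)) (w : bform).

Definition act_fun (u : W) : dual := (w (g^-1%VF u) \o g^-1)%VF.

Fact act_fun_is_linear : linear act_fun.
Proof.
move=> k u v; apply/lfunP => x; rewrite /act_fun (linearP g^-1%VF) (linearP w).
by rewrite !(add_lfunE, scale_lfunE, comp_lfunE).
Qed.
HB.instance Definition _ :=
  GRing.isSemilinear.Build K W dual _ act_fun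
    (GRing.semilinear_linear act_fun_is_linear).

Definition act : bform := linfun act_fun.

Lemma actE u v : act u v = w (g^-1%VF u) (g^-1%VF v).
Proof. by rewrite lfunE /= comp_lfunE. Qed.

End Action.

Definition SL_equiv (A B : {vspace bform}) : Prop :=
  exists2 g, inSL g & forall w, (act g w \in B) = (w \in A).

(* phi is an element of V^* (x) bform with V = K^(n+1).  When phi takes skew
   values, its orbit lies in the linear subspace V^* (x) /\^2 W^*; this
   subspace being closed, the orbit is closed in it iff it is closed in
   V^* (x) bform. *)
Definition SL_orbit (n : nat) (phi psi : 'Hom('rV[K]_n.+1, bform)) : Prop :=
  exists2 g, inSL g & forall v, psi v = act g (phi v).

Definition stable (n : nat) (A : {vspace bform}) : Prop :=
  exists phi : 'Hom('rV[K]_n.+1, bform),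
    [/\ lker phi = 0%VS,
        limg phi = A,
        zariski_closed (SL_orbit phi)
      & exists s : seq 'End(W), forall g, inSL g ->
          (forall v, act g (phi v) = phi v) -> g \in s].

(* X is a cone of forms; in the plane P(U), it is the zero locus of a
   nondegenerate quadratic form Q. *)
Definition smooth_conic_in (U : {vspace bform}) (X : bform -> Prop) : Prop :=
  exists (f : 3.-tuple bform) (Q : 'M[K]_3),
    [/\ basis_of U f, Q^T = Q, Q \in unitmx
      & forall x : 'rV[K]_3, x != 0 ->
          X (\sum_i x 0 i *: tnth f i) <-> x *m Q *m x^T = 0].

(* P(A) meets Gr(2, W^* ) along the smooth conic cut on some
   Gr(2, F) = Gr(2, 4) in P(/\^2 F) = P^5 by a plane P(U). *)
Definition meets_Gr2_in_plane_conic (A : {vspace bform}) : Prop :=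
  exists (F : {vspace dual}) (U : {vspace bform}),
    [/\ \dim F = 4%N,
        (U <= A :&: ext2 F)%VS,
        forall w, (w \in A /\ in_Gr2 w) <-> (w \in U /\ in_Gr2_of F w)
      & smooth_conic_in U (in_Gr2_of F)].

Definition meets_Gr2_in_disjoint_lines (A : {vspace bform}) : Prop :=
  exists L1 L2 : {vspace bform},
    [/\ \dim L1 = 2%N, \dim L2 = 2%N, (L1 :&: L2)%VS = 0%VS
      & forall w, (w \in A /\ in_Gr2 w) <->
                  (w != 0 /\ (w \in L1 \/ w \in L2))].

Section NormalForms.
Variable e : 6.-tuple dual.

(* 1-based indexing of the basis, and the forms e_i /\ e_j. *)
Let x (i : nat) : dual := e`_i.-1.
Let w (i j : nat) : bform := wedge (x i) (x j).

Definition space_a_gens : seq bform :=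
  [:: w 1 4 + w 2 5; w 1 6 + w 3 5; w 2 6 - w 3 4; w 1 2; w 4 5].

Definition space_b_gens : seq bform :=
  [:: w 1 4 + w 2 5; w 1 6 + w 3 5; w 2 6 - w 3 4;
      wedge (x 1 - x 5) (x 2 + x 4); wedge (x 1 - x 5) (x 3 + x 6)].

Definition space_a : {vspace bform} := <<space_a_gens>>%VS.
Definition space_b : {vspace bform} := <<space_b_gens>>%VS.

End NormalForms.

End SkewForms.

(* Main.v *)
(* The Hilbert-Mumford direction of stability that is needed is elementary: if P <= Q
   are subspaces of W with dim P + dim Q = 6 and all forms of A vanish on P x Q, the
   one-parameter subgroup acting as t on P, 1 on Q/P and 1/t on W/Q carries A to a limit,
   which lies in the closed orbit and is fixed by the whole subgroup, so the stabilizer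
   is infinite.  Every other step uses stability through the absence of such P, Q.

   A degenerate member of suitable pencils, found over an algebraically closed field,
   first yields a form w0 of rank 2 in A.  The Pfaffian of w0 + t w vanishes for
   all t, so the restrictions of A to the 4-dimensional kernel of w0 have rank at most
   2; without a common isotropic 3-space, they share a kernel vector k.
   In a basis k, c1, c2, c3 of ker w0, completed by p1, p2, put
   g w = (w(c2,c3), w(c3,c1), w(c1,c2)) and a_i w = (w(p_i,c1), w(p_i,c2), w(p_i,c3)).
   The Pfaffian of w is then w(k,p1) (g w . a_2 w) - w(k,p2) (g w . a_1 w).  As the two
   linear factors are independent, g . a_i = w(k,p_i) m(w) for a linear form m.
   A linear map a with g . a = 0 has the form v x g, and adding v to p_i removes it.
   If m is a linear combination of the coordinates of g, a shear of the c_i along k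
   makes m vanish, and A takes the form (b); otherwise both w(k,p_i) factor through g,
   and A takes the form (a). *)
Require Import Defs.
From HB Require Import structures.
From mathcomp Require Import all_boot all_order all_algebra.
From mathcomp Require Import reals complex ring.
From mathcomp Require mpoly.
Import Defs.

Set Implicit Arguments.
Unset Strict Implicit.
Unset Printing Implicit Defensive.

Import GRing.Theory Num.Theory.
Local Open Scope ring_scope.

(** * Linear algebra and bilinear forms *)

(** Why constant rank 4 is impossible: the linear term in [t] of the Pfaffian of [w0 + t w] is, up
    to a nonzero factor, the value of [w] on [ker w0], so every kernel would be isotropic for all of
    [A]. A 4 by 4 pencil makes one vector [k] common to two kernels; the kernels of the forms
    killing [k] then span a 4-space [T], isotropic for these forms. Killing [k] costs only two
    conditions, so three independent such forms remain, just enough for a 3 by 3 pencil to enlarge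
    [T] to a 5-space isotropic for one of them, whose rank is then at most 2. The existence of [m]
    is a case of unique factorization: independent linear forms [s], [t] and quadratic forms with
    [s r = t q] satisfy [q = s m] and [r = t m]. The normal forms are recognized by equations, not
    by generators: each is the solution space of ten linear equations on the 15-dimensional space of
    skew forms, so once [A] satisfies them its dimension 5 forces equality. The equations are
    homogeneous in the basis vectors, so a map of any nonzero determinant can be rescaled into SL by
    a sixth root. *)

Section LinearAlgebra.
Variables (K : fieldType) (V : vectType K).
Implicit Types (s b : seq V) (U : {vspace V}).

(** Coefficients and vectors are plain lists, so that combinations of explicitly named vectors
    reduce by computation. *)
Fixpoint lc (k : seq K) (s : seq V) : V :=
  match k, s with a :: k', x :: s' => a *: x + lc k' s' | _, _ => 0 end.

Lemma lc_span k s : lc k s \in <<s>>%VS.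
Proof.
elim: s k => [|x s IH] [|a k]; rewrite ?mem0v //= span_cons.
by apply: memv_add; rewrite ?IH // memvZ ?memv_line.
Qed.

Lemma span_lc s u : u \in <<s>>%VS -> exists2 k, size k = size s & u = lc k s.
Proof.
elim: s u => [|x s IH] u; first by rewrite span_nil memv0 => /eqP ->; exists [::].
rewrite span_cons => /memv_addP[y /vlineP[a ->] [z /IH[k sk ->] ->]].
by exists (a :: k); rewrite //= sk.
Qed.

Lemma free_lc k s : free s -> lc k s = 0 -> size k = size s ->
  k = nseq (size s) 0.
Proof.
elim: s k => [|x s IH] [|a k] //=; rewrite free_cons => /andP[xs fs] + [sk].
case: (eqVneq a 0) => [-> | a0]; first by rewrite scale0r add0r => /(IH _ fs) ->.
move/eqP; rewrite addr_eq0 => /eqP ax; case/negP: xs.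
rewrite -[x](scalerK a0) ax -memvN scalerN opprK; apply: memvZ; exact: lc_span.
Qed.

Lemma lc_free s :
  (forall k, size k = size s -> lc k s = 0 -> k = nseq (size s) 0) -> free s.
Proof.
elim: s => [|x s IH] h; first exact: nil_free.
rewrite free_cons IH ?andbT => [|k sk lk].
  apply/negP => /span_lc[k sk xk]; have := h (-1 :: k); rewrite /= sk => /(_ erefl).
  by rewrite -xk scaleN1r addNr => /(_ erefl)[/eqP]; rewrite oppr_eq0 oner_eq0.
by have := h (0 :: k); rewrite /= sk scale0r add0r => /(_ erefl lk)[].
Qed.

Lemma not_free_lc s : ~~ free s ->
  exists k, [/\ size k = size s, lc k s = 0 & k != nseq (size s) 0].
Proof.
elim: s => [|x s IH]; first by rewrite nil_free.
rewrite free_cons negb_and negbK => /orP[/span_lc[k sk xk] | /IH[k [sk lk k0]]].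
  exists (-1 :: k); rewrite /= sk; split => //; first by rewrite -xk scaleN1r addNr.
  by apply/eqP => -[/eqP]; rewrite oppr_eq0 oner_eq0.
exists (0 :: k); rewrite /= sk; split => //; first by rewrite scale0r add0r.
by apply: contra k0 => /eqP[->].
Qed.

Lemma basis_change s b : basis_of fullv s -> size b = size s ->
  {subset s <= <<b>>%VS} -> basis_of fullv b.
Proof.
move=> bs sz sb; rewrite basisEdim; apply/andP; split.
  by rewrite -(span_basis bs); apply/span_subvP.
by rewrite sz -(size_basis (X := in_tuple s) bs).
Qed.

Lemma basis_extend U n b : free b -> {subset b <= U} -> \dim U = (size b + n)%N ->
  exists c : n.-tuple V, basis_of U (b ++ c).
Proof.
move=> fb bU dU; pose D := (U :\: <<b>>)%VS.
have bUv : (<<b>> <= U)%VS by apply/span_subvP.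
have dD : \dim D = n.
  have := dimv_cap_compl U <<b>>; rewrite (capv_idPr bUv) dU (eqP fb).
  by move/addnI.
have bb : basis_of <<b>> b by rewrite /basis_of eqxx.
exists (tcast dD (vbasis D)); rewrite val_tcast.
have -> : U = (<<b>> + D)%VS by rewrite addvC addv_diff (addv_idPl bUv).
apply: cat_basis bb (vbasisP D); apply/directv_addP.
by rewrite capvC capv_diff.
Qed.

Lemma free_swap (a c : V) s : free (a :: c :: s) = free (c :: a :: s).
Proof. by apply: perm_free; apply/permP => p /=; rewrite addnCA. Qed.

Lemma dim_lker_functional (f : 'Hom(V, K^o)) U : (\dim U <= (\dim (U :&: lker f)).+1)%N.
Proof.
rewrite -(limg_ker_dim f U) -addn1 leq_add2l.
by apply: leq_trans (dimvS (subvf _)) _; rewrite dimvf.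
Qed.

Lemma lcZ a k s : a *: lc k s = lc (map ( *%R a) k) s.
Proof.
by elim: k s => [|b k IH] [|x s] //=; rewrite ?scaler0 // scalerDr scalerA IH.
Qed.

End LinearAlgebra.
(* Spaces of bilinear forms.  The space of all forms is the type [bform W], but its
   elements are nested linear maps, which unification unfolds at great cost. *)
Record forms (K : fieldType) (W : vectType K) := Forms {
  forms_sort :> vectType K;
  ev : forms_sort -> W -> W -> K;
  ker : forms_sort -> {vspace W};
  contract : forms_sort -> W -> 'Hom(W, K^o);
  eval : W -> W -> 'Hom(forms_sort, K^o);
  evDl : forall w u v x, ev w (u + v) x = ev w u x + ev w v x;
  evZl : forall w k u x, ev w (k *: u) x = k * ev w u x;
  evDr : forall w u v x, ev w x (u + v) = ev w x u + ev w x v;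
  evZr : forall w k u x, ev w x (k *: u) = k * ev w x u;
  evD : forall w1 w2 u v, ev (w1 + w2) u v = ev w1 u v + ev w2 u v;
  evZ : forall k w u v, ev (k *: w) u v = k * ev w u v;
  ev_ext : forall w1 w2, (forall u v, ev w1 u v = ev w2 u v) -> w1 = w2;
  ev_ker : forall w u, u \in ker w -> forall v, ev w u v = 0;
  ker_ev : forall w u, (forall v, ev w u v = 0) -> u \in ker w;
  contractE : forall w u v, contract w u v = ev w u v;
  evalE : forall x y w, eval x y w = ev w x y
}.
Arguments ev : simpl never.
Arguments ker : simpl never.

Section Ev.
Variables (K : fieldType) (W : vectType K) (B : forms W).
Implicit Types (w : B) (u v x : W).

Lemma ev0l w x : ev w 0 x = 0.
Proof. by rewrite -(scale0r 0) evZl mul0r. Qed.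
Lemma ev0r w x : ev w x 0 = 0.
Proof. by rewrite -(scale0r 0) evZr mul0r. Qed.
Lemma ev0 u v : ev (0 : B) u v = 0.
Proof. by rewrite -(scale0r 0) evZ mul0r. Qed.
Lemma evNl w u x : ev w (- u) x = - ev w u x.
Proof. by rewrite -scaleN1r evZl mulN1r. Qed.
Lemma evNr w u x : ev w x (- u) = - ev w x u.
Proof. by rewrite -scaleN1r evZr mulN1r. Qed.
Lemma evN w u v : ev (- w) u v = - ev w u v.
Proof. by rewrite -scaleN1r evZ mulN1r. Qed.

Definition evE := (evDl, evNl, evZl, ev0l, evDr, evNr, evZr, ev0r, evD, evN, evZ, ev0).

Definition skewf w := forall u v, ev w u v = - ev w v u.

Lemma ev_span_r w u s : {in s, forall v, ev w u v = 0} ->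
  {in <<s>>%VS, forall v, ev w u v = 0}.
Proof.
move=> h v; have /subvP H : (<<s>> <= lker (contract w u))%VS.
  by apply/span_subvP => x xs; rewrite memv_ker contractE; apply/eqP/h.
by move/H; rewrite memv_ker contractE => /eqP.
Qed.

Lemma ev_span w s t : skewf w -> {in s & t, forall u v, ev w u v = 0} ->
  {in <<s>>%VS & <<t>>%VS, forall u v, ev w u v = 0}.
Proof.
move=> sw h u v us; apply: ev_span_r => x xt; rewrite sw.
have H : {in s, forall y, ev w x y = 0} by move=> y ys; rewrite sw h ?oppr0.
by rewrite (ev_span_r H) ?oppr0.
Qed.

End Ev.

(** Each application subtracts a multiple of a known equation from the goal. A chain of them closed
    by [ring] derives an identity from hypotheses, the multipliers [c] being the certificate. *)
Lemma lin0 (R : pzRingType) (a b : R) (e : a = b) (c x : R) :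
  x - c * (a - b) = 0 -> x = 0.
Proof. by rewrite e subrr mulr0 subr0. Qed.
Arguments lin0 {R a b} e c {x}.

(** * Pfaffians of degenerate Gram matrices *)

Section Pfaffian.
Variables (K : fieldType) (W : vectType K) (B : forms W).
Hypothesis char0 : forall n, n.+1%:R != 0 :> K.
Implicit Types (w : B) (u v x : W).

Lemma ev_diag w u : skewf w -> ev w u u = 0.
Proof.
move=> sw; apply/eqP; have /eqP := sw u u.
by rewrite -addr_eq0 -mulr2n -mulr_natl mulf_eq0 (negPf (char0 1)).
Qed.

(** The Pfaffian of the 4 by 4 Gram matrix of a skew [w]. *)
Definition pf4 w a b c d :=
  ev w a b * ev w c d - ev w a c * ev w b d + ev w a d * ev w b c.

(** The 6 by 6 Pfaffian, expanded along its first row. *)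
Definition pf6 w a b c d e f :=
  ev w a b * pf4 w c d e f - ev w a c * pf4 w b d e f + ev w a d * pf4 w b c e f
  - ev w a e * pf4 w b c d f + ev w a f * pf4 w b c d e.

Lemma lc_nseq0 n (s : seq W) : lc (nseq n 0) s = 0.
Proof. by elim: n s => [|n IH] [|x s] //=; rewrite scale0r add0r IH. Qed.

(** Either the vectors are dependent, or their span is too large to avoid [ker w]. *)
Lemma gram_relation w (s : seq W) : (\dim {:W} < \dim (ker w) + size s)%N ->
  exists k, [/\ size k = size s, forall v, ev w (lc k s) v = 0 & k != nseq (size s) 0].
Proof.
move=> lt; have [fs|/not_free_lc[k [sk k0 kn]]] := boolP (free s); last first.
  by exists k; split => // v; rewrite k0 ev0l.
pose v := vpick (<<s>> :&: ker w)%VS.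
have /andP[vs vk] : (v \in <<s>>%VS) && (v \in ker w) by rewrite -memv_cap memv_pick.
have v0 : v != 0.
  rewrite vpick0 -dimv_eq0 -lt0n -(ltn_add2l (\dim (<<s>> + ker w))) dimv_sum_cap addn0.
  by rewrite (leq_ltn_trans (dimvS (subvf _))) // addnC (eqP fs).
have [k sk vE] := span_lc vs; exists k; split => // [x|]; first by rewrite -vE ev_ker.
by apply: contra v0 => /eqP k0; rewrite vE k0 lc_nseq0.
Qed.

(** The Gram matrix has a null vector by [gram_relation]. Its product with the Pfaffian adjugate is
    [pf4] times the identity, so [pf4] kills every coordinate of the null vector; the multipliers in
    the proof are the entries of the adjugate. *)
Lemma pf4_eq0 w a b c d : skewf w -> (\dim {:W} < \dim (ker w) + 4)%N -> pf4 w a b c d = 0.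
Proof.
move=> sw lt; have [k [sz kv k0]] := gram_relation (s := [:: a; b; c; d]) lt.
case: k sz kv k0 => [|k1 [|k2 [|k3 [|k4 []]]]] // _ kv k0.
have sd := fun x => ev_diag x sw; have sk := sw.
move: (kv a) (kv b) (kv c) (kv d); rewrite /= !evE !sd.
rewrite (sk b a) (sk c a) (sk d a) (sk c b) (sk d b) (sk d c) => ea eb ec ed.
apply/eqP; apply: contraNT k0 => p0.
have kp (y : K) : y * pf4 w a b c d = 0 -> y = 0.
  by move/eqP; rewrite mulf_eq0 (negPf p0) orbF => /eqP.
have -> : k1 = 0.
  apply: kp; apply: (lin0 eb (ev w c d)); apply: (lin0 ec (- ev w b d)).
  by apply: (lin0 ed (ev w b c)); rewrite /pf4; ring.
have -> : k2 = 0.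
  apply: kp; apply: (lin0 ea (- ev w c d)); apply: (lin0 ec (ev w a d)).
  by apply: (lin0 ed (- ev w a c)); rewrite /pf4; ring.
have -> : k3 = 0.
  apply: kp; apply: (lin0 ea (ev w b d)); apply: (lin0 eb (- ev w a d)).
  by apply: (lin0 ed (ev w a b)); rewrite /pf4; ring.
suff -> : k4 = 0 by [].
apply: kp; apply: (lin0 ea (- ev w b c)); apply: (lin0 eb (ev w a c)).
by apply: (lin0 ec (- ev w a b)); rewrite /pf4; ring.
Qed.

(** The argument of [pf4_eq0], the adjugate now consisting of the signed 4 by 4 sub-Pfaffians. *)
Lemma pf6_eq0 w a b c d e f : skewf w -> (\dim {:W} < \dim (ker w) + 6)%N -> pf6 w a b c d e f = 0.
Proof.
move=> sw lt; have [k [sz kv k0]] := gram_relation (s := [:: a; b; c; d; e; f]) lt.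
case: k sz kv k0 => [|k1 [|k2 [|k3 [|k4 [|k5 [|k6 []]]]]]] // _ kv k0.
have sd := fun x => ev_diag x sw; have sk := sw.
move: (kv a) (kv b) (kv c) (kv d) (kv e) (kv f); rewrite /= !evE !sd.
rewrite (sk b a) (sk c a) (sk d a) (sk e a) (sk f a) (sk c b) (sk d b) (sk e b) (sk f b).
rewrite (sk d c) (sk e c) (sk f c) (sk e d) (sk f d) (sk f e) => ea eb ec ed ee ef.
apply/eqP; apply: contraNT k0 => p0.
have kp (y : K) : y * pf6 w a b c d e f = 0 -> y = 0.
  by move/eqP; rewrite mulf_eq0 (negPf p0) orbF => /eqP.
have -> : k1 = 0.
  apply: kp; apply: (lin0 eb (pf4 w c d e f)); apply: (lin0 ec (- pf4 w b d e f)).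
  apply: (lin0 ed (pf4 w b c e f)); apply: (lin0 ee (- pf4 w b c d f)).
  by apply: (lin0 ef (pf4 w b c d e)); rewrite /pf6 /pf4; ring.
have -> : k2 = 0.
  apply: kp; apply: (lin0 ea (- pf4 w c d e f)); apply: (lin0 ec (pf4 w a d e f)).
  apply: (lin0 ed (- pf4 w a c e f)); apply: (lin0 ee (pf4 w a c d f)).
  by apply: (lin0 ef (- pf4 w a c d e)); rewrite /pf6 /pf4; ring.
have -> : k3 = 0.
  apply: kp; apply: (lin0 ea (pf4 w b d e f)); apply: (lin0 eb (- pf4 w a d e f)).
  apply: (lin0 ed (pf4 w a b e f)); apply: (lin0 ee (- pf4 w a b d f)).
  by apply: (lin0 ef (pf4 w a b d e)); rewrite /pf6 /pf4; ring.
have -> : k4 = 0.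
  apply: kp; apply: (lin0 ea (- pf4 w b c e f)); apply: (lin0 eb (pf4 w a c e f)).
  apply: (lin0 ec (- pf4 w a b e f)); apply: (lin0 ee (pf4 w a b c f)).
  by apply: (lin0 ef (- pf4 w a b c e)); rewrite /pf6 /pf4; ring.
have -> : k5 = 0.
  apply: kp; apply: (lin0 ea (pf4 w b c d f)); apply: (lin0 eb (- pf4 w a c d f)).
  apply: (lin0 ec (pf4 w a b d f)); apply: (lin0 ed (- pf4 w a b c f)).
  by apply: (lin0 ef (pf4 w a b c d)); rewrite /pf6 /pf4; ring.
suff -> : k6 = 0 by [].
apply: kp; apply: (lin0 ea (- pf4 w b c d e)); apply: (lin0 eb (pf4 w a c d e)).
apply: (lin0 ec (- pf4 w a b d e)); apply: (lin0 ed (pf4 w a b c e)).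
by apply: (lin0 ee (- pf4 w a b c d)); rewrite /pf6 /pf4; ring.
Qed.

End Pfaffian.

(** * Stability *)

Section BilinearForms.
Variables (K : fieldType) (W : vectType K).
Implicit Types (w : bform W) (u v x y : W).

Section Eval.
Variables x y : W.
Definition eval_fun w : K^o := w x y.
Fact eval_fun_is_linear : linear eval_fun.
Proof. by move=> k w1 w2; rewrite /eval_fun !add_lfunE !scale_lfunE. Qed.
HB.instance Definition _ := GRing.isSemilinear.Build K (bform W) K^o _ eval_fun
  (GRing.semilinear_linear eval_fun_is_linear).
Definition bform_eval : 'Hom(bform W, K^o) := linfun eval_fun.
End Eval.

Definition bforms : forms W.
Proof.
refine (@Forms K W (bform W) (fun w u v => w u v) (fun w => lker w) (fun w u => w u)
  bform_eval _ _ _ _ _ _ _ _ _ _ _).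
- by move=> w u v x; rewrite linearD add_lfunE.
- by move=> w k u x; rewrite linearZ scale_lfunE.
- by move=> w u v x; rewrite linearD.
- by move=> w k u x; rewrite linearZ.
- by move=> w1 w2 u v; rewrite !add_lfunE.
- by move=> k w u v; rewrite !scale_lfunE.
- by move=> w1 w2 h; apply/lfunP => u; apply/lfunP => v; apply: h.
- by move=> w u; rewrite memv_ker => /eqP -> v; rewrite zero_lfunE.
- by move=> w u h; rewrite memv_ker; apply/eqP/lfunP => v; rewrite zero_lfunE; apply: h.
- by [].
by move=> x y w; rewrite lfunE.
Defined.

Lemma ev_act (g : 'End(W)) w u v :
  @ev K W bforms (act g w) u v = @ev K W bforms w (g^-1%VF u) (g^-1%VF v).
Proof. exact: actE. Qed.

End BilinearForms.
Arguments bforms {K} W.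

(** * Determinants and diagonal endomorphisms *)

Section Determinant.
Import passmx.
Variables (K : fieldType) (W : vectType K).
Local Notation ev := (@ev K W (bforms W)).
Implicit Types (g h : 'End(W)).

(** [inSL g] is [dt g = 1] by conversion, which several proofs use silently. *)
Definition dt g : K := \det (mxof (vbasis {:W}) (vbasis {:W}) g).

Lemma dt1 : dt \1 = 1.
Proof. by rewrite /dt mxof1 ?det1 // (basis_free (vbasisP _)). Qed.

Lemma dt_comp g h : dt (g \o h) = dt g * dt h.
Proof. by rewrite /dt (mxof_comp _ _ (vbasisP _)) det_mulmx mulrC. Qed.

Lemma dtZ k g : dt (k *: g) = k ^+ \dim {:W} * dt g.
Proof. by rewrite /dt linearZ /= detZ. Qed.

Lemma dt_lker g : dt g != 0 -> lker g == 0%VS.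
Proof.
rewrite /dt -unitfE => ug; rewrite -subv0; apply/subvP => u; rewrite memv_ker memv0.
rewrite -!(rVof_eq0 (vbasisP {:W})) (rVof_app _ (vbasisP _)).
by move/eqP/(congr1 (mulmx^~ (invmx (mxof (vbasis {:W}) (vbasis {:W}) g))));
  rewrite mulmxK // mul0mx => ->.
Qed.

Lemma lker_dt g : lker g == 0%VS -> dt g != 0.
Proof.
move=> kg; have := dt_comp g g^-1; rewrite lker0_compfV // dt1 => e.
by apply: contra_eq_neq e => ->; rewrite mul0r oner_neq0.
Qed.

Lemma inSL_lker g : inSL g -> lker g == 0%VS.
Proof. by move=> sg; apply: dt_lker; rewrite /dt sg oner_neq0. Qed.

Lemma inSL_comp g h : inSL g -> inSL h -> inSL (g \o h).
Proof.
move=> sg sh; have : dt (g \o h) = 1 by rewrite dt_comp /dt sg sh mulr1.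
by [].
Qed.

Lemma inSL_inv g : inSL g -> inSL g^-1.
Proof.
move=> sg; have := dt_comp g g^-1.
by rewrite lker0_compfV ?inSL_lker // dt1 {1}/dt sg mul1r => /esym.
Qed.

Variable X : (\dim {:W}).-tuple W.
Hypothesis bX : basis_of {:W} X.

Definition diag (a : 'I_(\dim {:W}) -> K) : 'End(W) :=
  hommx X X (diag_mx (\row_i a i)).

Lemma diagE a (i : 'I_(\dim {:W})) : diag a X`_i = a i *: X`_i.
Proof.
rewrite /diag hommxE // rVofE // -rowE row_diag_mx mxE.
by rewrite linearZ /= vecof_delta.
Qed.

Lemma basis_lfun_eq (V : vectType K) (f1 f2 : 'Hom(W, V)) :
  (forall i : 'I_(\dim {:W}), f1 X`_i = f2 X`_i) -> f1 = f2.
Proof.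
move=> h; apply/lfunP => u; rewrite (coord_basis bX (memvf u)) !linear_sum /=.
by apply: eq_bigr => i _; rewrite !linearZ /= h.
Qed.

Lemma coord_diag a (i : 'I_(\dim {:W})) x : coord X i (diag a x) = a i * coord X i x.
Proof.
rewrite {1}(coord_basis bX (memvf x)) !linear_sum (bigD1 i) //= big1 ?addr0.
  by rewrite !linearZ /= diagE linearZ /= coord_free ?eqxx ?mulr1 1?mulrC // (basis_free bX).
move=> j ji; rewrite !linearZ /= diagE linearZ /= coord_free ?(basis_free bX) //.
by rewrite (negPf ji) !mulr0.
Qed.

Lemma ev_coord (w : bform W) x y : ev w x y =
  \sum_ij ev w X`_(ij.1 : 'I_(\dim {:W})) X`_(ij.2 : 'I_(\dim {:W})) *
    (coord X ij.1 x * coord X ij.2 y).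
Proof.
rewrite -(pair_big xpredT xpredT (fun i j : 'I_(\dim {:W}) => ev w X`_i X`_j *
  (coord X i x * coord X j y))) /=.
rewrite {1}(coord_basis bX (memvf x)) /ev /= linear_sum sum_lfunE.
apply: eq_bigr => i _; rewrite linearZ scale_lfunE {1}(coord_basis bX (memvf y)).
rewrite linear_sum scaler_sumr; apply: eq_bigr => j _.
by rewrite linearZ /= /GRing.scale /= mulrA mulrC.
Qed.

Lemma diag_comp a b : (diag a \o diag b)%VF = diag (fun i => a i * b i).
Proof.
apply: basis_lfun_eq => i.
by rewrite comp_lfunE !diagE linearZ /= diagE scalerA mulrC.
Qed.

Lemma diag1 : diag (fun=> 1) = \1%VF.
Proof. by apply: basis_lfun_eq => i; rewrite diagE scale1r id_lfunE. Qed.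

Lemma dt_diag a : dt (diag a) = \prod_i a i.
Proof.
have E : mxof X X (diag a) = diag_mx (\row_i a i) by rewrite /diag hommxK.
have V := vbasisP {:W}; have fV := basis_free V; have fX := basis_free bX.
(* The base changes between [X] and the basis in which [inSL] takes its determinant; they are
   mutually inverse. *)
pose M := mxof (vbasis {:W}) X \1; pose N := mxof X (vbasis {:W}) \1.
have MN : M *m N = 1%:M by rewrite -(mxof_comp _ _ bX) comp_lfun1l mxof1.
rewrite /dt -[diag a]comp_lfun1l (mxof_comp _ _ bX) -[diag a]comp_lfun1r.
rewrite (mxof_comp _ _ bX) -/M -/N E !det_mulmx mulrAC -det_mulmx MN det1 mul1r.
by rewrite det_diag; apply: eq_bigr => i _; rewrite mxE.
Qed.

Lemma diagV a : (forall i, a i != 0) -> (diag a)^-1%VF = diag (fun i => ((a i)^-1)%R).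
Proof.
move=> a0; have la : lker (diag a) == 0%VS.
  by apply: dt_lker; rewrite dt_diag; apply/prodf_neq0 => i _.
rewrite -[LHS]comp_lfun1r -diag1.
have -> : diag (fun=> 1) = (diag a \o diag (fun i => ((a i)^-1)%R))%VF.
  by rewrite diag_comp; congr diag; apply/boolp.funext => i; rewrite divff.
by rewrite comp_lfunA lker0_compVf // comp_lfun1l.
Qed.

End Determinant.

Section Destabilize.
Variables (K : numFieldType) (W : vectType K).
Implicit Types (w : bform W).
Local Notation ev := (@ev K W (bforms W)).

Definition poly_curve (U : vectType K) (I : finType) (n : I -> nat) (v : I -> U) (t : K) :=
  \sum_j t ^+ n j *: v j.

(* The curve [p (\sum_j t ^ n j v_j)] is polynomial in [t], so it vanishes at [0] if
   it vanishes elsewhere. *)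
Lemma zariski_closed_curve0 (U : vectType K) (X : U -> Prop) (I : finType)
    (n : I -> nat) (v : I -> U) : zariski_closed X ->
  (forall t, t != 0 -> X (poly_curve n v t)) -> X (poly_curve n v 0).
Proof.
case=> J XJ Xt; apply/XJ => p Jp.
pose q i : {poly K} := \sum_j coord (vbasis {:U}) i (v j) *: 'X^(n j).
pose P := \sum_(m <- mpoly.msupp p) mpoly.mcoeff m p *: \prod_i q i ^+ mpoly.fun_of_multinom m i.
have PE t : mpoly.meval
    (fun i => coord (vbasis {:U}) i (poly_curve n v t)) p = P.[t].
  rewrite mpoly.mevalE /P horner_sum; apply: eq_bigr => m _.
  rewrite hornerZ horner_prod; congr (_ * _); apply: eq_bigr => i _.
  rewrite horner_exp; congr (_ ^+ _); rewrite /poly_curve linear_sum /q horner_sum.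
  by apply: eq_bigr => j _; rewrite linearZ hornerZ hornerXn mulrC.
rewrite PE; suff -> : P = 0 by rewrite horner0.
apply/eqP/negPn/negP => P0.
(* In characteristic zero [1, ..., size P] are distinct nonzero points, one more than the number of
   roots a nonzero [P] can have. *)
pose rs := [seq i.+1%:R | i <- iota 0 (size P)] : seq K.
have /(max_poly_roots P0) : all (root P) rs.
  apply/allP => _ /mapP[i _ ->]; rewrite /root -PE; apply/eqP.
  by apply/(XJ _).1; [apply: Xt; rewrite pnatr_eq0 | exact: Jp].
rewrite map_inj_uniq ?iota_uniq => [|i j /eqP]; last by rewrite eqr_nat eqSS => /eqP.
by rewrite size_map size_iota ltnn => /(_ isT).
Qed.

Section Tensor.
Variables a b : dual W.
Definition tensor_fun (u : W) : dual W := (a u : K) *: b.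
Fact tensor_fun_is_linear : linear tensor_fun.
Proof. by move=> k u v; rewrite /tensor_fun (linearP a) scalerDl scalerA. Qed.
HB.instance Definition _ := GRing.isSemilinear.Build K W (dual W) _ tensor_fun
  (GRing.semilinear_linear tensor_fun_is_linear).
Definition tensor : bform W := linfun tensor_fun.
Lemma ev_tensor u v : ev tensor u v = (a u : K) * b v.
Proof. by rewrite /ev /= lfunE /= /tensor_fun scale_lfunE. Qed.
End Tensor.

Section Component.
Variables (n : nat) (phi : 'Hom('rV[K]_n, bform W)) (x y : W) (w : bform W).
(** With [w] the tensor of the coordinates belonging to two basis vectors [x] and [y], these are the
    matrix-entry components of [phi], on each of which a diagonal map acts by a scalar. *)
Definition component_fun (v : 'rV[K]_n) : bform W := ev (phi v) x y *: w.
Fact component_fun_is_linear : linear component_fun.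
Proof.
by move=> k u v; rewrite /component_fun (linearP phi) evD evZ scalerDl scalerA.
Qed.
HB.instance Definition _ := GRing.isSemilinear.Build K 'rV[K]_n (bform W) _ component_fun
  (GRing.semilinear_linear component_fun_is_linear).
Definition component : 'Hom('rV[K]_n, bform W) := linfun component_fun.
Lemma componentE v : component v = ev (phi v) x y *: w.
Proof. by rewrite lfunE. Qed.
End Component.

Lemma adapted_basis (P Q : {vspace W}) : (P <= Q)%VS ->
  exists X : (\dim {:W}).-tuple W,
    [/\ basis_of fullv X, forall i, (i < \dim P)%N -> X`_i \in P
      & forall i, (i < \dim Q)%N -> X`_i \in Q].
Proof.
move=> PQ; have bP := vbasisP P; have dPQ := dimvS PQ.
have [|| c bc] := basis_extend (n := \dim Q - \dim P) (U := Q) (basis_free bP).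
- by move=> v /vbasis_mem; apply/subvP.
- by rewrite size_tuple subnKC.
have szQ : size (vbasis P ++ c) = \dim Q by rewrite size_cat !size_tuple subnKC.
have dQ := dimvS (subvf Q).
have [|| d bd] := basis_extend (n := \dim {:W} - \dim Q) (U := fullv) (basis_free bc).
- by move=> v _; apply: memvf.
- by rewrite szQ subnKC.
have szX : size ((vbasis P ++ c) ++ d) == \dim {:W}.
  by rewrite size_cat szQ size_tuple subnKC.
exists (Tuple szX); split => //= i li.
  rewrite -catA nth_cat size_tuple li; apply: vbasis_mem; apply: mem_nth.
  by rewrite size_tuple.
by rewrite nth_cat szQ li; apply: (basis_mem bc); apply: mem_nth; rewrite szQ.
Qed.

Lemma stable_nondegenerate n (A : {vspace bform W}) (P Q : {vspace W}) :
  stable n A -> (forall w, w \in A -> skew w) ->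
  (P <= Q)%VS -> (0 < \dim P)%N -> (\dim P + \dim Q = \dim {:W})%N ->
  ~ (forall w, w \in A -> {in P & Q, forall u v, ev w u v = 0}).
Proof.
case=> phi [_ phiA closed_phi [s stab_s]] skA PQ P0 dPQ vanish.
have [X [bX XP XQ]] := adapted_basis PQ.
have phiv v : phi v \in A by rewrite -phiA memv_img ?memvf.
set m := \dim {:W} in X bX XP XQ dPQ.
(* Weights 0, 1, 2 on [P], [Q/P], [W/Q]: since [(d t i)^-1] is [t] to the power [wt i - 1], the
   entry [(i, j)] of a form gets multiplied by [t] to the power [wt i + wt j - 2]. *)
pose wt i := if (i < \dim P)%N then 0%N else if (i < \dim Q)%N then 1%N else 2%N.
pose d (t : K) (i : 'I_m) := if (i < \dim P)%N then t else
  if (i < \dim Q)%N then 1 else t^-1.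
pose g t := diag X (d t).
have d0 t i : t != 0 -> d t i != 0.
  by move=> t0; rewrite /d; do 2?case: ifP => _; rewrite ?oner_neq0 ?invr_neq0.
have SLg t : t != 0 -> inSL (g t).
  (* [P] and [W/Q] have the same dimension, so the powers of [t] cancel. *)
  move=> t0; have : dt (g t) = 1; last by [].
  rewrite /g dt_diag //.
  have -> : \prod_(i < m) d t i = \prod_(0 <= i < m) (if (i < \dim P)%N then t else
     if (i < \dim Q)%N then 1 else t^-1) by rewrite big_mkord.
  have lPQ := dimvS PQ; have lQ : (\dim Q <= m)%N by rewrite -dPQ leq_addl.
  rewrite (big_cat_nat (n := \dim P)) //= ?(leq_trans lPQ) //.
  rewrite (big_cat_nat (n := \dim Q) (m := \dim P)) //=.
  rewrite [X in X * _](eq_big_nat _ _ (F2 := fun=> t)); last by move=> i /andP[_ ->].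
  rewrite [X in _ * (X * _)](eq_big_nat _ _ (F2 := fun=> 1)); last first.
    by move=> i /andP[/leq_gtF -> ->].
  rewrite [X in _ * (_ * X)](eq_big_nat _ _ (F2 := fun=> t^-1)); last first.
    by move=> i /andP[li _]; rewrite !leq_gtF // (leq_trans lPQ).
  rewrite !prodr_const_nat subn0 expr1n mul1r.
  by rewrite -dPQ addnK -exprMn divff // expr1n.
(* The truncated subtraction is harmless: an entry of total weight below 2 pairs [P] with [Q] and
   vanishes, see [van]. *)
pose k (ij : 'I_m * 'I_m) := (wt ij.1 + wt ij.2 - 2)%N.
have [Psi evPsi Psi_lim] : exists2 Psi : K -> 'Hom('rV[K]_n.+1, bform W),
    (forall t v x y, ev (Psi t v) x y = \sum_ij t ^+ k ij *
      (ev (phi v) X`_ij.1 X`_ij.2 * (coord X ij.1 x * coord X ij.2 y)))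
    & (forall t, t != 0 -> SL_orbit phi (Psi t)) -> SL_orbit phi (Psi 0).
  pose psi (ij : 'I_m * 'I_m) := component phi X`_ij.1 X`_ij.2
    (tensor (linfun (coord X ij.1 : W -> K^o)) (linfun (coord X ij.2 : W -> K^o))).
  exists (poly_curve k psi) => [t v x y|]; last first.
    exact: zariski_closed_curve0 closed_phi.
  rewrite /poly_curve sum_lfunE.
  have evs I (r : seq I) (F : I -> bform W) :
      ev (\sum_(i <- r) F i) x y = \sum_(i <- r) ev (F i) x y.
    by rewrite /ev /= !sum_lfunE.
  rewrite evs; apply: eq_bigr => ij _; rewrite scale_lfunE evZ componentE evZ.
  by rewrite ev_tensor !lfunE.
have van v (i j : 'I_m) : (wt i + wt j < 2)%N -> ev (phi v) X`_i X`_j = 0.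
  move=> lt2; suff [ij | ij] : (i < \dim P)%N && (j < \dim Q)%N \/
      (j < \dim P)%N && (i < \dim Q)%N.
  - by case/andP: ij => li lj; apply: vanish; rewrite ?XP ?XQ.
  - case/andP: ij => li lj.
    have -> : ev (phi v) X`_i X`_j = - ev (phi v) X`_j X`_i by apply: skA.
    by rewrite vanish ?oppr0 ?XP ?XQ.
  have lPQ := dimvS PQ; move: lt2; rewrite /wt.
  case: (ltnP i (\dim P)) => iP; case: (ltnP j (\dim P)) => jP.
  - by left; apply: leq_trans lPQ.
  - by case: (ltnP j (\dim Q)) => //; left.
  - by case: (ltnP i (\dim Q)) => //; right.
  by case: (ltnP i (\dim Q)); case: (ltnP j (\dim Q)).
have evg t v x y : t != 0 -> ev (phi v) ((g t)^-1%VF x) ((g t)^-1%VF y) = \sum_ij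
    (d t ij.1)^-1 * (d t ij.2)^-1 *
    (ev (phi v) X`_ij.1 X`_ij.2 * (coord X ij.1 x * coord X ij.2 y)).
  move=> t0; rewrite /g diagV => [|//|i]; last exact: d0.
  rewrite (ev_coord bX); apply: eq_bigr => ij _; rewrite !coord_diag //.
  by ring.
have dk t i j v : t != 0 -> (d t i)^-1 * (d t j)^-1 * ev (phi v) X`_i X`_j =
    t ^+ k (i, j) * ev (phi v) X`_i X`_j.
  move=> t0; case: (ltnP (wt i + wt j) 2) => [/van -> | ]; first by rewrite !mulr0.
  rewrite /k /d /wt /=; case: (ltnP i (\dim P)) => _; case: (ltnP j (\dim P)) => _ //.
  - case: (ltnP j (\dim Q)) => _ // _.
    by rewrite invrK mulVf // expr0.
  - case: (ltnP i (\dim Q)) => _ // _.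
    by rewrite invrK mulfV // expr0.
  by case: (ltnP i (\dim Q)); case: (ltnP j (\dim Q)) => _ _ _;
    rewrite ?invr1 ?invrK ?mulr1 ?mul1r.
have orbit t : t != 0 -> SL_orbit phi (Psi t).
  move=> t0; exists (g t); first exact: SLg.
  move=> v; apply: (@ev_ext _ _ (bforms W)) => x y; rewrite ev_act evg // evPsi.
  by apply: eq_bigr => -[i j] _ /=; rewrite !mulrA dk.
have [h SLh Psi0] := Psi_lim orbit.
(* At parameter 0 only the entries of weight exactly 2 survive, and these are unchanged by [g t]. *)
have fixed t v : t != 0 -> act (g t) (Psi 0 v) = Psi 0 v.
  move=> t0; apply: (@ev_ext _ _ (bforms W)) => x y; rewrite ev_act !evPsi.
  apply: eq_bigr => -[i j] _ /=; rewrite /g diagV => [|//|l]; last exact: d0.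
  rewrite !coord_diag //.
  transitivity (0 ^+ k (i, j) * ((d t i)^-1 * (d t j)^-1 * ev (phi v) X`_i X`_j *
    (coord X i x * coord X j y))); first by ring.
  rewrite dk //; case: (k (i, j)) => [|l]; first by rewrite !expr0 !mul1r.
  by rewrite expr0n !mul0r.
(* As [h] carries [phi] to [Psi 0], conjugation by [h] brings the stabilizer of [Psi 0] back to that
   of [phi]. *)
pose f t := (h^-1 \o g t \o h)%VF.
have hK := inSL_lker SLh.
have fin t : t != 0 -> f t \in s.
  move=> t0; apply: stab_s.
    by apply: inSL_comp => //; apply: inSL_comp; [exact: inSL_inv | exact: SLg].
  move=> v; apply: (@ev_ext _ _ (bforms W)) => x y; rewrite ev_act.
  have fK : lker (f t) == 0%VS.
    apply: inSL_lker; apply: inSL_comp => //.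
    by apply: inSL_comp; [exact: inSL_inv | exact: SLg].
  have phiPsi a b : ev (phi v) a b = ev (Psi 0 v) (h a) (h b).
    by rewrite Psi0 ev_act !lker0_lfunK.
  have hf z : h ((f t)^-1%VF z) = (g t)^-1%VF (h z).
    rewrite -[in RHS](lker0_lfunVK fK z) /f !comp_lfunE lker0_lfunVK //.
    by rewrite lker0_lfunK //; exact: inSL_lker (SLg _ t0).
  by rewrite !phiPsi !hf -ev_act fixed.
(* The first basis vector lies in the nonzero space [P], where [g t] acts as [t]. *)
have f_inj : {in [pred t | t != 0] &, injective f}.
  move=> t t' _ _ /lfunP ff; have m0 : (0 < m)%N by rewrite -dPQ addn_gt0 P0.
  have gg x : g t x = g t' x.
    have := ff (h^-1%VF x); rewrite !comp_lfunE lker0_lfunVK //.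
    by move/(congr1 h); rewrite !lker0_lfunVK.
  have := gg X`_(Ordinal m0); rewrite /g !diagE // /d P0.
  move/eqP; rewrite -subr_eq0 -scalerBl scaler_eq0 subr_eq0 => /orP[/eqP // | X0].
  have /(basis_not0 bX) : X`_(Ordinal m0) \in X by apply: mem_nth; rewrite size_tuple.
  by rewrite X0.
pose fs := [seq f i.+1%:R | i <- iota 0 (size s).+1].
have ufs : uniq fs.
  rewrite map_inj_in_uniq ?iota_uniq // => i j _ _ /f_inj; rewrite !inE !pnatr_eq0.
  by move=> /(_ isT isT)/eqP; rewrite eqr_nat eqSS => /eqP.
have /(uniq_leq_size ufs) : {subset fs <= s}.
  by move=> _ /mapP[i _ ->]; apply: fin; rewrite pnatr_eq0.
by rewrite size_map size_iota ltnn.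
Qed.

End Destabilize.

(** * Forms of rank two *)

(** If [G] is invertible, an eigenvalue [a] of [F G^-1] makes [F - a G] singular; otherwise [G]
    itself is the singular member. *)
Lemma degenerate_pencil (K : fieldType)
    (closedK : forall p : {poly K}, size p != 1%N -> exists x, root p x)
    n (f g : nat -> nat -> K) : (0 < n)%N ->
  exists s t : K, (s != 0) || (t != 0) /\
  exists k : seq K, [/\ size k = n, k != nseq n 0
    & forall j, (j < n)%N -> \sum_(i < n) k`_i * (s * f i j + t * g i j) = 0].
Proof.
move=> n0; pose F : 'M[K]_n := \matrix_(i, j) f i j.
pose G : 'M[K]_n := \matrix_(i, j) g i j.
suff [s [t [st [v v0 vk]]]] : exists s t : K, (s != 0) || (t != 0) /\
    exists2 v : 'rV_n, v != 0 & v *m (s *: F + t *: G) = 0.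
  exists s, t; split => //; exists (mkseq (fun i => if insub i is Some j then v 0 j else 0) n).
  rewrite size_mkseq; split => // [|j jn].
    apply: contra v0 => /eqP/(congr1 (nth 0)) e; apply/eqP/rowP => j; rewrite mxE.
    by have := congr1 (fun h => h (val j)) e; rewrite /= nth_mkseq // nth_nseq if_same valK.
  have := congr1 (fun M : 'rV_n => M 0 (Ordinal jn)) vk; rewrite !mxE => e0; rewrite -[RHS]e0.
  by apply: eq_bigr => i _; rewrite nth_mkseq // valK !mxE.
have [uG | /negP nG] := boolP (G \in unitmx); last first.
  exists 0, 1; split; first by rewrite oner_neq0 orbT.
  have /det0P[v v0 vG] : \det G == 0 by rewrite -[_ == 0]negbK -unitfE -unitmxE; apply/negP.
  by exists v; rewrite // scale0r add0r scale1r.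
have /closedK[a ra] : size (char_poly (F *m invmx G)) != 1%N.
  by rewrite size_char_poly; case: n n0 {F G uG}.
exists 1, (- a); split; first by rewrite oner_neq0.
have /eigenvalueP[v vF v0] : eigenvalue (F *m invmx G) a by rewrite eigenvalue_root_char.
exists v => //; rewrite mulmxDr -!scalemxAr scale1r scaleNr.
by rewrite -[F](mulmxKV uG) mulmxA vF -scalemxAl subrr.
Qed.

Section FormPencil.
Variables (K : fieldType) (W : vectType K) (B : forms W).
Hypothesis closedK : forall p : {poly K}, size p != 1%N -> exists x, root p x.
Implicit Types (w : B) (u v x : W).

Lemma ev_lcl w k (s : seq W) y : size k = size s ->
  ev w (lc k s) y = \sum_(i < size s) k`_i * ev w s`_i y.
Proof.
elim: s k => [|x s IH] [|a k] //=; first by rewrite big_ord0 ev0l.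
by move=> [sk]; rewrite big_ord_recl evDl evZl IH.
Qed.

Lemma ev_lc k (s : seq (B)) x y : size k = size s ->
  ev (lc k s) x y = \sum_(i < size s) k`_i * ev s`_i x y.
Proof.
elim: s k => [|w s IH] [|a k] //=; first by rewrite big_ord0 ev0.
by move=> [sk]; rewrite big_ord_recl evD evZ IH.
Qed.

(** Rows are indexed by forms and columns by test vectors, so a null row vector of the degenerate
    member is a combination of forms, while the parameter of the pencil selects a vector of the span
    of [u] and [v]. *)
Lemma space_pencil (ws : seq (B)) (xs : seq W) u v :
  (0 < size ws)%N -> size ws = size xs ->
  exists s t : K, (s != 0) || (t != 0) /\ exists k : seq K,
    [/\ size k = size ws, k != nseq (size ws) 0
      & {in xs, forall x, ev (lc k ws) (s *: u + t *: v) x = 0}].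
Proof.
move=> ws0 wx; have [s [t [st [k [sk k0 E]]]]] := degenerate_pencil closedK
  (fun i j => ev ws`_i u xs`_j) (fun i j => ev ws`_i v xs`_j) ws0.
exists s, t; split=> //; exists k; split => // _ /(nthP 0)[j jx <-].
rewrite ev_lc // -[RHS](E j) ?wx //; apply: eq_bigr => i _.
by rewrite evDl !evZl.
Qed.

(** Here the pencil consists of Gram matrices on [xs], so the null row vector is a vector and the
    parameter selects a form. *)
Lemma pencil_kernel w1 w2 (xs : seq W) : (0 < size xs)%N ->
  exists s t : K, (s != 0) || (t != 0) /\ exists k : seq K,
    [/\ size k = size xs, k != nseq (size xs) 0
      & {in xs, forall x, ev (s *: w1 + t *: w2) (lc k xs) x = 0}].
Proof.
move=> xs0; have [s [t [st [k [sk k0 E]]]]] := degenerate_pencil closedK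
  (fun i j => ev w1 xs`_i xs`_j) (fun i j => ev w2 xs`_i xs`_j) xs0.
exists s, t; split=> //; exists k; split => // _ /(nthP 0)[j jx <-].
rewrite ev_lcl // -[RHS](E j) //; apply: eq_bigr => i _.
by rewrite evD !evZ.
Qed.

End FormPencil.

(** * Kernels of skew forms in dimension six *)

Section Kernels.
Variables (K : fieldType) (W : vectType K) (B : forms W).
Hypothesis char0 : forall n, n.+1%:R != 0 :> K.
Hypothesis dimW : \dim {:W} = 6%N.
Implicit Types (w : B) (u v x : W) (U : {vspace W}).

Lemma basis2 (V : vectType K) (U : {vspace V}) : \dim U = 2%N ->
  exists a b : V, basis_of U [:: a; b].
Proof.
move=> d; have [] // := basis_extend (n := 2) (U := U) (nil_free V).
move=> [[|a [|b []]] // ?]; by exists a, b.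
Qed.

Lemma ker_ev_basis w s u : basis_of {:W} s -> {in s, forall x, ev w u x = 0} -> u \in ker w.
Proof.
move=> bs h; apply: ker_ev => v; apply: (ev_span_r h).
by rewrite (span_basis bs) memvf.
Qed.

Lemma ker_compl_lc w (b c : seq W) k : <<b>>%VS = ker w -> free (b ++ c) ->
  size k = size c -> lc k c \in ker w -> k = nseq (size c) 0.
Proof.
move=> bw; rewrite cat_free => /and3P[_ fc /directv_addP bc] sk ck.
apply: free_lc => //; apply/eqP; rewrite -memv0 -bc memv_cap bw ck.
exact: lc_span.
Qed.

(** Parity of the rank, by hand: for [a], [b], [c] spanning a complement of the kernel, the
    combination with coefficients [w(b,c)], [-w(a,c)], [w(a,b)] lies in the kernel, so these entries
    vanish, and then [a] itself is in the kernel. *)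
Lemma dim_ker_neq3 w : skewf w -> \dim (ker w) <> 3%N.
Proof.
move=> sw d3; have sd := fun x => ev_diag char0 x sw; have sk := sw.
have bk := vbasisP (ker w).
have [||c bc] := basis_extend (n := 3) (U := fullv) (basis_free bk).
- by move=> v _; rewrite memvf.
- by rewrite size_tuple d3 dimW.
case: c bc => -[|a [|b [|c []]]] //= _ bc.
have kr y u : u \in vbasis (ker w) -> ev w y u = 0.
  by move/vbasis_mem => /ev_ker h; rewrite sk h oppr0.
have : lc [:: ev w b c; - ev w a c; ev w a b] [:: a; b; c] \in ker w.
  apply: (ker_ev_basis bc) => x; rewrite mem_cat => /orP[/kr // | ].
  rewrite !inE => /or3P[] /eqP -> /=; rewrite !evE !sd ?(sk b a) ?(sk c a) ?(sk c b); ring.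
move/(ker_compl_lc (span_basis bk) (basis_free bc)) => /(_ erefl)[ebc eac eab].
have : lc [:: 1; 0; 0] [:: a; b; c] \in ker w.
  apply: (ker_ev_basis bc) => x; rewrite mem_cat => /orP[/kr // | ].
  rewrite !inE => /or3P[] /eqP -> /=; rewrite !evE !sd ?eab; last move/eqP: eac;
   rewrite ?oppr_eq0; [ring|ring|by move/eqP => ->; ring].
move/(ker_compl_lc (span_basis bk) (basis_free bc)) => /(_ erefl)[/eqP].
by rewrite oner_eq0.
Qed.

Lemma dim_ker_neq5 w : skewf w -> \dim (ker w) <> 5%N.
Proof.
move=> sw d5; have sd := fun x => ev_diag char0 x sw; have sk := sw.
have bk := vbasisP (ker w).
have [||c bc] := basis_extend (n := 1) (U := fullv) (basis_free bk).
- by move=> v _; rewrite memvf.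
- by rewrite size_tuple d5 dimW.
case: c bc => -[|a []] //= _ bc.
have : lc [:: 1] [:: a] \in ker w.
  apply: (ker_ev_basis bc) => x; rewrite mem_cat /= addr0 scale1r inE.
  by case/orP => [/vbasis_mem/ev_ker h | /eqP ->]; rewrite ?sd // sk h oppr0.
move/(ker_compl_lc (span_basis bk) (basis_free bc)) => /(_ erefl)[/eqP].
by rewrite oner_eq0.
Qed.

(** With [c] completing [s] to a basis, the vectors of the isotropic 5-space that are orthogonal to
    [c] lie in the kernel, and they form a space of dimension at least 4. *)
Lemma isotropic5 w s : skewf w -> free s -> size s = 5%N ->
  {in s &, forall u v, ev w u v = 0} -> (4 <= \dim (ker w))%N.
Proof.
move=> sw fs s5 h; have [||c bc] := basis_extend (n := 1) (U := fullv) fs.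
- by move=> v _; rewrite memvf.
- by rewrite s5 dimW.
case: c bc => -[|c []] //= _ bc; have := dim_lker_functional (contract w c) <<s>>%VS.
rewrite (eqP fs) s5 ltnS => /leq_trans; apply; apply: dimvS.
apply/subvP => u; rewrite memv_cap memv_ker => /andP[us /eqP uc].
apply: (ker_ev_basis bc) => x; rewrite mem_cat inE => /orP[xs | /eqP ->].
  by apply: (ev_span sw h); rewrite // memv_span.
by rewrite sw -contractE uc oppr0.
Qed.

(** If the Pfaffian vanished, the rows of the Pfaffian adjugate would be null vectors of the Gram
    matrix on a complement of the kernel, hence zero. All entries pairing [a] would then vanish,
    putting [a] in the kernel. *)
Lemma pf4_neq0 w k1 k2 a b c d : skewf w -> basis_of (ker w) [:: k1; k2] ->
  basis_of {:W} [:: k1; k2; a; b; c; d] -> pf4 w a b c d != 0.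
Proof.
move=> sw bk bW; have sd := fun x => ev_diag char0 x sw; have sk := sw.
apply/eqP => p0.
have E k : size k = 4%N -> {in [:: a; b; c; d], forall x, ev w (lc k [:: a; b; c; d]) x = 0} ->
    forall i, k`_i = 0.
  move=> s4 h i; suff -> : k = nseq 4 0 by rewrite nth_nseq if_same.
  apply: (ker_compl_lc (span_basis bk) (basis_free bW)) => //.
  apply: (ker_ev_basis bW) => x.
  rewrite -[_ :: _]/([:: k1; k2] ++ [:: a; b; c; d]) mem_cat => /orP[xk | /h //].
  by rewrite sk ev_ker ?oppr0 // (basis_mem bk).
have h1 : forall i, [:: 0; ev w c d; - ev w b d; ev w b c]`_i = 0.
  apply: E => //.
  move=> x; rewrite !inE => /or4P[] /eqP -> /=; rewrite !evE !sd.
  - by apply: (lin0 p0 (-1)); rewrite /pf4 (sk b a) (sk c a) (sk d a); ring.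
  - by rewrite (sk c b) (sk d b); ring.
  - by rewrite (sk d c); ring.
  by ring.
have h2 : forall i, [:: ev w c d; 0; - ev w a d; ev w a c]`_i = 0.
  apply: E => //.
  move=> x; rewrite !inE => /or4P[] /eqP -> /=; rewrite !evE !sd.
  - by rewrite (sk c a) (sk d a); ring.
  - by apply: (lin0 p0 1); rewrite /pf4 (sk c b) (sk d b); ring.
  - by rewrite (sk d c); ring.
  by ring.
have h3 : forall i, [:: ev w b d; - ev w a d; 0; ev w a b]`_i = 0.
  apply: E => //.
  move=> x; rewrite !inE => /or4P[] /eqP -> /=; rewrite !evE !sd.
  - by rewrite (sk b a) (sk d a); ring.
  - by rewrite (sk d b); ring.
  - by apply: (lin0 p0 (-1)); rewrite /pf4 (sk d c); ring.
  by ring.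
have h4 : forall i, ([:: 1; 0; 0; 0] : seq K)`_i = 0.
  have e12 : ev w a b = 0 := h3 3%N; have e13 : ev w a c = 0 := h2 3%N.
  have e14 : ev w a d = 0 by apply/eqP; rewrite -oppr_eq0; apply/eqP/(h2 2%N).
  apply: E => // x; rewrite !inE => /or4P[] /eqP -> /=;
    by rewrite !evE ?sd ?e12 ?e13 ?e14; ring.
by have /eqP := h4 0%N; rewrite oner_eq0.
Qed.

(** The Pfaffian of [w0 + t w] is identically zero in [t], and its linear coefficient is the nonzero
    [pf4] of [w0] on a complement times the value of [w] on a basis of [ker w0]. *)
Lemma kernel_isotropic (A : {vspace B}) w0 w k1 k2 :
  {in A, forall w, skewf w} -> {in A, forall w, (2 <= \dim (ker w))%N} ->
  w0 \in A -> w \in A -> \dim (ker w0) = 2%N -> k1 \in ker w0 -> k2 \in ker w0 ->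
  ev w k1 k2 = 0.
Proof.
move=> skA rkA Aw0 Aw d2; have [b1 [b2 bk]] := basis2 d2.
have sd w' x : w' \in A -> ev w' x x = 0 by move=> /skA; apply: (ev_diag char0).
have sk w' : w' \in A -> forall x y, ev w' x y = - ev w' y x := fun h => skA w' h.
suff b12 : ev w b1 b2 = 0.
  rewrite -(span_basis bk); apply: ev_span; first exact: skA.
  move=> u v; rewrite !inE => /orP[] /eqP -> /orP[] /eqP ->; rewrite ?sd ?b12 //.
  by rewrite sk // b12 oppr0.
have [||c bc] := basis_extend (n := 4) (U := fullv) (basis_free bk).
- by move=> v _; rewrite memvf.
- by rewrite dimW.
case: c bc => -[|a [|b [|c [|d []]]]] //= _ bW.
have p0 := pf4_neq0 (skA _ Aw0) bk bW.
have kz b' x : b' \in [:: b1; b2] -> ev w0 x b' = 0.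
  by move=> /(basis_mem bk) kb; rewrite sk // ev_ker ?oppr0.
have z1 x : ev w0 x b1 = 0 by rewrite kz ?inE ?eqxx.
have z2 x : ev w0 x b2 = 0 by rewrite kz ?inE ?eqxx ?orbT.
pose P m12 m13 m14 m15 m16 m23 m24 m25 m26 m34 m35 m36 m45 m46 m56 : K :=
    m12 * (m34 * m56 - m35 * m46 + m36 * m45) - m13 * (m24 * m56 - m25 * m46 + m26 * m45)
    + m14 * (m23 * m56 - m25 * m36 + m26 * m35) - m15 * (m23 * m46 - m24 * m36 + m26 *
    m34) + m16 * (m23 * m45 - m24 * m35 + m25 * m34).
have pf t : P
    (ev w0 a b + t * ev w a b) (ev w0 a c + t * ev w a c) (ev w0 a d + t * ev w a d)
    (t * ev w a b1) (t * ev w a b2) (ev w0 b c + t * ev w b c) (ev w0 b d + t * ev w b d)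
    (t * ev w b b1) (t * ev w b b2) (ev w0 c d + t * ev w c d) (t * ev w c b1)
    (t * ev w c b2) (t * ev w d b1) (t * ev w d b2) (t * ev w b1 b2) = 0.
  have At : w0 + t *: w \in A by rewrite memvD // memvZ.
  have lin x y : ev w0 x y + t * ev w x y = ev (w0 + t *: w) x y by rewrite evD evZ.
  have lin1 x : t * ev w x b1 = ev (w0 + t *: w) x b1 by rewrite -lin z1 add0r.
  have lin2 x : t * ev w x b2 = ev (w0 + t *: w) x b2 by rewrite -lin z2 add0r.
  rewrite !lin1 !lin2 !lin -[LHS]/(pf6 (w0 + t *: w) a b c d b1 b2).
  by apply: (pf6_eq0 char0); [exact: skA | by rewrite dimW -{1}[6%N]add0n ltn_add2r ltnW ?rkA].
(* The Pfaffian is [c1 t + c2 t^2 + c3 t^3], without constant term because [b1], [b2] are in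
   [ker w0]. Six times its value at 1, minus twice that at -1, minus that at 2, is [6 c1]. *)
suff : 6%:R * (pf4 w0 a b c d * ev w b1 b2) = 0.
  by move/eqP; rewrite !mulf_eq0 (negPf (char0 5)) (negPf p0) /= => /eqP.
apply: (lin0 (pf 1) 6%:R); apply: (lin0 (pf (-1)) (- 2%:R)); apply: (lin0 (pf 2%:R) (-1)).
rewrite /P /pf4; ring.
Qed.

End Kernels.

Section RankTwo.
Variables (K : fieldType) (W : vectType K) (B : forms W) (A : {vspace B}).
Hypothesis closedK : forall p : {poly K}, size p != 1%N -> exists x, root p x.
Hypothesis char0 : forall n, n.+1%:R != 0 :> K.
Hypothesis dimW : \dim {:W} = 6%N.
Hypothesis dimA : \dim A = 5%N.
Hypothesis skA : {in A, forall w, skewf w}.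
Hypothesis rkA : {in A, forall w, (2 <= \dim (ker w))%N}.
Hypothesis ndA : forall P Q : {vspace W}, (P <= Q)%VS -> (0 < \dim P)%N ->
  (\dim P + \dim Q = 6)%N -> ~ {in A, forall w, {in P & Q, forall u v, ev w u v = 0}}.

Implicit Types (w : B) (k u v x y z p q c d : W).

Let sd w x : w \in A -> ev w x x = 0. Proof. by move=> /skA; apply: (ev_diag char0). Qed.
Let sk w : w \in A -> forall x y, ev w x y = - ev w y x.
Proof. by move=> /skA; by []. Qed.

(** * Impossibility of constant rank four *)

Section ConstantRank.
Hypothesis rk4 : {in A, forall w, w != 0 -> (\dim (ker w) < 4)%N}.

Lemma dim_ker w : w \in A -> w != 0 -> \dim (ker w) = 2%N.
Proof.
move=> Aw w0; have := rkA Aw; have := rk4 Aw w0; have := dim_ker_neq3 char0 dimW (skA Aw).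
by case: (\dim (ker w)) => [|[|[|[|]]]].
Qed.

Lemma kernelsP w0 w k1 k2 : w0 \in A -> w0 != 0 -> w \in A ->
  k1 \in ker w0 -> k2 \in ker w0 -> ev w k1 k2 = 0.
Proof.
by move=> A0 n0 Aw; apply: (kernel_isotropic char0 dimW skA rkA A0) => //; apply: dim_ker.
Qed.

(** Evaluate four forms completing [w0] to a basis of [A] on pairs of a vector of [ker w0] and one
    of a complement: a 4 by 4 pencil. Its degenerate member gives a vector of [ker w0] killed by a
    form [w] on the complement; on [ker w0] itself [w] vanishes by isotropy. *)
Lemma common_kernel : exists (k : W) (w1 w2 : B),
  [/\ k != 0, w1 \in A, w2 \in A, free [:: w1; w2] & k \in ker w1 /\ k \in ker w2].
Proof.
have [//|//|c bA] := basis_extend (n := 5) (U := A) (nil_free _).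
case: c bA => -[|w0 [|w1 [|w2 [|w3 [|w4 []]]]]] //= _ bA.
have Aw w : w \in [:: w0; w1; w2; w3; w4] -> w \in A by apply: (basis_mem bA).
have A0 : w0 \in A by rewrite Aw ?inE ?eqxx.
have n0 : w0 != 0 by apply: (basis_not0 bA); rewrite inE eqxx.
have [k1 [k2 bk]] := basis2 (dim_ker A0 n0).
have [||c bW] := basis_extend (n := 4) (U := fullv) (basis_free bk).
- by move=> v _; rewrite memvf.
- by rewrite dimW.
case: c bW => -[|a [|b [|c [|d []]]]] //= _ bW.
have [s [t [st [k [sk4 k0 E]]]]] :=
  @space_pencil K W B closedK [:: w1; w2; w3; w4] [:: a; b; c; d] k1 k2 isT erefl.
case: k sk4 k0 E => [|x1 [|x2 [|x3 [|x4 []]]]] // _ k0 E.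
pose w := lc [:: x1; x2; x3; x4] [:: w1; w2; w3; w4].
have Aw' : w \in A.
  rewrite -(span_basis bA) span_cons; apply: (subvP (addvSr _ _)); exact: lc_span.
have kk1 : k1 \in ker w0 by rewrite (basis_mem bk) ?inE ?eqxx.
have kk2 : k2 \in ker w0 by rewrite (basis_mem bk) ?inE ?eqxx ?orbT.
have kk : s *: k1 + t *: k2 \in ker w0 by rewrite memvD // memvZ.
exists (s *: k1 + t *: k2), w0, w; split => //.
- apply/negP => /eqP e.
  have e' : lc [:: s; t] [:: k1; k2] = 0 by rewrite -[RHS]e /= addr0.
  have [s0 t0] := free_lc (basis_free bk) e' erefl.
  by move: st; rewrite s0 t0 eqxx.
- apply: lc_free => -[|a1 [|a2 []]] //= _ e.
  have e' : lc [:: a1; a2 * x1; a2 * x2; a2 * x3; a2 * x4] [:: w0; w1; w2; w3; w4] = 0.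
    by rewrite -[RHS]e addr0 /w lcZ.
  have [-> e1 e2 e3 e4] := free_lc (basis_free bA) e' erefl.
  congr [:: _; _]; apply/eqP; apply: contraNT k0 => a20.
  have z (y : K) : a2 * y = 0 -> y = 0 by move/eqP; rewrite mulf_eq0 (negPf a20) => /eqP.
  by rewrite (z _ e1) (z _ e2) (z _ e3) (z _ e4).
split => //; apply: (ker_ev_basis bW) => x.
by rewrite inE => /orP[/eqP ->|]; last (rewrite inE => /orP[/eqP ->|]; last exact: E);
  exact: (kernelsP A0).
Qed.

Lemma pencil_nz w1 w2 (s t : K) : w1 \in A -> w2 \in A -> free [:: w1; w2] ->
  (s != 0) || (t != 0) -> s *: w1 + t *: w2 \in A /\ s *: w1 + t *: w2 != 0.
Proof.
move=> A1 A2 fw st; split; first by rewrite memvD // memvZ.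
apply/negP => /eqP e; have e' : lc [:: s; t] [:: w1; w2] = 0 by rewrite -[RHS]e /= addr0.
by have [s0 t0] := free_lc fw e' erefl; move: st; rewrite s0 t0 eqxx.
Qed.

Lemma basis_ker (k : W) w : w \in A -> w != 0 -> k != 0 -> k \in ker w ->
  exists u : W, basis_of (ker w) [:: k; u].
Proof.
move=> Aw w0 k0 kw; have fk : free [:: k] by rewrite seq1_free.
have [||c bc] := basis_extend (n := 1) (U := ker w) fk.
- by move=> v; rewrite inE => /eqP ->.
- exact: dim_ker.
by case: c bc => -[|u []] //= _ bc; exists u.
Qed.

Lemma three_kernels (k : W) w1 w2 : k != 0 -> w1 \in A -> w2 \in A -> free [:: w1; w2] ->
  k \in ker w1 -> k \in ker w2 ->
  exists u v z : W, [/\ free [:: z; v; u; k], u \in ker w1, v \in ker w2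
    & z \in ker (w1 + w2)].
Proof.
move=> k0 A1 A2 fw k1 k2.
have pnz s t := @pencil_nz w1 w2 s t A1 A2 fw.
have [A12 n12] : w1 + w2 \in A /\ w1 + w2 != 0.
  by have := pnz 1 1; rewrite !scale1r oner_neq0 => /(_ isT).
have n1 : w1 != 0 by apply: (free_not0 fw); rewrite inE eqxx.
have n2 : w2 != 0 by apply: (free_not0 fw); rewrite !inE eqxx orbT.
have [u bu] := basis_ker A1 n1 k0 k1; have [v bv] := basis_ker A2 n2 k0 k2.
have k12 : k \in ker (w1 + w2).
  by apply: ker_ev => x; rewrite evD !ev_ker ?addr0.
have [z bz] := basis_ker A12 n12 k0 k12.
have u1 : u \in ker w1 by rewrite (basis_mem bu) ?inE ?eqxx ?orbT.
have v2 : v \in ker w2 by rewrite (basis_mem bv) ?inE ?eqxx ?orbT.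
have z12 : z \in ker (w1 + w2) by rewrite (basis_mem bz) ?inE ?eqxx ?orbT.
have fuk : free [:: u; k] by rewrite free_swap (basis_free bu).
have fvk : free [:: v; k] by rewrite free_swap (basis_free bv).
have fzk : free [:: z; k] by rewrite free_swap (basis_free bz).
have suk : <<[:: u; k]>>%VS = ker w1.
  by rewrite -(span_basis bu); apply: eq_span => x; rewrite !inE orbC.
have svk : <<[:: v; k]>>%VS = ker w2.
  by rewrite -(span_basis bv); apply: eq_span => x; rewrite !inE orbC.
(* If [v] lay in [ker w1], the whole pencil would have kernel spanned by [k] and [v], and the
   degenerate member of its Gram matrices on the complement [c] would have a larger kernel. *)
have fvuk : free [:: v; u; k].
  rewrite free_cons fuk andbT suk; apply/negP => v1.
  have [||c bW] := basis_extend (n := 4) (U := fullv) (basis_free bv).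
  - by move=> y _; rewrite memvf.
  - by rewrite dimW.
  have [|s [t [st [x [sx x0 E]]]]] := @pencil_kernel K W B closedK w1 w2 c.
  - by rewrite size_tuple.
  pose w := s *: w1 + t *: w2; have [Aw n0] : w \in A /\ w != 0 := pnz s t st.
  have kw : k \in ker w by apply: ker_ev => y; rewrite evD !evZ !ev_ker // !mulr0 addr0.
  have vw : v \in ker w by apply: ker_ev => y; rewrite evD !evZ !ev_ker // !mulr0 addr0.
  have sw : <<[:: k; v]>>%VS = ker w.
    apply/eqP; rewrite eqEdim dim_ker // (eqP (basis_free bv)) leqnn andbT.
    by apply/span_subvP => y; rewrite !inE => /orP[] /eqP ->.
  case/eqP: x0.
  apply: (ker_compl_lc sw (basis_free bW)) => //.
  apply: (ker_ev_basis bW) => y; rewrite mem_cat => /orP[|/E //].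
  by rewrite sk // => yk; rewrite ev_ker ?oppr0 // -sw memv_span.
(* If [z = al v + be u + de k], the functionals [w1 v] and [w2 u] are proportional, and
   some member of the pencil has the kernel [H] of [w2 u] as an isotropic 5-space. *)
exists u, v, z; split => //; rewrite free_cons fvuk andbT.
apply/negP => /span_lc[[|al [|be [|de []]]]] // _ /= zE.
have zx x : al * ev w1 v x + be * ev w2 u x = 0.
  have := ev_ker z12 x; rewrite zE.
  rewrite evD !evDl !evZl !ev0l (ev_ker u1) (ev_ker v2) (ev_ker k1) (ev_ker k2) => e.
  by rewrite -[RHS]e; ring.
have al0 : al != 0.
  apply/negP => /eqP a0; move: zx zE; rewrite a0 scale0r add0r addr0 => zx zE.
  have [b0 | b0] := eqVneq be 0.
    move: fzk; rewrite zE b0 scale0r add0r free_cons => /andP[/negP]; case.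
    by rewrite memvZ // memv_span ?inE.
  move: fvuk; rewrite free_swap free_cons svk => /andP[/negP[]]; apply: ker_ev => x.
  have /eqP := zx x; rewrite mul0r add0r mulf_eq0 (negPf b0) => /eqP //.
have be0 : be != 0.
  apply/negP => /eqP b0; move: fvuk; rewrite free_cons suk => /andP[/negP[]].
  apply: ker_ev => x; have /eqP := zx x.
  by rewrite b0 mul0r addr0 mulf_eq0 (negPf al0) => /eqP.
pose H := lker (contract w2 u).
have HE x : (x \in H) = (ev w2 u x == 0) by rewrite memv_ker contractE.
have Hv x : x \in H -> ev w1 v x = 0.
  rewrite HE => /eqP h; have /eqP := zx x.
  by rewrite h mulr0 addr0 mulf_eq0 (negPf al0) => /eqP.
have dH : \dim H = 5%N.
  have := dim_lker_functional (contract w2 u) fullv; rewrite capfv dimW ltnS.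
  have := dimvS (subvf H); rewrite dimW leq_eqVlt => /orP[/eqP d6 | lt le]; last first.
    by apply/eqP; rewrite eqn_leq le -ltnS lt.
  case/negP: be0; apply/negPn.
  have /eqP HW : H == fullv by rewrite eqEdim subvf dimW d6.
  have u2 : u \in ker w2 by apply: ker_ev => x; apply/eqP; rewrite -HE HW memvf.
  by have := fvuk; rewrite free_swap free_cons svk u2.
have [||c bH] := basis_extend (n := 2) (U := H) fvuk.
- move=> y; rewrite !inE HE => /or3P[] /eqP ->; last by rewrite sk // ev_ker ?oppr0.
  + by rewrite sk // ev_ker ?oppr0.
  by rewrite sd.
- by rewrite dH.
case: c bH => -[|x [|y []]] //= _ bH.
have [s [t [st E]]] : exists s t : K, (s != 0) || (t != 0) /\ s * ev w1 x y + t * ev w2 x y = 0.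
  have [e1|e1] := eqVneq (ev w1 x y) 0.
    by exists 1, 0; rewrite oner_neq0 e1; split => //; ring.
  exists (ev w2 x y), (- ev w1 x y); rewrite oppr_eq0 e1 orbT; split => //; ring.
pose w := s *: w1 + t *: w2; have [Aw n0] : w \in A /\ w != 0 := pnz s t st.
have := rk4 Aw n0; rewrite ltnNge; move/negP; apply.
apply: (isotropic5 dimW (skA Aw) (basis_free bH)) => //.
have hx : x \in H by rewrite (basis_mem bH) // !inE eqxx !orbT.
have hy : y \in H by rewrite (basis_mem bH) // !inE eqxx !orbT.
have kk q : ev w k q = 0 by rewrite evD !evZ !ev_ker // !mulr0 addr0.
have uH q : q \in H -> ev w u q = 0.
  by rewrite HE => /eqP h; rewrite evD !evZ h ev_ker // !mulr0 addr0.
have vH q : q \in H -> ev w v q = 0.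
  by move=> /Hv h; rewrite evD !evZ h ev_ker // !mulr0 addr0.
have xy : ev w x y = 0 by rewrite evD !evZ.
move=> p q pc qc; have pH := basis_mem bH pc; have qH := basis_mem bH qc.
move: pc qc; rewrite !inE => pc qc.
case/or4P: pc => [/eqP -> | /eqP -> | /eqP -> | pc]; rewrite ?uH ?vH ?kk //.
case/or4P: qc => [/eqP -> | /eqP -> | /eqP -> | qc]; rewrite ?(sk Aw p) ?uH ?vH ?kk ?oppr0 //.
case/orP: pc => /eqP ->; case/orP: qc => /eqP ->;
  by rewrite ?(sk Aw y x) ?sd // ?xy ?oppr0.
Qed.

Lemma rank_lt4_false : False.
Proof.
have [k [w1 [w2 [k0 A1 A2 fw [k1 k2]]]]] := common_kernel.
have [u [v [z [fT u1 v2 z12]]]] := three_kernels k0 A1 A2 fw k1 k2.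
have n1 : w1 != 0 by apply: (free_not0 fw); rewrite inE eqxx.
have n2 : w2 != 0 by apply: (free_not0 fw); rewrite !inE eqxx orbT.
have [A12 n12] : w1 + w2 \in A /\ w1 + w2 != 0.
  by have := pencil_nz (s := 1) (t := 1) A1 A2 fw; rewrite !scale1r oner_neq0 => /(_ isT).
have k12 : k \in ker (w1 + w2).
  by apply: ker_ev => x; rewrite evD !ev_ker ?addr0.
(* [T] contains the kernel of every form of [A] that kills [k], and is isotropic for all
   these forms; the pencil lemma extends it to an isotropic 5-space of one of them. *)
pose T := <<[:: z; v; u; k]>>%VS.
have kT : {in A & T, forall w x, ev w k x = 0}.
  move=> w x Aw; apply: ev_span_r => y; rewrite !inE.
  case/or4P => /eqP ->; last exact: sd.
  - exact: (kernelsP A12).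
  - exact: (kernelsP A2).
  exact: (kernelsP A1).
(* Otherwise all forms vanish on the pair of the line of [k] and the 5-space spanned by [q] and [T],
   against stability. *)
have nT q : q \notin T -> exists2 w, w \in A & ev w k q != 0.
  move=> qT; apply: boolp.contrapT => nE.
  have kA w : w \in A -> ev w k q = 0.
    by move=> Aw; apply/eqP; apply: boolp.contrapT => /negP ne; apply: nE; exists w.
  have fq : free [:: q; z; v; u; k] by rewrite free_cons qT.
  apply: (ndA (P := <[k]>%VS) (Q := <<[:: q; z; v; u; k]>>%VS)).
  - by apply/subvP => _ /vlineP[a ->]; rewrite memvZ // memv_span // !inE eqxx !orbT.
  - by rewrite dim_vline k0.
  - by rewrite dim_vline k0 (eqP fq).
  move=> w Aw _ y /vlineP[a ->] yQ; rewrite evZl.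
  suff -> : ev w k y = 0 by rewrite mulr0.
  apply: (ev_span_r _ yQ) => x; rewrite inE => /orP[/eqP -> | xT]; first exact: kA.
  by apply: kT; rewrite // memv_span.
have [||c bW] := basis_extend (n := 2) (U := fullv) fT.
- by move=> y _; rewrite memvf.
- by rewrite dimW.
case: c bW => -[|x [|y []]] //= _ bW.
(* Every form of [A] vanishes on [k] against [T], so killing [k] amounts to the two conditions at
   [x] and [y]. *)
pose Ak := (A :&: lker (eval B k x) :&: lker (eval B k y))%VS.
have dAk : (3 <= \dim Ak)%N.
  have := dim_lker_functional (eval B k x) A; rewrite dimA ltnS => h1.
  by have := leq_trans h1 (dim_lker_functional (eval B k y) _); rewrite ltnS.
have AkP w : w \in Ak -> w \in A /\ k \in ker w.
  move=> hw; have [Aw kx ky] : [/\ w \in A, ev w k x = 0 & ev w k y = 0].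
    by move: hw; rewrite !memv_cap !memv_ker !evalE => /andP[/andP[? /eqP ?] /eqP ?].
  split=> //.
  apply: (ker_ev_basis bW) => p.
  rewrite -[_ :: _]/([:: z; v; u; k] ++ [:: x; y]) mem_cat => /orP[pT | ].
    by apply: kT; rewrite // memv_span.
  by rewrite !inE => /orP[] /eqP ->.
(* Kernels are isotropic for all of [A], so everything in a kernel through [k] is orthogonal to [k]
   for all forms, hence in [T] by [nT]. *)
have lkT w q : w \in Ak -> w != 0 -> q \in ker w -> q \in T.
  move=> /AkP[Aw kw] w0 qw; apply/negPn/negP => /nT[w' Aw' /eqP]; apply.
  exact: (kernelsP Aw).
have isoT w : w \in Ak -> {in T &, forall p q, ev w p q = 0}.
  move=> Akw; have [Aw kw] := AkP w Akw.
  have [->|w0] := eqVneq w 0; first by move=> p q _ _; rewrite ev0.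
  have fw1 : free [:: w] by rewrite seq1_free.
  have /subvPn[w' Akw' ww'] : ~~ (Ak <= <<[:: w]>>)%VS.
    by apply/negP => /dimvS; rewrite (eqP fw1) leqNgt (leq_trans _ dAk).
  have [Aw' kw'] := AkP w' Akw'.
  have fw2 : free [:: w'; w] by rewrite free_cons ww'.
  have [u' [v' [z' [fT' u1' v2' z12']]]] := three_kernels k0 Aw' Aw fw2 kw' kw.
  have w'0 : w' != 0 by apply: (free_not0 fw2); rewrite inE eqxx.
  have [_ nww] := pencil_nz (s := 1) (t := 1) Aw' Aw fw2 (introT orP (or_introl (oner_neq0 _))).
  rewrite !scale1r in nww.
  have -> : T = <<[:: z'; v'; u'; k]>>%VS.
    apply/eqP; rewrite eq_sym eqEdim (eqP fT) (eqP fT') leqnn andbT.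
    apply/span_subvP => p; rewrite !inE => /or4P[] /eqP ->.
    - by apply: (lkT (w' + w)); rewrite // memvD.
    - exact: (lkT w).
    - exact: (lkT w').
    by rewrite memv_span // !inE eqxx !orbT.
  apply: ev_span; first exact: skA.
  (* On [z'] the forms [w] and [- w'] agree, and [w'] kills [u']. *)
  have uz : ev w u' z' = 0.
    rewrite (sk Aw); have := ev_ker z12' u'; rewrite evD => /eqP.
    by rewrite addrC addr_eq0 (sk Aw' z') (ev_ker u1') oppr0 oppr0 => /eqP ->; rewrite oppr0.
  have zu : ev w z' u' = 0 by rewrite (sk Aw) uz oppr0.
  move=> p q; rewrite !inE.
  have kp a : ev w k a = 0 by rewrite ev_ker.
  have pk a : ev w a k = 0 by rewrite (sk Aw) kp oppr0.
  have vp a : ev w v' a = 0 by rewrite ev_ker.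
  have pv a : ev w a v' = 0 by rewrite (sk Aw) vp oppr0.
  by case/or4P => /eqP ->; case/or4P => /eqP ->; rewrite ?kp ?pk ?vp ?pv ?sd.
have [a1 [a2 [a3 [fa Aka]]]] : exists a1 a2 a3 : B,
    free [:: a1; a2; a3] /\ {subset [:: a1; a2; a3] <= Ak}.
  have := vbasisP Ak; case: (vbasis Ak) => -[|a1 [|a2 [|a3 l]]] //=;
    try by move=> /eqP e; rewrite -e in dAk.
  move=> _ bl; exists a1, a2, a3; split.
    by have := basis_free bl; rewrite (cat_free [:: a1; a2; a3]) => /andP[].
  move=> p pl; apply: (basis_mem bl); move: pl; rewrite !inE.
  by case/or3P => ->; rewrite ?orbT.
(* Three forms killing [k] against the three remaining generators of [T]: the degenerate member
   yields a form [w] and a vector [r] outside [T] orthogonal to [T] under [w]. *)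
have [s [t [st [l [sl l0 E]]]]] := @space_pencil K W B closedK [:: a1; a2; a3]
  [:: z; v; u] x y isT erefl.
pose w := lc l [:: a1; a2; a3]; pose r := s *: x + t *: y.
have Akw : w \in Ak.
  by apply: (subvP (_ : <<[:: a1; a2; a3]>> <= Ak)%VS); [exact/span_subvP | exact: lc_span].
have [Aw kw] := AkP w Akw.
have w0 : w != 0 by apply: contra l0 => /eqP e; rewrite (free_lc fa e sl).
have fr : free [:: r; z; v; u; k].
  rewrite free_cons fT andbT; apply/negP => /span_lc[[|b1 [|b2 [|b3 [|b4 []]]]]] // _.
  move/eqP; rewrite -subr_eq0 => /eqP e.
  have e' : lc [:: - b1; - b2; - b3; - b4; s; t] [:: z; v; u; k; x; y] = 0.
    rewrite -[RHS]e /= /r !scaleNr !addr0 !opprD [RHS]addrC -!addrA.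
    by do 4!congr (_ + _).
  have [_ _ _ _ s0 t0] := free_lc (basis_free bW) e' erefl.
  by move: st; rewrite s0 t0 eqxx.
have := rk4 Aw w0; rewrite ltnNge => /negP; apply.
apply: (isotropic5 dimW (skA Aw) fr) => //.
have rT q : q \in [:: z; v; u; k] -> ev w r q = 0.
  rewrite -[_ :: _]/([:: z; v; u] ++ [:: k]) mem_cat => /orP[/E // | ].
  by rewrite inE (sk Aw) => /eqP ->; rewrite ev_ker ?oppr0.
move=> p q; rewrite inE => /orP[/eqP -> | pT]; rewrite inE => /orP[/eqP -> | qT].
- exact: sd.
- exact: rT.
- by rewrite (sk Aw) rT ?oppr0.
by apply: isoT; rewrite // memv_span.
Qed.

End ConstantRank.

Lemma exists_rank2 : exists w, [/\ w \in A, w != 0 & (4 <= \dim (ker w))%N].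
Proof.
apply: boolp.contrapT => ne; apply: rank_lt4_false => w Aw w0.
by rewrite ltnNge; apply/negP => d4; apply: ne; exists w.
Qed.

End RankTwo.

(** * Linear forms with quadratic relations *)

Section Functionals.
Variables (K : fieldType) (V : vectType K).
Hypothesis char0 : forall n, n.+1%:R != 0 :> K.
Implicit Types (U : {vspace V}).

(** A predicate on bare functions, so that evaluations of forms and combinations of them need not be
    packaged as linear maps. *)
Definition linf (f : V -> K) := forall (a : K) x y, f (a *: x + y) = a * f x + f y.

Lemma linfD f x y : linf f -> f (x + y) = f x + f y.
Proof. by move=> h; have := h 1 x y; rewrite scale1r mul1r. Qed.

Lemma linf0 f : linf f -> f 0 = 0.
Proof.
move=> h; have := linfD 0 0 h; rewrite addr0 => /eqP.
by rewrite addrC -subr_eq subrr eq_sym => /eqP.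
Qed.

Lemma linf_sum f I (r : seq I) (k : I -> K) (x : I -> V) : linf f ->
  f (\sum_(i <- r) k i *: x i) = \sum_(i <- r) k i * f (x i).
Proof.
by move=> h; elim: r => [|i r IH]; rewrite ?big_nil ?linf0 // !big_cons h IH.
Qed.

(** Independence of the functionals on [U] says that the matrix of their values on a basis of [U]
    has full column rank. *)
Lemma functionals_onto n (f : 'I_n -> V -> K) U : (forall i, linf (f i)) ->
  (forall k : 'I_n -> K, {in U, forall x, \sum_i k i * f i x = 0} -> forall i, k i = 0) ->
  forall t : 'I_n -> K, exists2 x, x \in U & forall i, f i x = t i.
Proof.
move=> lf h t; pose G := \matrix_(j < \dim U, i < n) f i (vbasis U)`_j.
have ev (y : 'rV_(\dim U)) i : f i (\sum_j y 0 j *: (vbasis U)`_j) = (y *m G) 0 i.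
  by rewrite linf_sum // !mxE; apply: eq_bigr => j _; rewrite mxE.
have /row_fullP[B BG] : row_full G.
  rewrite /row_full -mxrank_tr -[_ == _]/(row_free G^T) -kermx_eq0.
  apply/eqP/row_matrixP => r; rewrite row0; apply/rowP => i; rewrite [RHS]mxE.
  apply: (h (fun i => row r (kermx G^T) 0 i)) => x xU.
  rewrite (coord_vbasis xU).
  have : row r (kermx G^T) *m G^T = 0 by rewrite -row_mul mulmx_ker row0.
  move=> /rowP e; under eq_bigr => l _ do rewrite linf_sum // mulr_sumr.
  rewrite exchange_big big1 //= => j _.
  have e0 : \sum_l row r (kermx G^T) 0 l * f l (vbasis U)`_j = 0.
    have := e j; rewrite [RHS]mxE [LHS]mxE => e1; rewrite -[RHS]e1.
    by apply: eq_bigr => l _; rewrite [G^T _ _]mxE [G _ _]mxE.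
  transitivity (coord (vbasis U) j x * \sum_l row r (kermx G^T) 0 l * f l (vbasis U)`_j).
    by rewrite mulr_sumr; apply: eq_bigr => l _; rewrite mulrCA.
  by rewrite e0 mulr0.
pose y := (\row_i t i) *m B.
exists (\sum_j y 0 j *: (vbasis U)`_j) => [|i].
  by apply: memv_suml => j _; rewrite memvZ // vbasis_mem // mem_nth // size_tuple.
by rewrite ev /y -mulmxA BG mulmx1 mxE.
Qed.

Lemma functionals_relation n (f : 'I_n -> V -> K) U : (forall i, linf (f i)) ->
  (\dim U < n)%N ->
  exists k : 'I_n -> K, {in U, forall x, \sum_i k i * f i x = 0} /\ exists i, k i != 0.
Proof.
move=> lf dU; apply: boolp.contrapT => ne.
have H (k : 'I_n -> K) : {in U, forall x, \sum_i k i * f i x = 0} -> forall i, k i = 0.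
  move=> hk i; apply/eqP; apply: boolp.contrapT => /negP ki; apply: ne.
  by exists k; split => //; exists i.
have onto := functionals_onto lf H.
have /boolp.choice[g gP] : forall j : 'I_n, exists x, x \in U /\ forall i, f i x = (i == j)%:R.
  by move=> j; have [x xU xE] := onto (fun i => (i == j)%:R); exists x.
have : (size [tuple g j | j < n] <= \dim U)%N.
  rewrite -(_ : \dim <<[tuple g j | j < n]>> = size [tuple g j | j < n]).
    by apply/dimvS/span_subvP => _ /tnthP[j ->]; rewrite tnth_mktuple; case: (gP j).
  have gE (j : 'I_n) : [tuple g j | j < n]`_j = g j by rewrite -tnth_nth tnth_mktuple.
  apply/eqP/freeP => k k0 i; have := linf0 (lf i); rewrite -[in X in X = _]k0.
  rewrite linf_sum // (bigD1 i isT) gE (gP i).2 eqxx mulr1.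
  rewrite big1 => [|j ji]; first by rewrite /= addr0.
  rewrite gE (gP j).2.
  by rewrite eq_sym (negPf ji) mulr0.
by rewrite size_tuple leqNgt dU.
Qed.

(** A vector space is not the union of two proper subspaces: at a point [x] with [f x] nonzero [g]
    vanishes, and the product at [x + y] reduces to [f x * g y]. *)
Lemma linf_mul_eq0 U f g : linf f -> linf g -> {in U, forall x, f x * g x = 0} ->
  {in U, forall x, f x = 0} \/ {in U, forall x, g x = 0}.
Proof.
move=> lf lg fg; have [|ne] := boolp.pselect {in U, forall x, f x = 0}; first by left.
right=> y yU; have [x xU fx] : exists2 x, x \in U & f x != 0.
  apply: boolp.contrapT => nx; apply: ne => x xU; apply/eqP.
  by apply: boolp.contrapT => /negP fx; apply: nx; exists x.
have gx : g x = 0 by have /eqP := fg x xU; rewrite mulf_eq0 (negPf fx) => /eqP.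
apply/eqP; have /eqP := fg (x + y) (memvD xU yU); rewrite !linfD // gx add0r mulrDl.
by rewrite fg // addr0 mulf_eq0 (negPf fx).
Qed.

(** A quadratic form [q] together with its polar form [b], kept explicit because later formulas use
    it. *)
Definition quadf (q : V -> K) (b : V -> V -> K) :=
  forall (a : K) x y, q (a *: x + y) = a ^+ 2 * q x + a * b x y + q y.

Lemma quadf_sum3 (f1 f2 f3 g1 g2 g3 : V -> K) :
  linf f1 -> linf f2 -> linf f3 -> linf g1 -> linf g2 -> linf g3 ->
  quadf (fun x => f1 x * g1 x + f2 x * g2 x + f3 x * g3 x)
    (fun x y => f1 x * g1 y + f2 x * g2 y + f3 x * g3 y +
                (f1 y * g1 x + f2 y * g2 x + f3 y * g3 x)).
Proof.
by move=> l1 l2 l3 l4 l5 l6 a x y; rewrite l1 l2 l3 l4 l5 l6; ring.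
Qed.

Lemma half_eq0 (x : K) : x + x = 0 -> x = 0.
Proof. by move/eqP; rewrite -mulr2n -mulr_natl mulf_eq0 (negPf (char0 1)) => /eqP. Qed.

(** Off the hyperplane [f = 0] the form [q] vanishes outright. For [x] on the hyperplane, adding the
    values at [z + x] and [- z + x] cancels the polar term and leaves [2 q x]. *)
Lemma linf_quad_eq0 U f q b z : linf f -> quadf q b -> z \in U -> f z != 0 ->
  {in U, forall x, f x * q x = 0} -> {in U, forall x, q x = 0}.
Proof.
move=> lf lq zU fz fq x xU.
have nz y : y \in U -> f y != 0 -> q y = 0.
  by move=> yU fy; have /eqP := fq y yU; rewrite mulf_eq0 (negPf fy) => /eqP.
have [fx|/nz] := eqVneq (f x) 0; last by apply.
have q1 : q (1 *: z + x) = 0.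
  by apply: nz; [rewrite memvD ?memvZ | rewrite lf fx mul1r addr0].
have q2 : q (- 1 *: z + x) = 0.
  by apply: nz; [rewrite memvD ?memvZ | rewrite lf fx mulN1r addr0 oppr_eq0].
move: q1 q2; rewrite !lq (nz _ zU fz) => q1 q2; apply: half_eq0.
by apply: (lin0 q1 1); apply: (lin0 q2 1); ring.
Qed.

(** Where [s] vanishes so does [t q], hence [q], because [t] is not zero on that hyperplane. So [s]
    divides [q], and cancelling [s] gives [r]; the zeros of [s] are again reached by symmetric
    differences. *)
Lemma proportional_quadratics U s t q r bq br x1 x2 :
  linf s -> linf t -> quadf q bq -> quadf r br -> (forall y, linf (bq^~ y)) ->
  x1 \in U -> x2 \in U -> s x1 = 1 -> t x1 = 0 -> s x2 = 0 -> t x2 = 1 ->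
  {in U, forall x, s x * r x = t x * q x} ->
  exists2 m, linf m & {in U, forall x, q x = s x * m x /\ r x = t x * m x}.
Proof.
move=> ls lt lq lr lb x1U x2U s1 t1 s2 t2 E.
have q0 x : x \in U -> s x = 0 -> q x = 0.
  move=> xU sx; have nz y : y \in U -> s y = 0 -> t y != 0 -> q y = 0.
    move=> yU sy ty; have /esym/eqP := E y yU.
    by rewrite sy mul0r mulf_eq0 (negPf ty) => /eqP.
  have [tx|] := eqVneq (t x) 0; last exact: nz.
  have q2 : q x2 = 0 by apply: nz; rewrite ?t2 ?oner_neq0.
  have e1 : q (1 *: x2 + x) = 0.
    apply: nz; first by rewrite memvD ?memvZ.
      by rewrite ls s2 sx; ring.
    by rewrite lt t2 tx mul1r addr0 oner_neq0.
  have e2 : q (- 1 *: x2 + x) = 0.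
    apply: nz; first by rewrite memvD ?memvZ.
      by rewrite ls s2 sx; ring.
    by rewrite lt t2 tx mulN1r addr0 oppr_eq0 oner_neq0.
  move: e1 e2; rewrite !lq q2 => e1 e2; apply: half_eq0.
  by apply: (lin0 e1 1); apply: (lin0 e2 1); ring.
have b11 : bq x1 x1 = 2%:R * q x1.
  have e0 : q 0 = 0.
    have := lq (-1) 0 0; rewrite scaler0 addr0 (linf0 (lb 0)) => e.
    by apply: (lin0 e (-1)); ring.
  have := lq (-1) x1 x1; rewrite scaleN1r addNr e0 => e.
  by apply/eqP; rewrite -subr_eq0; apply/eqP; apply: (lin0 e 1); ring.
(* The quotient of [q] by [s]: writing [x] as [s x *: x1] plus a vector [y] with [s y = 0], where
   [q y = 0], the form [q x] is [s x] times this expression. *)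
pose m x := bq x x1 - s x * q x1.
have lm : linf m by move=> a x y; rewrite /m ls lb; ring.
have qm x : x \in U -> q x = s x * m x.
  move=> xU; have e0 : q (- s x *: x1 + x) = 0.
    by apply: q0; [rewrite memvD ?memvZ | rewrite ls s1; ring].
  move: e0; rewrite lq /m.
  have := lq 1 x x1; rewrite scale1r addrC -[x1 in x1 + x]scale1r lq => e2 e.
  apply/eqP; rewrite -subr_eq0; apply/eqP; apply: (lin0 e 1); apply: (lin0 e2 (s x)); ring.
exists m => // x xU; split; first exact: qm.
have nz y : y \in U -> s y != 0 -> r y = t y * m y.
  by move=> yU sy; apply: (mulfI sy); rewrite E // qm //; ring.
have [sx|] := eqVneq (s x) 0; last exact: nz.
have r1 : r x1 = 0 by rewrite nz ?s1 ?oner_neq0 // t1 mul0r.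
have e1 : r (1 *: x1 + x) = t (1 *: x1 + x) * m (1 *: x1 + x).
  by apply: nz; [rewrite memvD ?memvZ | rewrite ls s1 sx mul1r addr0 oner_neq0].
have e2 : r (- 1 *: x1 + x) = t (- 1 *: x1 + x) * m (- 1 *: x1 + x).
  by apply: nz; [rewrite memvD ?memvZ | rewrite ls s1 sx mulN1r addr0 oppr_eq0 oner_neq0].
move: e1 e2; rewrite !lr !lt !lm t1 r1 => e1 e2.
apply/eqP; rewrite -subr_eq0; apply/eqP; apply: half_eq0.
by apply: (lin0 e1 1); apply: (lin0 e2 1); ring.
Qed.

(** Polarizing [g . a = 0] against preimages under [g] of the standard basis shows that [a] depends
    on [g] through a skew 3 by 3 matrix, that is, through a cross product with a fixed vector. *)
Lemma orthogonal_cross U g1 g2 g3 a1 a2 a3 :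
  linf g1 -> linf g2 -> linf g3 -> linf a1 -> linf a2 -> linf a3 ->
  (forall t1 t2 t3, exists2 x, x \in U & [/\ g1 x = t1, g2 x = t2 & g3 x = t3]) ->
  {in U, forall x, g1 x * a1 x + g2 x * a2 x + g3 x * a3 x = 0} ->
  exists v1 v2 v3 : K, {in U, forall x, [/\ a1 x = v2 * g3 x - v3 * g2 x,
    a2 x = v3 * g1 x - v1 * g3 x & a3 x = v1 * g2 x - v2 * g1 x]}.
Proof.
move=> l1 l2 l3 m1 m2 m3 onto E.
have [x1 U1 [g11 g21 g31]] := onto 1 0 0.
have [x2 U2 [g12 g22 g32]] := onto 0 1 0.
have [x3 U3 [g13 g23 g33]] := onto 0 0 1.
have P x y : x \in U -> y \in U -> g1 x * a1 y + g2 x * a2 y + g3 x * a3 y +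
    (g1 y * a1 x + g2 y * a2 x + g3 y * a3 x) = 0.
  move=> xU yU; have := E _ (memvD xU yU); rewrite !linfD // => e.
  by apply: (lin0 e 1); apply: (lin0 (E x xU) (-1)); apply: (lin0 (E y yU) (-1)); ring.
exists (a3 x2), (- a3 x1), (a2 x1) => x xU.
have e1 := P x x1 xU U1; have e2 := P x x2 xU U2; have e3 := P x x3 xU U3.
have d1 := E x1 U1; have d2 := E x2 U2; have d3 := E x3 U3.
have e12 := P x1 x2 U1 U2; have e13 := P x1 x3 U1 U3; have e23 := P x2 x3 U2 U3.
move: e1 e2 e3 d1 d2 d3 e12 e13 e23.
rewrite g11 g21 g31 g12 g22 g32 g13 g23 g33 => e1 e2 e3 d1 d2 d3 e12 e13 e23.
split; apply/eqP; rewrite -subr_eq0; apply/eqP.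
- by apply: (lin0 e1 1); apply: (lin0 d1 (- g1 x)); ring.
- apply: (lin0 e2 1); apply: (lin0 d2 (- g2 x)); apply: (lin0 e12 (- g1 x)); ring.
apply: (lin0 e3 1); apply: (lin0 d3 (- g3 x)); apply: (lin0 e13 (- g1 x)).
apply: (lin0 e23 (- g2 x)); ring.
Qed.

Lemma linf_factor U g1 g2 g3 m :
  linf g1 -> linf g2 -> linf g3 -> linf m ->
  (forall t1 t2 t3, exists2 x, x \in U & [/\ g1 x = t1, g2 x = t2 & g3 x = t3]) ->
  {in U, forall x, g1 x = 0 -> g2 x = 0 -> g3 x = 0 -> m x = 0} ->
  exists m1 m2 m3 : K, {in U, forall x, m x = m1 * g1 x + m2 * g2 x + m3 * g3 x}.
Proof.
move=> l1 l2 l3 lm onto m0.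
have [x1 U1 [g11 g21 g31]] := onto 1 0 0.
have [x2 U2 [g12 g22 g32]] := onto 0 1 0.
have [x3 U3 [g13 g23 g33]] := onto 0 0 1.
exists (m x1), (m x2), (m x3) => x xU.
pose y := - g1 x *: x1 + (- g2 x *: x2 + (- g3 x *: x3 + x)).
have yU : y \in U by rewrite !memvD ?memvZ.
have := m0 y yU; rewrite /y !l1 !l2 !l3 !lm g11 g21 g31 g12 g22 g32 g13 g23 g33.
move=> /(_ ltac:(ring) ltac:(ring) ltac:(ring)) e.
by apply/eqP; rewrite -subr_eq0; apply/eqP; apply: (lin0 e 1); ring.
Qed.

End Functionals.

(** * Normal forms *)

Section Frames.
Variables (K : fieldType) (W : vectType K) (B : forms W) (A : {vspace B}).
Hypothesis closedK : forall p : {poly K}, size p != 1%N -> exists x, root p x.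
Hypothesis char0 : forall n, n.+1%:R != 0 :> K.
Hypothesis dimW : \dim {:W} = 6%N.
Hypothesis dimA : \dim A = 5%N.
Hypothesis skA : {in A, forall w, skewf w}.
Hypothesis rkA : {in A, forall w, (2 <= \dim (ker w))%N}.
Hypothesis ndA : forall P Q : {vspace W}, (P <= Q)%VS -> (0 < \dim P)%N ->
  (\dim P + \dim Q = 6)%N -> ~ {in A, forall w, {in P & Q, forall u v, ev w u v = 0}}.

Implicit Types (w : B) (k u v x y z p q c d : W).

Let sd w x : w \in A -> ev w x x = 0. Proof. by move=> /skA; apply: (ev_diag char0). Qed.
Let sk w : w \in A -> forall x y, ev w x y = - ev w y x.
Proof. by move=> /skA; by []. Qed.

(** Stability with [P = Q] of dimension 3. *)
Lemma no_isotropic3 x y z : free [:: x; y; z] ->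
  ~ {in A, forall w, [/\ ev w x y = 0, ev w x z = 0 & ev w y z = 0]}.
Proof.
move=> fT h; apply: (ndA (subvv <<[:: x; y; z]>>)); rewrite ?(eqP fT) //.
move=> w Aw; have [xy xz yz] := h w Aw; apply: ev_span; first exact: skA.
move=> p q; rewrite !inE => /or3P[] /eqP -> /or3P[] /eqP ->; rewrite ?sd //;
  by rewrite sk // ?xy ?xz ?yz oppr0.
Qed.

(** Stability with [P] a line and [Q] a 5-space containing it. *)
Lemma no_kernel5 k a b c d : free [:: k; a; b; c; d] ->
  ~ {in A, forall w, [/\ ev w k a = 0, ev w k b = 0, ev w k c = 0 & ev w k d = 0]}.
Proof.
move=> fQ h; have k0 : k != 0 by apply: (free_not0 fQ); rewrite inE eqxx.
apply: (ndA (P := <[k]>%VS) (Q := <<[:: k; a; b; c; d]>>%VS)).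
- by apply/subvP => _ /vlineP[e ->]; rewrite memvZ // memv_span // inE eqxx.
- by rewrite dim_vline k0.
- by rewrite dim_vline k0 (eqP fQ).
move=> w Aw _ y /vlineP[e ->] yQ; rewrite evZl; have [h1 h2 h3 h4] := h w Aw.
suff -> : ev w k y = 0 by rewrite mulr0.
apply: (ev_span_r _ yQ) => x; rewrite inE => /orP[/eqP -> | ]; first exact: sd.
by rewrite !inE => /or4P[] /eqP ->.
Qed.

(** As [w0] pairs only [p1] with [p2], it enters the Pfaffian of [w0 + w] linearly: the difference
    from the Pfaffian of [w] is [w0(p1,p2)] times [pf4 w a b c d], and both Pfaffians vanish. *)
Lemma pf4_ker w0 w p1 p2 a b c d : w0 \in A -> w \in A -> ev w0 p1 p2 != 0 ->
  a \in ker w0 -> b \in ker w0 -> c \in ker w0 -> d \in ker w0 ->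
  pf4 w a b c d = 0.
Proof.
move=> A0 Aw e0 la lb lc0 ld.
have pf w' : w' \in A -> pf6 w' p1 p2 a b c d = 0.
  move=> Av; apply: (pf6_eq0 char0); first exact: skA.
  by rewrite dimW -{1}[6%N]add0n ltn_add2r ltnW ?rkA.
have Z x y : y \in ker w0 -> ev (w0 + w) x y = ev w x y.
  by move=> yl; rewrite evD (sk A0) ev_ker // oppr0 add0r.
have Z4 x y z u : y \in ker w0 -> z \in ker w0 -> u \in ker w0 ->
    pf4 (w0 + w) x y z u = pf4 w x y z u.
  by move=> ly lz lu; rewrite /pf4 !Z.
have E : pf6 (w0 + w) p1 p2 a b c d = (ev w0 p1 p2 + ev w p1 p2) * pf4 w a b c d
    - ev w p1 a * pf4 w p2 b c d + ev w p1 b * pf4 w p2 a c d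
    - ev w p1 c * pf4 w p2 a b d + ev w p1 d * pf4 w p2 a b c.
  by rewrite /pf6 !Z4 // (Z _ a) // (Z _ b) // (Z _ c) // (Z _ d) // evD.
have /eqP := pf _ (memvD A0 Aw); rewrite E.
have := pf w Aw; rewrite /pf6 => e /eqP e1.
apply: (mulfI e0); rewrite mulr0.
by apply: (lin0 e1 1); apply: (lin0 e (-1)); ring.
Qed.

(** A linear space of 2 by 2 matrices of rank at most 1 has a common left or right null vector. Here
    [q] and [d] span the left and right null spaces at [w0]; polarizing the determinant gives
    [w(q,d) = 0], after which the determinant makes [w(q1,d) w(q,d1)] vanish, and one of these two
    linear forms is zero. *)
Lemma rank1_matrices_at w0 q1 q2 d1 d2 : w0 \in A -> ev w0 q1 d1 != 0 ->
  {in A, forall w, ev w q1 d1 * ev w q2 d2 = ev w q1 d2 * ev w q2 d1} ->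
  (exists a b : K, (a != 0) || (b != 0) /\
     {in A, forall w, ev w (a *: q1 + b *: q2) d1 = 0 /\ ev w (a *: q1 + b *: q2) d2 = 0}) \/
  (exists a b : K, (a != 0) || (b != 0) /\
     {in A, forall w, ev w q1 (a *: d1 + b *: d2) = 0 /\ ev w q2 (a *: d1 + b *: d2) = 0}).
Proof.
move=> A0 x0 h; have h0 := h w0 A0.
pose q := - ev w0 q2 d1 *: q1 + ev w0 q1 d1 *: q2.
pose d := - ev w0 q1 d2 *: d1 + ev w0 q1 d1 *: d2.
have qd w : w \in A -> ev w q d = 0.
  move=> Aw; have := h _ (memvD A0 Aw); rewrite !(evD w0) => e.
  rewrite /q /d !evDl !evZl !evDr !evZr; apply/eqP; rewrite -subr_eq0; apply/eqP.
  apply: (lin0 e (ev w0 q1 d1)); apply: (lin0 h0 (- ev w q1 d1 - ev w0 q1 d1)).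
  by apply: (lin0 (h w Aw) (- ev w0 q1 d1)); ring.
have prod w : w \in A -> ev w q1 d * ev w q d1 = 0.
  move=> Aw; have := qd w Aw; rewrite /q /d !evDl !evZl !evDr !evZr => e.
  apply: (lin0 e (ev w q1 d1)); apply: (lin0 (h w Aw) (- ev w0 q1 d1 * ev w0 q1 d1)).
  by ring.
have [||h1|h1] := @linf_mul_eq0 K (B) A (fun w => ev w q1 d) (fun w => ev w q d1) _ _ prod.
- by move=> a w1 w2; rewrite evD evZ.
- by move=> a w1 w2; rewrite evD evZ.
- right; exists (- ev w0 q1 d2), (ev w0 q1 d1); rewrite x0 orbT; split => // w Aw.
  split; first exact: h1.
  have := qd w Aw; rewrite {1}/q evDl !evZl (h1 w Aw) mulr0 add0r => /eqP.
  by rewrite mulf_eq0 (negPf x0) => /eqP.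
left; exists (- ev w0 q2 d1), (ev w0 q1 d1); rewrite x0 orbT; split => // w Aw.
split; first exact: h1.
have := qd w Aw; rewrite {1}/d evDr !evZr (h1 w Aw) mulr0 add0r => /eqP.
by rewrite mulf_eq0 (negPf x0) => /eqP.
Qed.

Lemma rank1_matrices q1 q2 d1 d2 :
  {in A, forall w, ev w q1 d1 * ev w q2 d2 = ev w q1 d2 * ev w q2 d1} ->
  (exists a b : K, (a != 0) || (b != 0) /\
     {in A, forall w, ev w (a *: q1 + b *: q2) d1 = 0 /\ ev w (a *: q1 + b *: q2) d2 = 0}) \/
  (exists a b : K, (a != 0) || (b != 0) /\
     {in A, forall w, ev w q1 (a *: d1 + b *: d2) = 0 /\ ev w q2 (a *: d1 + b *: d2) = 0}).
Proof.
move=> h.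
have [[w0 A0 n]|n11] := boolp.pselect (exists2 w, w \in A & ev w q1 d1 != 0).
  exact: (rank1_matrices_at A0 n).
have [[w0 A0 n]|n12] := boolp.pselect (exists2 w, w \in A & ev w q1 d2 != 0).
  have [w Aw||] := @rank1_matrices_at w0 q1 q2 d2 d1 A0 n; first by rewrite h.
    by case=> a [b [ab H]]; left; exists a, b; split => // w /H[].
  by case=> a [b [ab H]]; right; exists b, a; rewrite orbC addrC.
have [[w0 A0 n]|n21] := boolp.pselect (exists2 w, w \in A & ev w q2 d1 != 0).
  have [w Aw||] := @rank1_matrices_at w0 q2 q1 d1 d2 A0 n.
  - by rewrite mulrC -h // mulrC.
  - by case=> a [b [ab H]]; left; exists b, a; rewrite orbC addrC.
  by case=> a [b [ab H]]; right; exists a, b; split => // w /H[].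
left; exists 1, 0; rewrite oner_neq0 scale1r scale0r addr0; split => // w Aw.
by split; apply/eqP; apply: boolp.contrapT => /negP ?; [apply: n11 | apply: n12]; exists w.
Qed.

(* [w0] has rank 2, and [k], [c1], [c2], [c3] span its kernel. *)
Definition frame k c1 c2 c3 p1 p2 := [/\ basis_of fullv [:: k; c1; c2; c3; p1; p2],
  {in A, forall w, [/\ ev w k c1 = 0, ev w k c2 = 0 & ev w k c3 = 0]} &
  exists w0, [/\ w0 \in A, {subset [:: k; c1; c2; c3] <= ker w0} & ev w0 p1 p2 != 0]].

(** A linear space of skew forms of rank at most 2 on the 4-space [ker w0] has a common kernel
    vector or a common isotropic 3-space, as for the two families of planes in the Klein quadric.
    Splitting [ker w0] by a form [al] not zero on it reduces this to the alternative of
    [rank1_matrices], and stability excludes the isotropic 3-space. *)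
Lemma frame_exists : exists k c1 c2 c3 p1 p2, frame k c1 c2 c3 p1 p2.
Proof.
have [w0 [A0 n0 d4]] := exists_rank2 closedK char0 dimW dimA skA rkA ndA.
have {}d4 : \dim (ker w0) = 4%N.
  have := dimvS (subvf (ker w0)); rewrite dimW; have := dim_ker_neq5 char0 dimW (skA A0).
  have : \dim (ker w0) <> 6%N.
    move=> d6; case/eqP: n0; apply: ev_ext => u v; rewrite ev0 ev_ker //.
    have /eqP -> : ker w0 == fullv by rewrite eqEdim subvf dimW d6.
    exact: memvf.
  by case: (\dim (ker w0)) d4 => [|[|[|[|[|[|[|]]]]]]].
have [||p bp] := basis_extend (n := 2) (U := fullv) (basis_free (vbasisP (ker w0))).
- by move=> v _; rewrite memvf.
- by rewrite size_tuple d4 dimW.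
case: p bp => -[|p1 [|p2 []]] //= _ bp.
have e0 : ev w0 p1 p2 != 0.
  apply: contra n0 => /eqP e0; apply/eqP/ev_ext => u v; rewrite ev0.
  apply: (ev_span (skA A0) (s := vbasis (ker w0) ++ [:: p1; p2])
    (t := vbasis (ker w0) ++ [:: p1; p2])); rewrite ?(span_basis bp) ?memvf //.
  move=> x y; rewrite !mem_cat => /orP[/vbasis_mem/ev_ker -> // | xp].
  case/orP => [/vbasis_mem/ev_ker yl | ]; first by rewrite sk // yl oppr0.
  move: xp; rewrite !inE => /orP[] /eqP -> /orP[] /eqP ->; rewrite ?sd //.
  by rewrite sk // e0 oppr0.
suff [k [k0 kl kE]] : exists k, [/\ k != 0, k \in ker w0 &
    {in A, forall w, {in ker w0, forall x, ev w k x = 0}}].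
  have fk : free [:: k] by rewrite seq1_free.
  have [||c bc] := basis_extend (n := 3) (U := ker w0) fk.
  - by move=> x; rewrite inE => /eqP ->.
  - by rewrite d4.
  case: c bc => -[|c1 [|c2 [|c3 []]]] //= _ bc.
  exists k, c1, c2, c3, p1, p2; split.
  - apply: (basis_change bp); first by rewrite size_cat size_tuple d4.
    move=> x; rewrite mem_cat => /orP[/vbasis_mem | xp]; last first.
      apply: memv_span; rewrite -[[:: k; _; _; _; _; _]]/([:: k; c1; c2; c3] ++ _).
      by rewrite mem_cat xp orbT.
    rewrite -(span_basis bc) -[[:: k; _; _; _; _; _]]/([:: k; c1; c2; c3] ++ [:: p1; p2]).
    by rewrite span_cat; apply: (subvP (addvSl _ _)).
  - by move=> w Aw; split; apply: kE; rewrite // (basis_mem bc) // !inE eqxx ?orbT.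
  by exists w0; split => // x; apply: (basis_mem bc).
have [[al Aal [d1 [d2 [l1 l2 ad]]]]|nE] := boolp.pselect (exists2 w, w \in A &
    exists d1 d2, [/\ d1 \in ker w0, d2 \in ker w0 & ev w d1 d2 != 0]); last first.
  have : ker w0 != 0%VS by rewrite -dimv_eq0 d4.
  rewrite -vpick0 => v0; exists (vpick (ker w0)); split => //; first exact: memv_pick.
  move=> w Aw x xl; apply/eqP; apply: boolp.contrapT => /negP ne; apply: nE.
  by exists w => //; exists (vpick (ker w0)), x; split => //; apply: memv_pick.
have fd : free [:: d1; d2].
  apply: lc_free => -[|a [|b []]] //= _; rewrite addr0 => e.
  have h1 : ev al (a *: d1 + b *: d2) d2 = 0 by rewrite e ev0l.
  have h2 : ev al (a *: d1 + b *: d2) d1 = 0 by rewrite e ev0l.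
  move: h1 h2; rewrite !evDl !evZl !sd // !mulr0 addr0 add0r (sk Aal d2).
  move=> /eqP; rewrite mulf_eq0 (negPf ad) orbF => /eqP ->.
  by move=> /eqP; rewrite mulf_eq0 oppr_eq0 (negPf ad) orbF => /eqP ->.
have [||c bc] := basis_extend (n := 2) (U := ker w0) fd.
- by move=> x; rewrite !inE => /orP[] /eqP ->.
- by rewrite d4.
case: c bc => -[|x1 [|x2 []]] //= _ bc.
have lx1 : x1 \in ker w0 by rewrite (basis_mem bc) // !inE eqxx !orbT.
have lx2 : x2 \in ker w0 by rewrite (basis_mem bc) // !inE eqxx !orbT.
(* The projection along [d1], [d2] onto their orthogonal complement for [al]. *)
pose pr x := x + (- (ev al x d2 / ev al d1 d2) *: d1 + (ev al x d1 / ev al d1 d2) *: d2).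
have pr1 x : ev al (pr x) d1 = 0.
  by rewrite /pr !evDl !evZl sd // (sk Aal d2); field.
have pr2 x : ev al (pr x) d2 = 0.
  by rewrite /pr !evDl !evZl sd //; field.
have prl x : x \in ker w0 -> pr x \in ker w0.
  by move=> xl; rewrite memvD // memvD // memvZ.
pose q1 := pr x1; pose q2 := pr x2.
have lq1 := prl _ lx1; have lq2 := prl _ lx2.
have dp x : ev al d1 (pr x) = 0 by rewrite sk // pr1 oppr0.
have dp2 x : ev al d2 (pr x) = 0 by rewrite sk // pr2 oppr0.
have pf w : w \in A -> pf4 w q1 q2 d1 d2 = 0.
  by move=> Aw; apply: (pf4_ker A0 Aw e0).
have aq : ev al q1 q2 = 0.
  have /eqP := pf al Aal; rewrite /pf4 !pr1 !pr2 !mul0r subr0 addr0 mulf_eq0.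
  by rewrite (negPf ad) orbF => /eqP.
have qq w : w \in A -> ev w q1 q2 = 0.
  move=> Aw; have := pf _ (memvD Aal Aw); rewrite /pf4 !(evD al) !pr1 !pr2 aq !add0r.
  have := pf w Aw; rewrite /pf4 => e1 e2; apply: (mulIf ad); rewrite mul0r.
  by apply: (lin0 e2 1); apply: (lin0 e1 (-1)); ring.
have dtw w : w \in A -> ev w q1 d1 * ev w q2 d2 = ev w q1 d2 * ev w q2 d1.
  move=> Aw; have := pf w Aw; rewrite /pf4 qq // mul0r sub0r => /eqP.
  by rewrite addrC subr_eq0 => /eqP ->.
have bC : basis_of (ker w0) [:: d1; d2; q1; q2].
  rewrite basisEdim d4 leqnn andbT -(span_basis bc); apply/span_subvP => x.
  have prK y : pr y \in <<[:: d1; d2; q1; q2]>>%VS -> y \in <<[:: d1; d2; q1; q2]>>%VS.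
    move=> h; rewrite -[y](addrK (- (ev al y d2 / ev al d1 d2) *: d1 +
      (ev al y d1 / ev al d1 d2) *: d2)) memvB // memvD // memvZ //;
      by rewrite memv_span // !inE eqxx ?orbT.
  rewrite !inE => /or4P[] /eqP ->; first by rewrite memv_span // !inE eqxx ?orbT.
  - by rewrite memv_span // !inE eqxx ?orbT.
  - by apply: prK; rewrite memv_span // !inE eqxx ?orbT.
  by apply: prK; rewrite memv_span // !inE eqxx ?orbT.
have fC := basis_free bC.
have [[a [b [ab H]]]|[a [b [ab H]]]] := rank1_matrices dtw.
  exists (a *: q1 + b *: q2); split.
  - apply/negP => /eqP e.
    have e' : lc [:: 0; 0; a; b] [:: d1; d2; q1; q2] = 0.
      by rewrite -[RHS]e /= !scale0r !add0r addr0.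
    by have [a0 b0] := free_lc fC e' erefl; move: ab; rewrite a0 b0 eqxx.
  - by rewrite memvD // memvZ.
  move=> w Aw y; rewrite -(span_basis bC); apply: ev_span_r => x.
  have [h1 h2] := H w Aw.
  rewrite !inE => /or4P[] /eqP ->; rewrite // evDl !evZl ?sd ?qq //; try by ring.
  by rewrite (sk Aw) qq //; ring.
exfalso; apply: (@no_isotropic3 (a *: d1 + b *: d2) q1 q2).
  apply: lc_free => -[|y1 [|y2 [|y3 []]]] //= _ e.
  have e' : lc [:: y1 * a; y1 * b; y2; y3] [:: d1; d2; q1; q2] = 0.
    by rewrite -[RHS]e /= !scalerDr !scalerA !addrA.
  have [y1a y1b -> ->] := free_lc fC e' erefl.
  suff -> : y1 = 0 by [].
  apply/eqP; move: ab; apply: contraTT => y10; rewrite negb_or !negbK.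
  move/eqP: y1a; move/eqP: y1b.
  by rewrite !mulf_eq0 !(negPf y10) /= => -> ->.
move=> w Aw; have [h1 h2] := H w Aw.
by rewrite qq // sk // h1 oppr0 sk // h2 oppr0.
Qed.

End Frames.

Section Blocks.
Variables (K : fieldType) (V : vectType K).
Implicit Types (s a b d : seq V).

Lemma lcD (k l : seq K) s : size k = size l ->
  lc k s + lc l s = lc [seq p.1 + p.2 | p <- zip k l] s.
Proof.
elim: k l s => [|a k IH] [|b l] [|x s] //=; rewrite ?addr0 // => -[kl].
by rewrite -IH // scalerDl addrACA.
Qed.

Lemma free_span_eq b b' : free b -> free b' -> size b' = size b ->
  {subset b' <= <<b>>%VS} -> <<b'>>%VS = <<b>>%VS.
Proof.
move=> fb fb' sz sub; apply/eqP; rewrite eqEdim (eqP fb) (eqP fb') sz leqnn andbT.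
exact/span_subvP.
Qed.

Lemma block_change a b b' d : basis_of fullv (a ++ b ++ d) -> size b' = size b ->
  free b' -> {subset b' <= <<b>>%VS} -> basis_of fullv (a ++ b' ++ d).
Proof.
move=> bW sz fb' sub; apply: (basis_change bW); first by rewrite !size_cat sz.
have fb : free b by have := basis_free bW; rewrite !cat_free => /and3P[_ /and3P[]].
move=> x; rewrite !mem_cat !span_cat (free_span_eq fb fb' sz sub) => /or3P[] xs.
- by apply: (subvP (addvSl _ _)); apply: memv_span.
- by apply: (subvP (addvSr _ _)); apply: (subvP (addvSl _ _)); apply: memv_span.
by do 2!apply: (subvP (addvSr _ _)); apply: memv_span.
Qed.
End Blocks.

(** * Changes of frame and the three forms on the [c_i] *)

Section FrameGeometry.
Variables (K : fieldType) (W : vectType K) (B : forms W) (A : {vspace B}).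
Hypothesis closedK : forall p : {poly K}, size p != 1%N -> exists x, root p x.
Hypothesis char0 : forall n, n.+1%:R != 0 :> K.
Hypothesis dimW : \dim {:W} = 6%N.
Hypothesis dimA : \dim A = 5%N.
Hypothesis skA : {in A, forall w, skewf w}.
Hypothesis rkA : {in A, forall w, (2 <= \dim (ker w))%N}.
Hypothesis ndA : forall P Q : {vspace W}, (P <= Q)%VS -> (0 < \dim P)%N ->
  (\dim P + \dim Q = 6)%N -> ~ {in A, forall w, {in P & Q, forall u v, ev w u v = 0}}.
Implicit Types (w : B) (k u v x y z p q c d : W).

Let sd w x : w \in A -> ev w x x = 0. Proof. by move=> /skA; apply: (ev_diag char0). Qed.
Let sk w : w \in A -> forall x y, ev w x y = - ev w y x.
Proof. by move=> /skA; by []. Qed.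
Local Notation frame := (frame A).

Lemma linf_ev x y : linf (fun w => ev w x y).
Proof. by move=> a w1 w2; rewrite evD evZ. Qed.

Lemma frame_basis4 k c1 c2 c3 p1 p2 : frame k c1 c2 c3 p1 p2 -> free [:: k; c1; c2; c3].
Proof. by case=> /basis_free; rewrite (cat_free [:: k; c1; c2; c3]) => /andP[]. Qed.

(** A cyclic rotation permutes [w(c2,c3)], [w(c3,c1)], [w(c1,c2)] without signs, so statements about
    the first carry over to all three. *)
Lemma frame_rot k c1 c2 c3 p1 p2 : frame k c1 c2 c3 p1 p2 -> frame k c2 c3 c1 p1 p2.
Proof.
case=> bW kc [w0 [A0 l0 e0]]; split.
- rewrite (perm_basis (Y := [:: k; c1; c2; c3; p1; p2])) //.
  by apply/permP => a /=; rewrite (addnCA (a c3)) (addnCA (a c2) (a c1)).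
- by move=> w /kc[].
exists w0; split => // x; rewrite !inE => h; apply: l0; rewrite !inE.
by case/or4P: h => ->; rewrite ?orbT.
Qed.

Lemma frame_shift_c k c1 c2 c3 p1 p2 (m1 m2 m3 : K) : frame k c1 c2 c3 p1 p2 ->
  frame k (c1 + m1 *: k) (c2 + m2 *: k) (c3 + m3 *: k) p1 p2.
Proof.
case=> bW kc [w0 [A0 l0 e0]]; split.
- pose b := [:: k; c1 + m1 *: k; c2 + m2 *: k; c3 + m3 *: k; p1; p2].
  apply: (basis_change bW) => // x; rewrite -/b.
  have kb : k \in <<b>>%VS by rewrite memv_span // inE eqxx.
  have cb c (m : K) : c + m *: k \in b -> c \in <<b>>%VS.
    by move=> h; rewrite -(addrK (m *: k) c) memvB // ?memvZ // memv_span.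
  rewrite !inE; case/or4P => [/eqP -> // | /eqP -> | /eqP -> | ].
  - by apply: (cb _ m1); rewrite !inE eqxx ?orbT.
  - by apply: (cb _ m2); rewrite !inE eqxx ?orbT.
  case/or3P => /eqP ->; last 2 first.
  - by rewrite memv_span // !inE eqxx ?orbT.
  - by rewrite memv_span // !inE eqxx ?orbT.
  by apply: (cb _ m3); rewrite !inE eqxx ?orbT.
- move=> w Aw; have [h1 h2 h3] := kc w Aw.
  by rewrite !evDr !evZr h1 h2 h3 sd // !mulr0 addr0.
exists w0; split => // x; have kl : k \in ker w0 by apply: l0; rewrite inE eqxx.
rewrite inE => /orP[/eqP -> // | ]; rewrite !inE.
by case/or3P => /eqP ->; rewrite memvD ?memvZ // l0 // !inE eqxx ?orbT.
Qed.

Lemma frame_shift_p k c1 c2 c3 p1 p2 x y : frame k c1 c2 c3 p1 p2 ->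
  x \in <<[:: c1; c2; c3]>>%VS -> y \in <<[:: c1; c2; c3]>>%VS ->
  frame k c1 c2 c3 (p1 + x) (p2 + y).
Proof.
case=> bW kc [w0 [A0 l0 e0]] xc yc.
have cl z : z \in <<[:: c1; c2; c3]>>%VS -> z \in ker w0.
  apply: (subvP (_ : <<[:: c1; c2; c3]>> <= ker w0)%VS); apply/span_subvP => c cc.
  by apply: l0; rewrite inE cc orbT.
split => //.
- pose b := [:: k; c1; c2; c3; p1 + x; p2 + y].
  apply: (basis_change bW) => // z; rewrite -/b.
  have cb u : u \in <<[:: c1; c2; c3]>>%VS -> u \in <<b>>%VS.
    apply: (subvP (_ : <<[:: c1; c2; c3]>> <= <<b>>)%VS); apply: sub_span => c.
    by rewrite !inE => /or3P[] ->; rewrite ?orbT.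
  have pb p u : p + u \in b -> u \in <<[:: c1; c2; c3]>>%VS -> p \in <<b>>%VS.
    by move=> h /cb uc; rewrite -(addrK u p) memvB // memv_span.
  rewrite -[_ :: _]/([:: k; c1; c2; c3] ++ [:: p1; p2]) mem_cat => /orP[h | ].
    by rewrite memv_span // -[b]/([:: k; c1; c2; c3] ++ _) mem_cat h.
  rewrite !inE => /orP[] /eqP ->.
  - by apply: (pb _ x) => //; rewrite !inE eqxx ?orbT.
  by apply: (pb _ y) => //; rewrite !inE eqxx ?orbT.
exists w0; split => //.
have xl := cl _ xc; have yl := cl _ yc.
by rewrite evDl !evDr (ev_ker xl) (ev_ker xl) (sk A0 p1 y) (ev_ker yl) oppr0 !addr0.
Qed.

Lemma frame_c k c1 c2 c3 p1 p2 d1 d2 d3 : frame k c1 c2 c3 p1 p2 ->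
  free [:: d1; d2; d3] -> {subset [:: d1; d2; d3] <= <<[:: c1; c2; c3]>>%VS} ->
  frame k d1 d2 d3 p1 p2.
Proof.
case=> bW kc [w0 [A0 l0 e0]] fd sub; split.
- exact: (@block_change _ _ [:: k] [:: c1; c2; c3] [:: d1; d2; d3] [:: p1; p2]).
- move=> w Aw; have [h1 h2 h3] := kc w Aw.
  have h d : d \in [:: d1; d2; d3] -> ev w k d = 0.
    by move/sub; apply: ev_span_r => c; rewrite !inE => /or3P[] /eqP ->.
  by split; apply: h; rewrite !inE eqxx ?orbT.
exists w0; split => // x; rewrite inE => /orP[/eqP -> | /sub].
  by apply: l0; rewrite inE eqxx.
apply: (subvP (_ : <<[:: c1; c2; c3]>> <= ker w0)%VS); apply/span_subvP => c cc.
by apply: l0; rewrite inE cc orbT.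
Qed.

Lemma frame_p k c1 c2 c3 p1 p2 (a b : K) : frame k c1 c2 c3 p1 p2 ->
  (a != 0) || (b != 0) -> exists q, frame k c1 c2 c3 (a *: p1 + b *: p2) q /\
    q \in <<[:: p1; p2]>>%VS.
Proof.
case=> bW kc [w0 [A0 l0 e0]] ab; set q1 := _ + _.
have fp : free [:: p1; p2].
  by have := basis_free bW; rewrite (cat_free [:: k; c1; c2; c3]) => /and3P[].
have q10 : q1 != 0.
  apply/negP => /eqP e; have e' : lc [:: a; b] [:: p1; p2] = 0 by rewrite /= addr0.
  by have [a0 b0] := free_lc fp e' erefl; move: ab; rewrite a0 b0 eqxx.
have fq : free [:: q1] by rewrite seq1_free.
have q1P : q1 \in <<[:: p1; p2]>>%VS.
  by rewrite memvD ?memvZ // memv_span // !inE eqxx ?orbT.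
have [||q bq] := basis_extend (n := 1) (U := <<[:: p1; p2]>>%VS) fq.
- by move=> x; rewrite inE => /eqP ->.
- by rewrite (eqP fp).
case: q bq => -[|q []] //= _ bq; exists q.
have qP : q \in <<[:: p1; p2]>>%VS by rewrite (basis_mem bq) // !inE eqxx orbT.
split => //; split => //.
- rewrite -[_ :: _]/([:: k; c1; c2; c3] ++ [:: q1; q] ++ [::]).
  apply: (block_change (b := [:: p1; p2])) => //; first exact: (basis_free bq).
  by move=> x; rewrite !inE => /orP[] /eqP ->.
exists w0; split => //; apply: contra e0 => /eqP e0; apply/eqP.
apply: (ev_span (skA A0) (s := [:: q1; q]) (t := [:: q1; q])).
- move=> x y; rewrite !inE => /orP[] /eqP -> /orP[] /eqP ->; rewrite ?sd //.
  by rewrite sk // e0 oppr0.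
- by rewrite (span_basis bq) memv_span // inE eqxx.
by rewrite (span_basis bq) memv_span // !inE eqxx orbT.
Qed.

(** If [v1] were nonzero, [k] together with the plane of combinations of the [c_i] on which the
    covector [v] vanishes would be a common isotropic 3-space. *)
Lemma gamma_indep k c1 c2 c3 p1 p2 (v1 v2 v3 : K) : frame k c1 c2 c3 p1 p2 ->
  {in A, forall w, v1 * ev w c2 c3 + v2 * ev w c3 c1 + v3 * ev w c1 c2 = 0} -> v1 = 0.
Proof.
move=> F h; apply/eqP/negPn/negP => v10; have [_ kc _] := F.
apply: (no_isotropic3 char0 skA ndA
  (x := k) (y := - v2 *: c1 + v1 *: c2) (z := - v3 *: c1 + v1 *: c3)).
  apply: lc_free => -[|x1 [|x2 [|x3 []]]] //= _ e.
  have e' : lc [:: x1; x2 * - v2 + x3 * - v3; x2 * v1; x3 * v1] [:: k; c1; c2; c3] = 0.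
    rewrite -[RHS]e /= !scalerDr !scalerA !addr0 scalerDl; congr (_ + _).
    by rewrite -!addrA; congr (_ + _); rewrite addrCA.
  have [-> _ /eqP + /eqP] := free_lc (frame_basis4 F) e' erefl.
  by rewrite !mulf_eq0 (negPf v10) !orbF => /eqP -> /eqP ->.
move=> w Aw; have [h1 h2 h3] := kc w Aw; have e := h w Aw.
split; rewrite !evDr !evZr ?h1 ?h2 ?h3; try by ring.
rewrite !evDl !evZl sd // (sk Aw c1 c3) (sk Aw c2 c1).
by apply: (lin0 e v1); ring.
Qed.

Lemma gamma_onto k c1 c2 c3 p1 p2 : frame k c1 c2 c3 p1 p2 ->
  forall t1 t2 t3 : K, exists2 w, w \in A &
    [/\ ev w c2 c3 = t1, ev w c3 c1 = t2 & ev w c1 c2 = t3].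
Proof.
move=> F t1 t2 t3.
pose f (i : 'I_3) w := [:: ev w c2 c3; ev w c3 c1; ev w c1 c2]`_i.
have lf i : linf (f i).
  by case: i => [[|[|[|]]] // ?]; rewrite /f /=; apply: linf_ev.
have [|w Aw E] := functionals_onto lf _ (fun i : 'I_3 => [:: t1; t2; t3]`_i) (U := A).
  move=> l lE; have F2 := frame_rot F; have F3 := frame_rot F2.
  have e w : w \in A -> l 0 * ev w c2 c3 + l 1 * ev w c3 c1 + l (lift 0 1) * ev w c1 c2 = 0.
    move=> /lE; rewrite !big_ord_recl big_ord0 addr0 addrA /f /= => e.
    by rewrite -[RHS]e; congr (_ + l _ * _ + l _ * _); apply: val_inj.
  have l0 : l 0 = 0 by apply: (gamma_indep F e).
  have l1 : l 1 = 0.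
    apply: (gamma_indep F2 (v2 := l (lift 0 1)) (v3 := l 0)) => w /e e1.
    by rewrite -[RHS]e1; ring.
  have l2 : l (lift 0 1) = 0.
    apply: (gamma_indep F3 (v2 := l 0) (v3 := l 1)) => w /e e1.
    by rewrite -[RHS]e1; ring.
  move=> [[|[|[|]]] // i]; [rewrite -[RHS]l0 | rewrite -[RHS]l1 | rewrite -[RHS]l2];
    by congr (l _); apply: val_inj.
exists w => //; split.
- exact: (E 0).
- exact: (E 1).
exact: (E (lift 0 1)).
Qed.

Lemma frame_pfaffian k c1 c2 c3 p1 p2 w : frame k c1 c2 c3 p1 p2 -> w \in A ->
  ev w k p1 * (ev w c2 c3 * ev w p2 c1 + ev w c3 c1 * ev w p2 c2 + ev w c1 c2 * ev w p2 c3) =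
  ev w k p2 * (ev w c2 c3 * ev w p1 c1 + ev w c3 c1 * ev w p1 c2 + ev w c1 c2 * ev w p1 c3).
Proof.
move=> [_ kc _] Aw; have [h1 h2 h3] := kc w Aw.
have : pf6 w k c1 c2 c3 p1 p2 = 0.
  by apply: (pf6_eq0 char0); [exact: skA | by rewrite dimW -{1}[6%N]add0n ltn_add2r ltnW ?rkA].
rewrite /pf6 h1 h2 h3 !mul0r subr0 add0r add0r /pf4.
rewrite (sk Aw p1 c1) (sk Aw p1 c2) (sk Aw p1 c3) (sk Aw p2 c1) (sk Aw p2 c2) (sk Aw p2 c3).
rewrite (sk Aw c3 c1) => e; apply/eqP; rewrite -subr_eq0; apply/eqP.
by apply: (lin0 e 1); ring.
Qed.

(** For [x = v1 c1 + v2 c2 + v3 c3] the triple [w(x,c_i)] is minus the cross product of [v] with the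
    vector of the [w(c_i,c_j)]. *)
Lemma skew_part k c1 c2 c3 p1 p2 (a1 a2 a3 : B -> K) : frame k c1 c2 c3 p1 p2 ->
  linf a1 -> linf a2 -> linf a3 ->
  {in A, forall w, ev w c2 c3 * a1 w + ev w c3 c1 * a2 w + ev w c1 c2 * a3 w = 0} ->
  exists2 x, x \in <<[:: c1; c2; c3]>>%VS &
    {in A, forall w, [/\ ev w x c1 = - a1 w, ev w x c2 = - a2 w & ev w x c3 = - a3 w]}.
Proof.
move=> F l1 l2 l3 E.
have [v1 [v2 [v3 H]]] := @orthogonal_cross K (B) A _ _ _ _ _ _
  (linf_ev c2 c3) (linf_ev c3 c1) (linf_ev c1 c2) l1 l2 l3 (gamma_onto F) E.
exists (v1 *: c1 + v2 *: c2 + v3 *: c3).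
  by rewrite !memvD ?memvZ // memv_span // !inE eqxx ?orbT.
move=> w Aw; have [e1 e2 e3] := H w Aw.
by split; rewrite !evDl !evZl (sd _ Aw) ?e1 ?e2 ?e3 ?(sk Aw c2 c1) ?(sk Aw c1 c3)
  ?(sk Aw c3 c2); ring.
Qed.

End FrameGeometry.

(** * Reduction to the two systems of equations *)

Section NormalForm.
Variables (K : fieldType) (W : vectType K) (B : forms W) (A : {vspace B}).
Hypothesis closedK : forall p : {poly K}, size p != 1%N -> exists x, root p x.
Hypothesis char0 : forall n, n.+1%:R != 0 :> K.
Hypothesis dimW : \dim {:W} = 6%N.
Hypothesis dimA : \dim A = 5%N.
Hypothesis skA : {in A, forall w, skewf w}.
Hypothesis rkA : {in A, forall w, (2 <= \dim (ker w))%N}.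
Hypothesis ndA : forall P Q : {vspace W}, (P <= Q)%VS -> (0 < \dim P)%N ->
  (\dim P + \dim Q = 6)%N -> ~ {in A, forall w, {in P & Q, forall u v, ev w u v = 0}}.
Implicit Types (w : B) (k u v x y z p q c d : W).

Let sd w x : w \in A -> ev w x x = 0. Proof. by move=> /skA; apply: (ev_diag char0). Qed.
Let sk w : w \in A -> forall x y, ev w x y = - ev w y x.
Proof. by move=> /skA; by []. Qed.
Local Notation frame := (frame A).

Let le x y : linf (fun w : B => ev w x y). Proof. exact: linf_ev. Qed.

Lemma frame_k_c k c1 c2 c3 p1 p2 w x : frame k c1 c2 c3 p1 p2 -> w \in A ->
  x \in <<[:: c1; c2; c3]>>%VS -> ev w k x = 0.
Proof.
case=> _ kc _ /kc[h1 h2 h3]; apply: ev_span_r => c.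
by rewrite !inE => /or3P[] /eqP ->.
Qed.

(** Suppose [w(k,p1)] is identically zero. If [w(k,p2)] is too, [k] violates stability. Otherwise
    the Pfaffian identity forces [g . a_1 = 0], so some translate [p1 + x] is orthogonal to [k] and
    all [c_i], again against stability. *)
Lemma exists_ev_k_p1 k c1 c2 c3 p1 p2 : frame k c1 c2 c3 p1 p2 ->
  exists2 w, w \in A & ev w k p1 != 0.
Proof.
move=> F; apply: boolp.contrapT => ne.
have s0 w : w \in A -> ev w k p1 = 0.
  by move=> Aw; apply/eqP; apply: boolp.contrapT => /negP h; apply: ne; exists w.
have [bW kc _] := F.
have [[z Az tz]|nt] := boolp.pselect (exists2 w, w \in A & ev w k p2 != 0); last first.
  apply: (no_kernel5 char0 skA ndA (k := k) (a := c1) (b := c2) (c := c3) (d := p1)).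
    by have := basis_free bW; rewrite (cat_free [:: k; c1; c2; c3; p1]) => /andP[].
  by move=> w Aw; have [h1 h2 h3] := kc w Aw; rewrite s0.
have E w : w \in A -> ev w k p2 *
    (ev w c2 c3 * ev w p1 c1 + ev w c3 c1 * ev w p1 c2 + ev w c1 c2 * ev w p1 c3) = 0.
  by move=> Aw; rewrite -(frame_pfaffian char0 dimW skA rkA F Aw) s0 // mul0r.
have q0 := linf_quad_eq0 char0 (le k p2) (quadf_sum3 (le c2 c3) (le c3 c1)
  (le c1 c2) (le p1 c1) (le p1 c2) (le p1 c3)) Az tz E.
have [x xc xE] := skew_part char0 skA ndA F (le p1 c1) (le p1 c2)
  (le p1 c3) q0.
have [bW' _ _] := frame_shift_p skA F xc (mem0v _).
apply: (no_kernel5 char0 skA ndA (k := p1 + x) (a := c1) (b := c2) (c := c3) (d := k)).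
  have : free [:: k; c1; c2; c3; p1 + x].
    by have := basis_free bW'; rewrite (cat_free [:: k; c1; c2; c3; p1 + x]) => /andP[].
  rewrite (perm_free (Y := [:: p1 + x; c1; c2; c3; k])) //.
  apply/permP => a /=; rewrite !addn0 [LHS]addnC -!addnA.
  by do 3!(rewrite [RHS]addnCA; congr (_ + _)%N).
move=> w Aw; have [e1 e2 e3] := xE w Aw; have kx := frame_k_c F Aw xc.
by rewrite !evDl e1 e2 e3 !subrr (sk Aw p1) s0 // (sk Aw x) kx oppr0 addr0.
Qed.

(** Any combination of [p1] and [p2] can serve as the first [p] of a frame, so [exists_ev_k_p1]
    gives independence of the two functionals. *)
Lemma st_onto k c1 c2 c3 p1 p2 : frame k c1 c2 c3 p1 p2 ->
  forall t1 t2 : K, exists2 w, w \in A & ev w k p1 = t1 /\ ev w k p2 = t2.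
Proof.
move=> F t1 t2; pose f (i : 'I_2) w := [:: ev w k p1; ev w k p2]`_i.
have lf i : linf (f i).
  by case: i => [[|[|]] // ?]; rewrite /f /=; apply: linf_ev.
have [|w Aw E] := functionals_onto lf _ (fun i : 'I_2 => [:: t1; t2]`_i) (U := A).
  move=> l lE; have e w : w \in A -> l 0 * ev w k p1 + l 1 * ev w k p2 = 0.
    move=> /lE; rewrite !big_ord_recl big_ord0 addr0 /f /= => e.
    by rewrite -[RHS]e; congr (_ + l _ * _); apply: val_inj.
  have [l00|] := boolP ((l 0 == 0) && (l 1 == 0)).
    have [/eqP l0 /eqP l1] := andP l00.
    move=> [[|[|]] // i]; [rewrite -[RHS]l0 | rewrite -[RHS]l1];
      by congr (l _); apply: val_inj.
  rewrite negb_and => /(frame_p char0 skA F)[q [F' _]].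
  have [w /e ew] := exists_ev_k_p1 F'.
  by rewrite evDr !evZr ew eqxx.
exists w => //; split; [exact: (E 0) | exact: (E 1)].
Qed.

(* The spaces of skew forms cut out by [eqs_a] and [eqs_b] are [space_a] and [space_b], up to
   the changes of basis of [space_aP] and [space_bP]. *)
Definition eqs_a w k c1 c2 c3 p1 p2 :=
  [/\ [/\ ev w k c1 = 0, ev w k c2 = 0 & ev w k c3 = 0],
      [/\ ev w p1 c2 = 0, ev w p1 c3 = 0, ev w p2 c1 = 0 & ev w p2 c3 = 0],
      ev w p1 c1 = ev w p2 c2, ev w k p1 = ev w c2 c3 & ev w k p2 = ev w c3 c1].

Definition eqs_b w k c1 c2 c3 p1 p2 :=
  [/\ [/\ ev w k c1 = 0, ev w k c2 = 0 & ev w k c3 = 0],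
      [/\ ev w p1 c1 = 0, ev w p1 c2 = 0 & ev w p1 c3 = 0],
      [/\ ev w p2 c1 = 0, ev w p2 c2 = 0 & ev w p2 c3 = 0]
    & ev w k p1 = ev w c2 c3].

Lemma block_form_relation k c1 c2 c3 p1 p2 (a b v1 v2 v3 : K) :
  frame k c1 c2 c3 p1 p2 ->
  {in A, forall w, [/\ ev w p1 c1 = 0, ev w p1 c2 = 0 & ev w p1 c3 = 0]} ->
  {in A, forall w, [/\ ev w p2 c1 = 0, ev w p2 c2 = 0 & ev w p2 c3 = 0]} ->
  {in A, forall w, a * ev w k p1 + b * ev w k p2 +
    (v1 * ev w c2 c3 + v2 * ev w c3 c1 + v3 * ev w c1 c2) = 0} ->
  (a != 0) || (b != 0) -> v1 != 0 ->
  exists k c1 c2 c3 p1 p2, basis_of fullv [:: k; c1; c2; c3; p1; p2] /\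
    {in A, forall w, eqs_b w k c1 c2 c3 p1 p2}.
Proof.
move=> F z1 z2 rel ab v10; have [q [F' qp]] := frame_p char0 skA F ab.
(* Chosen with cross product [- v], so that [w(d2,d3)] is minus the [v]-part of the relation, which
   equals [w(k, a p1 + b p2)]. *)
pose d2 := - v2 *: c1 + v1 *: c2; pose d3 := (v3 / v1) *: c1 - c3.
have c1P : c1 \in <<[:: c1; c2; c3]>>%VS by rewrite memv_span // !inE eqxx.
have c2P : c2 \in <<[:: c1; c2; c3]>>%VS by rewrite memv_span // !inE eqxx orbT.
have c3P : c3 \in <<[:: c1; c2; c3]>>%VS by rewrite memv_span // !inE eqxx !orbT.
have sub : {subset [:: c1; d2; d3] <= <<[:: c1; c2; c3]>>%VS}.
  move=> x; rewrite !inE => /or3P[] /eqP -> //; first by rewrite memvD // memvZ.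
  by rewrite memvB // memvZ.
have fc : free [:: c1; c2; c3].
  by have := frame_basis4 F; rewrite free_cons => /andP[].
have fd : free [:: c1; d2; d3].
  apply: lc_free => -[|x1 [|x2 [|x3 []]]] //= _ e.
  have e' : lc [:: x1 + (x2 * - v2 + x3 * (v3 / v1)); x2 * v1; - x3] [:: c1; c2; c3] = 0.
    rewrite -[RHS]e /= /d2 /d3 !scalerDr !scalerA !addr0 scalerN scaleNr !scalerDl.
    by rewrite -!addrA; do 2!congr (_ + _); rewrite addrCA.
  have [h1 /eqP h2 /eqP h3] := free_lc fc e' erefl.
  move: h2 h3 h1; rewrite mulf_eq0 (negPf v10) orbF oppr_eq0 => /eqP -> /eqP ->.
  by rewrite !mul0r !addr0 => ->.
have G := frame_c F' fd sub; have [bW _ _] := G.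
exists k, c1, d2, d3, (a *: p1 + b *: p2), q; split => // w Aw.
have [_ kc _] := G; have [h1 h2 h3] := z1 w Aw; have [g1 g2 g3] := z2 w Aw.
have pc p c : p \in <<[:: p1; p2]>>%VS -> c \in <<[:: c1; c2; c3]>>%VS -> ev w p c = 0.
  apply: (ev_span (skA Aw)) => x y; rewrite !inE.
  by move=> /orP[] /eqP -> /or3P[] /eqP ->.
have pP : a *: p1 + b *: p2 \in <<[:: p1; p2]>>%VS.
  by rewrite memvD // memvZ // memv_span // !inE eqxx ?orbT.
have d2P : d2 \in <<[:: c1; c2; c3]>>%VS by apply: sub; rewrite !inE eqxx orbT.
have d3P : d3 \in <<[:: c1; c2; c3]>>%VS by apply: sub; rewrite !inE eqxx !orbT.
split; [exact: kc | split; exact: pc | split; exact: pc | ].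
rewrite /d2 /d3 evDr !evZr !evDl !evZl !evDr !evNr !evZr (sd c1 Aw) (sk Aw c2 c1) (sk Aw c1 c3).
apply/eqP; rewrite -subr_eq0; apply/eqP; by apply: (lin0 (rel w Aw) 1); field.
Qed.

(** On the hyperplane of [A] where [w(p1,p2) = 0], of dimension at most 4, the five remaining
    entries are dependent. The relation must involve both the [w(k,p_i)] and the [w(c_i,c_j)], since
    each group alone is independent; it is the missing equation of [eqs_b]. *)
Lemma block_form k c1 c2 c3 p1 p2 : frame k c1 c2 c3 p1 p2 ->
  {in A, forall w, [/\ ev w p1 c1 = 0, ev w p1 c2 = 0 & ev w p1 c3 = 0]} ->
  {in A, forall w, [/\ ev w p2 c1 = 0, ev w p2 c2 = 0 & ev w p2 c3 = 0]} ->
  exists k c1 c2 c3 p1 p2, basis_of fullv [:: k; c1; c2; c3; p1; p2] /\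
    {in A, forall w, eqs_b w k c1 c2 c3 p1 p2}.
Proof.
move=> F z1 z2; have [bW kc [w0 [A0 l0 e0]]] := F.
pose U := (A :&: lker (eval B p1 p2))%VS.
have dU : (\dim U < 5)%N.
  rewrite ltnNge; apply/negP => d5; have UA : U = A.
    by apply/eqP; rewrite eqEdim capvSl dimA.
  by move: A0; rewrite -UA memv_cap memv_ker evalE (negPf e0) andbF.
pose f (i : 'I_5) w := [:: ev w k p1; ev w k p2; ev w c2 c3; ev w c3 c1; ev w c1 c2]`_i.
have lf i : linf (f i).
  by case: i => [[|[|[|[|[|]]]]] // ?]; rewrite /f /=; apply: linf_ev.
have [l [lU l0']] := functionals_relation lf dU.
pose l_ (n : nat) := l (inord n).
have lE w : \sum_i l i * f i w = l_ 0%N * ev w k p1 + l_ 1%N * ev w k p2 +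
    (l_ 2%N * ev w c2 c3 + l_ 3%N * ev w c3 c1 + l_ 4%N * ev w c1 c2).
  rewrite !big_ord_recl big_ord0 addr0 !addrA /f /= /l_.
  by congr (_ + _ + _ + _ + _); congr (l _ * _); apply: val_inj; rewrite /= inordK.
have rel w : w \in A -> l_ 0%N * ev w k p1 + l_ 1%N * ev w k p2 +
    (l_ 2%N * ev w c2 c3 + l_ 3%N * ev w c3 c1 + l_ 4%N * ev w c1 c2) = 0.
  (* Subtracting a multiple of [w0] moves [w] into [U] without changing the five entries, as [k] and
     the [c_i] are in [ker w0]. *)
  move=> Aw; pose u := w - (ev w p1 p2 / ev w0 p1 p2) *: w0.
  have uU : u \in U.
    by rewrite memv_cap memvB ?memvZ //= memv_ker evalE evD evN evZ divfK // subrr.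
  have := lU u uU; rewrite lE.
  have z x y : x \in [:: k; c1; c2; c3] -> ev w0 x y = 0 by move/l0/ev_ker.
  have uE x y : x \in [:: k; c1; c2; c3] -> ev u x y = ev w x y.
    by move=> xl; rewrite evD evN evZ (z x) // mulr0 subr0.
  by rewrite !uE ?inE ?eqxx ?orbT.
have ab : (l_ 0%N != 0) || (l_ 1%N != 0).
  apply: contraT; rewrite negb_or !negbK => /andP[/eqP a0 /eqP b0].
  move: rel; rewrite a0 b0 => rel.
  have r w : w \in A -> l_ 2%N * ev w c2 c3 + l_ 3%N * ev w c3 c1 + l_ 4%N * ev w c1 c2 = 0.
    by move=> /rel e; rewrite -[RHS]e; ring.
  have F2 := frame_rot F; have F3 := frame_rot F2.
  have e2 := gamma_indep char0 skA ndA F r.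
  have e3 : l_ 3%N = 0.
    apply: (gamma_indep char0 skA ndA F2 (v2 := l_ 4%N) (v3 := l_ 2%N)) => w /r e.
    by rewrite -[RHS]e; ring.
  have e4 : l_ 4%N = 0.
    apply: (gamma_indep char0 skA ndA F3 (v2 := l_ 2%N) (v3 := l_ 3%N)) => w /r e.
    by rewrite -[RHS]e; ring.
  case: l0' => i /eqP[]; rewrite -(inord_val i).
  by case: i => [[|[|[|[|[|]]]]] // ?].
have F2 := frame_rot F; have F3 := frame_rot F2.
have [v2|/negPn/eqP v2] := boolP (l_ 2%N != 0).
  exact: (block_form_relation F z1 z2 rel ab v2).
have [v3|/negPn/eqP v3] := boolP (l_ 3%N != 0).
  apply: (block_form_relation F2 (v1 := l_ 3%N) (v2 := l_ 4%N) (v3 := l_ 2%N)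
    (a := l_ 0%N) (b := l_ 1%N)) => // w Aw.
  - by case: (z1 w Aw).
  - by case: (z2 w Aw).
  by rewrite -[RHS](rel w Aw); ring.
have [v4|/negPn/eqP v4] := boolP (l_ 4%N != 0).
  apply: (block_form_relation F3 (v1 := l_ 4%N) (v2 := l_ 2%N) (v3 := l_ 3%N)
    (a := l_ 0%N) (b := l_ 1%N)) => // w Aw.
  - by case: (z1 w Aw).
  - by case: (z2 w Aw).
  by rewrite -[RHS](rel w Aw); ring.
have r0 w : w \in A -> l_ 0%N * ev w k p1 + l_ 1%N * ev w k p2 = 0.
  by move=> Aw; rewrite -[RHS](rel w Aw) v2 v3 v4; ring.
have [x1 /r0 h1 [s1 t1]] := st_onto F 1 0; have [x2 /r0 h2 [s2 t2]] := st_onto F 0 1.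
move: ab h1 h2; rewrite s1 t1 s2 t2 !mulr0 !mulr1 add0r addr0 => ab h1 h2.
by move: ab; rewrite h1 h2 eqxx.
Qed.

(** Replacing [c_i] by [c_i + m_i k] leaves every [w(c_i,c_j)] unchanged and subtracts [w(k,p) m]
    from [g . a], so both sums become zero and [skew_part] applies. *)
Lemma shear_to_block_form k c1 c2 c3 p1 p2 (m1 m2 m3 : K) : frame k c1 c2 c3 p1 p2 ->
  {in A, forall w,
    ev w c2 c3 * ev w p1 c1 + ev w c3 c1 * ev w p1 c2 + ev w c1 c2 * ev w p1 c3 =
    ev w k p1 * (m1 * ev w c2 c3 + m2 * ev w c3 c1 + m3 * ev w c1 c2) /\
    ev w c2 c3 * ev w p2 c1 + ev w c3 c1 * ev w p2 c2 + ev w c1 c2 * ev w p2 c3 =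
    ev w k p2 * (m1 * ev w c2 c3 + m2 * ev w c3 c1 + m3 * ev w c1 c2)} ->
  exists c1' c2' c3' p1' p2', [/\ frame k c1' c2' c3' p1' p2',
    {in A, forall w, [/\ ev w p1' c1' = 0, ev w p1' c2' = 0 & ev w p1' c3' = 0]} &
    {in A, forall w, [/\ ev w p2' c1' = 0, ev w p2' c2' = 0 & ev w p2' c3' = 0]}].
Proof.
move=> F mE; have F' := frame_shift_c char0 skA m1 m2 m3 F.
pose d1 := c1 + m1 *: k; pose d2 := c2 + m2 *: k; pose d3 := c3 + m3 *: k.
have [_ kc _] := F.
have gE w : w \in A -> [/\ ev w d2 d3 = ev w c2 c3, ev w d3 d1 = ev w c3 c1 &
    ev w d1 d2 = ev w c1 c2].
  move=> Aw; have [h1 h2 h3] := kc w Aw.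
  have dk x : ev w x k = - ev w k x by apply: sk.
  by split; rewrite !evDl !evDr !evZl !evZr (sd k Aw) ?(dk c1) ?(dk c2) ?(dk c3) ?h1 ?h2 ?h3; ring.
have pE p w : w \in A -> ev w c2 c3 * ev w p d1 + ev w c3 c1 * ev w p d2 +
    ev w c1 c2 * ev w p d3 = ev w c2 c3 * ev w p c1 + ev w c3 c1 * ev w p c2 +
    ev w c1 c2 * ev w p c3 -
    ev w k p * (m1 * ev w c2 c3 + m2 * ev w c3 c1 + m3 * ev w c1 c2).
  by move=> Aw; rewrite !evDr !evZr (sk Aw p k); ring.
have z1 : {in A, forall w,
    ev w d2 d3 * ev w p1 d1 + ev w d3 d1 * ev w p1 d2 + ev w d1 d2 * ev w p1 d3 = 0}.
  by move=> w Aw; have [-> -> ->] := gE w Aw; rewrite pE // (mE w Aw).1 subrr.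
have z2 : {in A, forall w,
    ev w d2 d3 * ev w p2 d1 + ev w d3 d1 * ev w p2 d2 + ev w d1 d2 * ev w p2 d3 = 0}.
  by move=> w Aw; have [-> -> ->] := gE w Aw; rewrite pE // (mE w Aw).2 subrr.
have [x xc xE] := skew_part char0 skA ndA F' (le p1 d1) (le p1 d2) (le p1 d3) z1.
have [y yc yE] := skew_part char0 skA ndA F' (le p2 d1) (le p2 d2) (le p2 d3) z2.
exists d1, d2, d3, (p1 + x), (p2 + y); split; first exact: (frame_shift_p skA F').
- by move=> w Aw; have [e1 e2 e3] := xE w Aw; rewrite !evDl e1 e2 e3 !subrr.
by move=> w Aw; have [e1 e2 e3] := yE w Aw; rewrite !evDl e1 e2 e3 !subrr.
Qed.

Lemma conic_form k c1 c2 c3 p1 p2 (m : B -> K) w1 : frame k c1 c2 c3 p1 p2 -> linf m ->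
  {in A, forall w,
    ev w c2 c3 * ev w p1 c1 + ev w c3 c1 * ev w p1 c2 + ev w c1 c2 * ev w p1 c3 =
    ev w k p1 * m w /\
    ev w c2 c3 * ev w p2 c1 + ev w c3 c1 * ev w p2 c2 + ev w c1 c2 * ev w p2 c3 =
    ev w k p2 * m w} ->
  w1 \in A -> ev w1 c2 c3 = 0 -> ev w1 c3 c1 = 0 -> ev w1 c1 c2 = 0 -> m w1 != 0 ->
  exists k c1 c2 c3 p1 p2, basis_of fullv [:: k; c1; c2; c3; p1; p2] /\
    {in A, forall w, eqs_a w k c1 c2 c3 p1 p2}.
Proof.
move=> F lm mE A1 g1 g2 g3 mw1; have onto := gamma_onto char0 skA ndA F.
(* On the common kernel of the [w(c_i,c_j)], [f m] vanishes and [f w1 = 0]; the product at [w + w1]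
   leaves [f w * m w1]. *)
have cancel_m (f : B -> K) (q : B -> K) : linf f ->
    {in A, forall w, ev w c2 c3 = 0 -> ev w c3 c1 = 0 -> ev w c1 c2 = 0 -> f w * m w = 0} ->
    {in A, forall w, ev w c2 c3 = 0 -> ev w c3 c1 = 0 -> ev w c1 c2 = 0 -> f w = 0}.
  move=> lf fm w Aw h1 h2 h3.
  have f1 : f w1 = 0 by have /eqP := fm w1 A1 g1 g2 g3; rewrite mulf_eq0 (negPf mw1) orbF => /eqP.
  have := fm _ (memvD Aw A1); rewrite !evD h1 h2 h3 g1 g2 g3 addr0 => /(_ erefl erefl erefl).
  rewrite !linfD // f1 addr0 mulrDr fm // add0r => /eqP.
  by rewrite mulf_eq0 (negPf mw1) orbF => /eqP.
have s0 := cancel_m _ (fun=> 0) (le k p1) _; have t0 := cancel_m _ (fun=> 0) (le k p2) _.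
have [s1 [s2 [s3 sE]]] : exists s1 s2 s3 : K, {in A, forall w,
    ev w k p1 = s1 * ev w c2 c3 + s2 * ev w c3 c1 + s3 * ev w c1 c2}.
  apply: (linf_factor (le c2 c3) (le c3 c1) (le c1 c2) (le k p1) onto).
  by apply: s0 => w Aw h1 h2 h3; rewrite -(mE w Aw).1 h1 h2 h3; ring.
have [t1 [t2 [t3 tE]]] : exists t1 t2 t3 : K, {in A, forall w,
    ev w k p2 = t1 * ev w c2 c3 + t2 * ev w c3 c1 + t3 * ev w c1 c2}.
  apply: (linf_factor (le c2 c3) (le c3 c1) (le c1 c2) (le k p2) onto).
  by apply: t0 => w Aw h1 h2 h3; rewrite -(mE w Aw).2 h1 h2 h3; ring.
have la p c (a : K) : linf (fun w => ev w p c - a * m w).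
  by move=> b u v; rewrite evD evZ lm; ring.
have z1 : {in A, forall w, ev w c2 c3 * (ev w p1 c1 - s1 * m w) +
    ev w c3 c1 * (ev w p1 c2 - s2 * m w) + ev w c1 c2 * (ev w p1 c3 - s3 * m w) = 0}.
  move=> w Aw; have := (mE w Aw).1; rewrite sE // => e.
  by apply: (lin0 e 1); ring.
have z2 : {in A, forall w, ev w c2 c3 * (ev w p2 c1 - t1 * m w) +
    ev w c3 c1 * (ev w p2 c2 - t2 * m w) + ev w c1 c2 * (ev w p2 c3 - t3 * m w) = 0}.
  move=> w Aw; have := (mE w Aw).2; rewrite tE // => e.
  by apply: (lin0 e 1); ring.
have [x xc xE] := skew_part char0 skA ndA F (la p1 c1 s1) (la p1 c2 s2) (la p1 c3 s3) z1.
have [y yc yE] := skew_part char0 skA ndA F (la p2 c1 t1) (la p2 c2 t2) (la p2 c3 t3) z2.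
have F' := frame_shift_p skA F xc yc.
(* A vector [r] with [det(s,t,r) = 1]: take the cross product of the [g]-values of two forms on
   which [(w(k,p1), w(k,p2))] is [(1,0)] and [(0,1)], and use Lagrange's identity. *)
have [r1 [r2 [r3 det1]]] : exists r1 r2 r3 : K,
    (s2 * t3 - s3 * t2) * r1 + (s3 * t1 - s1 * t3) * r2 + (s1 * t2 - s2 * t1) * r3 = 1.
  have [u Au [su tu]] := st_onto F 1 0; have [v Av [sv tv]] := st_onto F 0 1.
  exists (ev u c3 c1 * ev v c1 c2 - ev u c1 c2 * ev v c3 c1),
    (ev u c1 c2 * ev v c2 c3 - ev u c2 c3 * ev v c1 c2),
    (ev u c2 c3 * ev v c3 c1 - ev u c3 c1 * ev v c2 c3).
  move: su tu sv tv; rewrite !sE // !tE // => su tu sv tv.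
  transitivity (1 * 1 - 0 * 0 : K); last by ring.
  by rewrite -{1}su -{1}tv -{1}sv -{1}tu; ring.
(* The basis dual to [s], [t], [r], given by their cross products. After the shift the pairings of
   [p1], [p2] with the [c_i] are [m s] and [m t], so in this basis only one entry of each
   survives. *)
pose d1 := (t2 * r3 - t3 * r2) *: c1 + (t3 * r1 - t1 * r3) *: c2 + (t1 * r2 - t2 * r1) *: c3.
pose d2 := (r2 * s3 - r3 * s2) *: c1 + (r3 * s1 - r1 * s3) *: c2 + (r1 * s2 - r2 * s1) *: c3.
pose d3 := (s2 * t3 - s3 * t2) *: c1 + (s3 * t1 - s1 * t3) *: c2 + (s1 * t2 - s2 * t1) *: c3.
have cP : {subset [:: c1; c2; c3] <= <<[:: c1; c2; c3]>>%VS} by move=> z; apply: memv_span.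
have comb (a b e : K) : a *: c1 + b *: c2 + e *: c3 \in <<[:: c1; c2; c3]>>%VS.
  by rewrite !memvD // memvZ // cP // !inE eqxx ?orbT.
have sub : {subset [:: d1; d2; d3] <= <<[:: c1; c2; c3]>>%VS}.
  by move=> z; rewrite !inE => /or3P[] /eqP ->; apply: comb.
have fc : free [:: c1; c2; c3].
  by have := frame_basis4 F; rewrite free_cons => /andP[].
have fd : free [:: d1; d2; d3].
  apply: lc_free => -[|x1 [|x2 [|x3 []]]] //= _ e.
  have e' : lc [::
      x1 * (t2 * r3 - t3 * r2) + x2 * (r2 * s3 - r3 * s2) + x3 * (s2 * t3 - s3 * t2);
      x1 * (t3 * r1 - t1 * r3) + x2 * (r3 * s1 - r1 * s3) + x3 * (s3 * t1 - s1 * t3);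
      x1 * (t1 * r2 - t2 * r1) + x2 * (r1 * s2 - r2 * s1) + x3 * (s1 * t2 - s2 * t1)]
      [:: c1; c2; c3] = 0.
    have lc3 (a b f : K) : a *: c1 + b *: c2 + f *: c3 = lc [:: a; b; f] [:: c1; c2; c3].
      by rewrite /= addr0 addrA.
    by rewrite -[RHS]e /d1 /d2 /d3 addr0 !lc3 !lcZ addrA !lcD.
  have [h1 h2 h3] := free_lc fc e' erefl.
  congr [:: _; _; _]; rewrite -[LHS]mulr1 -det1.
  - by apply: (lin0 h1 s1); apply: (lin0 h2 s2); apply: (lin0 h3 s3); ring.
  - by apply: (lin0 h1 t1); apply: (lin0 h2 t2); apply: (lin0 h3 t3); ring.
  by apply: (lin0 h1 r1); apply: (lin0 h2 r2); apply: (lin0 h3 r3); ring.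
have G := frame_c F' fd sub; have [bW kc _] := G.
exists k, d1, d2, d3, (p1 + x), (p2 + y); split => // w Aw.
have [e1 e2 e3] := xE w Aw; have [f1 f2 f3] := yE w Aw.
have a1 : ev w (p1 + x) c1 = s1 * m w by rewrite evDl e1; ring.
have a2 : ev w (p1 + x) c2 = s2 * m w by rewrite evDl e2; ring.
have a3 : ev w (p1 + x) c3 = s3 * m w by rewrite evDl e3; ring.
have b1 : ev w (p2 + y) c1 = t1 * m w by rewrite evDl f1; ring.
have b2 : ev w (p2 + y) c2 = t2 * m w by rewrite evDl f2; ring.
have b3 : ev w (p2 + y) c3 = t3 * m w by rewrite evDl f3; ring.
have kx : ev w k x = 0 by apply: (frame_k_c F).
have ky : ev w k y = 0 by apply: (frame_k_c F).
have crossE (u1 u2 u3 v1 v2 v3 : K) :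
    ev w (u1 *: c1 + u2 *: c2 + u3 *: c3) (v1 *: c1 + v2 *: c2 + v3 *: c3) =
    (u2 * v3 - u3 * v2) * ev w c2 c3 + (u3 * v1 - u1 * v3) * ev w c3 c1 +
    (u1 * v2 - u2 * v1) * ev w c1 c2.
  rewrite !evDl !evDr !evZl !evZr !(sd _ Aw) (sk Aw c2 c1) (sk Aw c1 c3) (sk Aw c3 c2).
  by ring.
have pd p (v1 v2 v3 : K) : ev w p (v1 *: c1 + v2 *: c2 + v3 *: c3) =
    v1 * ev w p c1 + v2 * ev w p c2 + v3 * ev w p c3 by rewrite !evDr !evZr.
(* Inserting the determinant makes both sides homogeneous, so that [ring] can finish. *)
have det1m (u : K) : u = u * ((s2 * t3 - s3 * t2) * r1 + (s3 * t1 - s1 * t3) * r2 +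
  (s1 * t2 - s2 * t1) * r3) by rewrite det1 mulr1.
split; first exact: kc.
- by split; rewrite pd ?a1 ?a2 ?a3 ?b1 ?b2 ?b3; ring.
- by rewrite !pd a1 a2 a3 b1 b2 b3; ring.
- by rewrite evDr kx addr0 crossE sE // [LHS]det1m; ring.
by rewrite evDr ky addr0 crossE tE // [LHS]det1m; ring.
Qed.

Lemma normal_form : exists k c1 c2 c3 p1 p2,
  basis_of fullv [:: k; c1; c2; c3; p1; p2] /\
  ({in A, forall w, eqs_a w k c1 c2 c3 p1 p2} \/ {in A, forall w, eqs_b w k c1 c2 c3 p1 p2}).
Proof.
have [k [c1 [c2 [c3 [p1 [p2 F]]]]]] := frame_exists closedK char0 dimW dimA skA rkA ndA.
have [x1 X1 [s1 t1]] := st_onto F 1 0; have [x2 X2 [s2 t2]] := st_onto F 0 1.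
have lq := quadf_sum3 (le c2 c3) (le c3 c1) (le c1 c2) (le p1 c1) (le p1 c2) (le p1 c3).
have lr := quadf_sum3 (le c2 c3) (le c3 c1) (le c1 c2) (le p2 c1) (le p2 c2) (le p2 c3).
have [||m lm mE] := proportional_quadratics char0 (le k p1) (le k p2) lq lr
  _ X1 X2 s1 t1 s2 t2 (U := A).
- by move=> y a u v; rewrite !evD !evZ; ring.
- by move=> w Aw; apply: (frame_pfaffian char0 dimW skA rkA F Aw).
have onto := gamma_onto char0 skA ndA F.
have [[w1 A1 [g1 g2 g3 mw1]]|nE] := boolp.pselect (exists2 w, w \in A &
    [/\ ev w c2 c3 = 0, ev w c3 c1 = 0, ev w c1 c2 = 0 & m w != 0]).
  have [k' [d1 [d2 [d3 [q1 [q2 [bW h]]]]]]] := conic_form F lm mE A1 g1 g2 g3 mw1.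
  by exists k', d1, d2, d3, q1, q2; split => //; left.
have m0 w : w \in A -> ev w c2 c3 = 0 -> ev w c3 c1 = 0 -> ev w c1 c2 = 0 -> m w = 0.
  move=> Aw h1 h2 h3; apply/eqP; apply: boolp.contrapT => /negP h; apply: nE.
  by exists w.
have [m1 [m2 [m3 mm]]] := linf_factor (le c2 c3) (le c3 c1) (le c1 c2) lm onto m0.
have [|d1 [d2 [d3 [q1 [q2 [F' z1 z2]]]]]] := shear_to_block_form (m1 := m1) (m2 := m2) (m3 := m3) F.
  by move=> w Aw; rewrite -mm //; apply: mE.
have [k' [e1 [e2 [e3 [r1 [r2 [bW h]]]]]]] := block_form F' z1 z2.
by exists k', e1, e2, e3, r1, r2; split => //; right.
Qed.

End NormalForm.

(** * The two spaces *)

Section Spaces.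
Variables (K : fieldType) (W : vectType K).
Hypothesis char0 : forall n, n.+1%:R != 0 :> K.
Hypothesis dimW : \dim {:W} = 6%N.
Implicit Types (w : bform W) (a b : dual W) (u x y : W).
Local Notation ev := (@ev K W (bforms W)).

Lemma ev_wedge a b u x : ev (wedge a b) u x = (a u : K) * b x - (b u : K) * a x.
Proof. exact: wedgeE. Qed.

Lemma skew_wedge a b : skew (wedge a b).
Proof. by move=> u x; rewrite !wedgeE; ring. Qed.

Definition dual_lists (f : seq (dual W)) (v : seq W) :=
  forall i j, (i < 6)%N -> (j < 6)%N -> f`_i v`_j = (i == j)%:R.

Lemma dual_lists_basis f v : dual_lists f v -> size v = 6%N -> basis_of {:W} v.
Proof.
case: v => [|v1 [|v2 [|v3 [|v4 [|v5 [|v6 []]]]]]] // D _.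
rewrite basisEfree subvf dimW leqnn !andbT.
apply: lc_free => -[|k1 [|k2 [|k3 [|k4 [|k5 [|k6 []]]]]]] // _ e.
have h i : f`_i (lc [:: k1; k2; k3; k4; k5; k6] [:: v1; v2; v3; v4; v5; v6]) = 0.
  by rewrite e linear0.
have D1 i (i6 : (i < 6)%N) : f`_i v1 = (i == 0)%:R := D i 0 i6 isT.
have D2 i (i6 : (i < 6)%N) : f`_i v2 = (i == 1)%:R := D i 1 i6 isT.
have D3 i (i6 : (i < 6)%N) : f`_i v3 = (i == 2)%:R := D i 2 i6 isT.
have D4 i (i6 : (i < 6)%N) : f`_i v4 = (i == 3)%:R := D i 3 i6 isT.
have D5 i (i6 : (i < 6)%N) : f`_i v5 = (i == 4)%:R := D i 4 i6 isT.
have D6 i (i6 : (i < 6)%N) : f`_i v6 = (i == 5)%:R := D i 5 i6 isT.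
by congr [:: _; _; _; _; _; _];
  [move: (h 0%N) | move: (h 1%N) | move: (h 2%N) | move: (h 3%N)
  | move: (h 4%N) | move: (h 5%N)];
  rewrite /= !linearD !linearZ linear0 /= D1 // D2 // D3 // D4 // D5 // D6 //
    /GRing.scale /= !mulr0 mulr1 ?addr0 ?add0r.
Qed.

Lemma dual_vectors (e : 6.-tuple (dual W)) : basis_of fullv e ->
  exists v : 6.-tuple W, dual_lists e v.
Proof.
move=> be; pose f (i : 'I_6) u : K := e`_i u.
have lf i : linf (f i) by move=> c x y; rewrite /f linearP.
have h (k : 'I_6 -> K) : {in fullv, forall u, \sum_i k i * f i u = 0} -> forall i, k i = 0.
  move=> kE; apply: (freeP (X := e) _ k); first exact: basis_free be.
  apply/lfunP => u; rewrite sum_lfunE zero_lfunE -[RHS](kE u (memvf u)).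
  by apply: eq_bigr => i _; rewrite scale_lfunE.
have /boolp.choice[v vP] : forall j : 'I_6, exists x, forall i : 'I_6, f i x = (i == j)%:R.
  by move=> j; have [u _ uE] := functionals_onto lf h (fun i => (i == j)%:R); exists u.
exists [tuple v j | j < 6] => i j i6 j6.
have -> : [tuple v j | j < 6]`_j = v (Ordinal j6).
  by rewrite -[j]/(val (Ordinal j6)) -tnth_nth tnth_mktuple.
exact: (vP (Ordinal j6) (Ordinal i6)).
Qed.

(** A product of equations, usable as a single rewrite rule for all 36 values. *)
Lemma dual_table f1 f2 f3 f4 f5 f6 v1 v2 v3 v4 v5 v6 :
  dual_lists [:: f1; f2; f3; f4; f5; f6] [:: v1; v2; v3; v4; v5; v6] ->
  (((f1 v1 = 1) * (f1 v2 = 0) * (f1 v3 = 0) * (f1 v4 = 0) * (f1 v5 = 0) * (f1 v6 = 0)) *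
  ((f2 v1 = 0) * (f2 v2 = 1) * (f2 v3 = 0) * (f2 v4 = 0) * (f2 v5 = 0) * (f2 v6 = 0)) *
  ((f3 v1 = 0) * (f3 v2 = 0) * (f3 v3 = 1) * (f3 v4 = 0) * (f3 v5 = 0) * (f3 v6 = 0)) *
  ((f4 v1 = 0) * (f4 v2 = 0) * (f4 v3 = 0) * (f4 v4 = 1) * (f4 v5 = 0) * (f4 v6 = 0)) *
  ((f5 v1 = 0) * (f5 v2 = 0) * (f5 v3 = 0) * (f5 v4 = 0) * (f5 v5 = 1) * (f5 v6 = 0)) *
  ((f6 v1 = 0) * (f6 v2 = 0) * (f6 v3 = 0) * (f6 v4 = 0) * (f6 v5 = 0) * (f6 v6 = 1)))%type.
Proof.
move=> D; have h i j (i6 : (i < 6)%N) (j6 : (j < 6)%N) := D i j i6 j6.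
do ![split];
  [ exact: (h 0%N 0%N) | exact: (h 0%N 1%N) | exact: (h 0%N 2%N)
  | exact: (h 0%N 3%N) | exact: (h 0%N 4%N) | exact: (h 0%N 5%N)
  | exact: (h 1%N 0%N) | exact: (h 1%N 1%N) | exact: (h 1%N 2%N)
  | exact: (h 1%N 3%N) | exact: (h 1%N 4%N) | exact: (h 1%N 5%N)
  | exact: (h 2%N 0%N) | exact: (h 2%N 1%N) | exact: (h 2%N 2%N)
  | exact: (h 2%N 3%N) | exact: (h 2%N 4%N) | exact: (h 2%N 5%N)
  | exact: (h 3%N 0%N) | exact: (h 3%N 1%N) | exact: (h 3%N 2%N)
  | exact: (h 3%N 3%N) | exact: (h 3%N 4%N) | exact: (h 3%N 5%N)
  | exact: (h 4%N 0%N) | exact: (h 4%N 1%N) | exact: (h 4%N 2%N)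
  | exact: (h 4%N 3%N) | exact: (h 4%N 4%N) | exact: (h 4%N 5%N)
  | exact: (h 5%N 0%N) | exact: (h 5%N 1%N) | exact: (h 5%N 2%N)
  | exact: (h 5%N 3%N) | exact: (h 5%N 4%N) | exact: (h 5%N 5%N) ].
Qed.

Lemma bform_ext_basis (s : seq W) w1 w2 : basis_of {:W} s -> skew w1 -> skew w2 ->
  {in s &, forall x y, ev w1 x y = ev w2 x y} -> w1 = w2.
Proof.
move=> bs s1 s2 h; apply: (@ev_ext _ _ (bforms W)) => x y; apply/eqP; rewrite -subr_eq0.
rewrite -(@evN _ _ (bforms W)) -(@evD _ _ (bforms W)); apply/eqP.
apply: (@ev_span _ _ (bforms W) _ s s); rewrite ?(span_basis bs) ?memvf //.
  move=> a b; rewrite !(@evD _ _ (bforms W)) !(@evN _ _ (bforms W)) opprD.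
  by congr (_ + - _); [exact: s1 | exact: s2].
by move=> a b sa sb; rewrite (@evD _ _ (bforms W)) (@evN _ _ (bforms W)) h // subrr.
Qed.

Lemma skew_ext6 v1 v2 v3 v4 v5 v6 w1 w2 : basis_of {:W} [:: v1; v2; v3; v4; v5; v6] ->
  skew w1 -> skew w2 ->
  ev w1 v1 v2 = ev w2 v1 v2 ->
  ev w1 v1 v3 = ev w2 v1 v3 ->
  ev w1 v1 v4 = ev w2 v1 v4 ->
  ev w1 v1 v5 = ev w2 v1 v5 ->
  ev w1 v1 v6 = ev w2 v1 v6 ->
  ev w1 v2 v3 = ev w2 v2 v3 ->
  ev w1 v2 v4 = ev w2 v2 v4 ->
  ev w1 v2 v5 = ev w2 v2 v5 ->
  ev w1 v2 v6 = ev w2 v2 v6 ->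
  ev w1 v3 v4 = ev w2 v3 v4 ->
  ev w1 v3 v5 = ev w2 v3 v5 ->
  ev w1 v3 v6 = ev w2 v3 v6 ->
  ev w1 v4 v5 = ev w2 v4 v5 ->
  ev w1 v4 v6 = ev w2 v4 v6 ->
  ev w1 v5 v6 = ev w2 v5 v6 ->
  w1 = w2.
Proof.
move=> bs s1 s2 h12 h13 h14 h15 h16 h23 h24 h25 h26 h34 h35 h36 h45 h46 h56.
have d1 x : ev w1 x x = 0 := @ev_diag _ _ (bforms W) char0 w1 x s1.
have d2 x : ev w2 x x = 0 := @ev_diag _ _ (bforms W) char0 w2 x s2.
have k1 x y : ev w1 x y = - ev w1 y x := s1 x y.
have k2 x y : ev w2 x y = - ev w2 y x := s2 x y.
apply: (bform_ext_basis bs s1 s2) => x y.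
rewrite !inE; do 5?case/orP; move=> /eqP -> ; do 5?case/orP; move=> /eqP ->;
  rewrite ?d1 ?d2 // k1 [RHS]k2;
  by rewrite ?h12 ?h13 ?h14 ?h15 ?h16 ?h23 ?h24 ?h25 ?h26 ?h34 ?h35 ?h36 ?h45 ?h46 ?h56.
Qed.

Lemma ev_space_a (f1 f2 f3 f4 f5 f6 : dual W) (sz : size [:: f1; f2; f3; f4; f5; f6] == 6)
    (k1 k2 k3 k4 k5 : K) x y :
  ev (lc [:: k1; k2; k3; k4; k5] (space_a_gens (Tuple sz))) x y =
    k1 * (f1 x * f4 y - f4 x * f1 y + (f2 x * f5 y - f5 x * f2 y)) +
    k2 * (f1 x * f6 y - f6 x * f1 y + (f3 x * f5 y - f5 x * f3 y)) +
    k3 * (f2 x * f6 y - f6 x * f2 y - (f3 x * f4 y - f4 x * f3 y)) +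
    k4 * (f1 x * f2 y - f2 x * f1 y) + k5 * (f4 x * f5 y - f5 x * f4 y).
Proof.
rewrite /= addr0 !(@evD _ _ (bforms W)) !(@evZ _ _ (bforms W)) !(@evD _ _ (bforms W)).
by rewrite (@evN _ _ (bforms W)) !ev_wedge; ring.
Qed.

Lemma skew_space_a (f1 f2 f3 f4 f5 f6 : dual W) (sz : size [:: f1; f2; f3; f4; f5; f6] == 6)
    (k1 k2 k3 k4 k5 : K) : skew (lc [:: k1; k2; k3; k4; k5] (space_a_gens (Tuple sz))).
Proof.
by move=> x y; rewrite -[LHS]/(ev _ x y) -[X in - X]/(ev _ y x) !ev_space_a; ring.
Qed.

(** In the basis dual to [e] the ten equations leave five of the fifteen entries free, and these are
    the coefficients on the five generators, collected in [G]. *)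
Lemma space_aP (e : 6.-tuple (dual W)) (v : 6.-tuple W) w : dual_lists e v ->
  w \in space_a e <-> skew w /\
    eqs_a (B := bforms W) w v`_5 v`_3 v`_4 v`_2 v`_0 v`_1.
Proof.
case: e v => -[|f1 [|f2 [|f3 [|f4 [|f5 [|f6 []]]]]]] // se [].
case=> [|v1 [|v2 [|v3 [|v4 [|v5 [|v6 []]]]]]] // ? D /=.
have bv := dual_lists_basis D erefl.
have T := dual_table D.
split=> [/span_lc[[|k1 [|k2 [|k3 [|k4 [|k5 []]]]]] // _ ->] | [sw]].
  split; first exact: skew_space_a.
  by rewrite /eqs_a !ev_space_a !T; do ![split]; ring.
case=> [[h64 h65 h63] [h15 h13 h24 h23] h1425 h61 h62].
have k1 x y : ev w x y = - ev w y x := sw x y.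
pose G := lc [:: ev w v1 v4; ev w v1 v6; ev w v2 v6; ev w v1 v2; ev w v4 v5]
    (space_a_gens (Tuple se)).
suff -> : w = G by apply: lc_span.
have sG : skew G by apply: skew_space_a.
have evG x y : ev G x y = _ := ev_space_a se _ _ _ _ _ x y.
apply: (skew_ext6 bv sw sG); rewrite evG !T {sG evG G}.
- by ring.
- by rewrite h13; ring.
- by ring.
- by rewrite h15; ring.
- by ring.
- by rewrite h23; ring.
- by rewrite h24; ring.
- by rewrite -h1425; ring.
- by ring.
- by rewrite -h62 (k1 v6 v2); ring.
- by rewrite (k1 v3 v5) -h61 (k1 v6 v1); ring.
- by rewrite (k1 v3 v6) h63; ring.
- by ring.
- by rewrite (k1 v4 v6) h64; ring.
- by rewrite (k1 v5 v6) h65; ring.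
Qed.

(** Adapted to the covectors [x1 - x5], [x2 + x4], [x3 + x6] in the generators of (b): in these sums
    and differences the space takes the form [eqs_b]. *)
Lemma sum_difference_basis v1 v2 v3 v4 v5 v6 : basis_of {:W} [:: v1; v2; v3; v4; v5; v6] ->
  basis_of {:W} [:: v3 - v6; v1 - v5; v2 + v4; v3 + v6; v2 - v4; v1 + v5].
Proof.
move=> bv; have n2 : 2%:R != 0 :> K := char0 1.
apply: (basis_change bv) => // x; set E := <<_>>%VS.
have E1 : {subset [:: v3 - v6; v1 - v5; v2 + v4; v3 + v6; v2 - v4; v1 + v5] <= E}.
  by move=> y; apply: memv_span.
have hf y z : y + z \in E -> y - z \in E -> y \in E /\ z \in E.
  move=> p m; split.
    have -> : y = (2%:R)^-1 *: (y + z + (y - z)).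
      by rewrite addrACA subrr addr0 -mulr2n -scaler_nat scalerA mulVf // scale1r.
    by rewrite memvZ // memvD.
  have -> : z = (2%:R)^-1 *: (y + z - (y - z)).
    by rewrite opprB addrC subrKA -mulr2n -scaler_nat scalerA mulVf // scale1r.
  by rewrite memvZ // memvB.
have [e1 e5] : v1 \in E /\ v5 \in E by apply: hf; apply: E1; rewrite !inE eqxx ?orbT.
have [e2 e4] : v2 \in E /\ v4 \in E by apply: hf; apply: E1; rewrite !inE eqxx ?orbT.
have [e3 e6] : v3 \in E /\ v6 \in E by apply: hf; apply: E1; rewrite !inE eqxx ?orbT.
by rewrite !inE; do 5?case/orP; move=> /eqP ->.
Qed.

Lemma sum_difference_table f1 f2 f3 f4 f5 f6 v1 v2 v3 v4 v5 v6 :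
  dual_lists [:: f1; f2; f3; f4; f5; f6] [:: v1; v2; v3; v4; v5; v6] ->
  (((f1 (v3 - v6)%R = 0) * (f2 (v3 - v6)%R = 0) * (f3 (v3 - v6)%R = 1) *
    (f4 (v3 - v6)%R = 0) * (f5 (v3 - v6)%R = 0) * (f6 (v3 - v6)%R = - 1)) *
  ((f1 (v1 - v5)%R = 1) * (f2 (v1 - v5)%R = 0) * (f3 (v1 - v5)%R = 0) *
    (f4 (v1 - v5)%R = 0) * (f5 (v1 - v5)%R = - 1) * (f6 (v1 - v5)%R = 0)) *
  ((f1 (v2 + v4)%R = 0) * (f2 (v2 + v4)%R = 1) * (f3 (v2 + v4)%R = 0) *
    (f4 (v2 + v4)%R = 1) * (f5 (v2 + v4)%R = 0) * (f6 (v2 + v4)%R = 0)) *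
  ((f1 (v3 + v6)%R = 0) * (f2 (v3 + v6)%R = 0) * (f3 (v3 + v6)%R = 1) *
    (f4 (v3 + v6)%R = 0) * (f5 (v3 + v6)%R = 0) * (f6 (v3 + v6)%R = 1)) *
  ((f1 (v2 - v4)%R = 0) * (f2 (v2 - v4)%R = 1) * (f3 (v2 - v4)%R = 0) *
    (f4 (v2 - v4)%R = - 1) * (f5 (v2 - v4)%R = 0) * (f6 (v2 - v4)%R = 0)) *
  ((f1 (v1 + v5)%R = 1) * (f2 (v1 + v5)%R = 0) * (f3 (v1 + v5)%R = 0) *
    (f4 (v1 + v5)%R = 0) * (f5 (v1 + v5)%R = 1) * (f6 (v1 + v5)%R = 0)))%type.
Proof.
move/dual_table=> T; do ![split]; rewrite linearD ?linearN /= !T;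
  by rewrite ?oppr0 ?addr0 ?add0r.
Qed.

Lemma ev_space_b (f1 f2 f3 f4 f5 f6 : dual W) (sz : size [:: f1; f2; f3; f4; f5; f6] == 6)
    (k1 k2 k3 k4 k5 : K) x y :
  ev (lc [:: k1; k2; k3; k4; k5] (space_b_gens (Tuple sz))) x y =
    k1 * (f1 x * f4 y - f4 x * f1 y + (f2 x * f5 y - f5 x * f2 y)) +
    k2 * (f1 x * f6 y - f6 x * f1 y + (f3 x * f5 y - f5 x * f3 y)) +
    k3 * (f2 x * f6 y - f6 x * f2 y - (f3 x * f4 y - f4 x * f3 y)) +
    k4 * ((f1 x - f5 x) * (f2 y + f4 y) - (f2 x + f4 x) * (f1 y - f5 y)) +
    k5 * ((f1 x - f5 x) * (f3 y + f6 y) - (f3 x + f6 x) * (f1 y - f5 y)).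
Proof.
rewrite /= addr0 !(@evD _ _ (bforms W)) !(@evZ _ _ (bforms W)) !(@evD _ _ (bforms W)).
by rewrite (@evN _ _ (bforms W)) !ev_wedge !(add_lfunE, opp_lfunE); ring.
Qed.

Lemma skew_space_b (f1 f2 f3 f4 f5 f6 : dual W) (sz : size [:: f1; f2; f3; f4; f5; f6] == 6)
    (k1 k2 k3 k4 k5 : K) : skew (lc [:: k1; k2; k3; k4; k5] (space_b_gens (Tuple sz))).
Proof.
by move=> x y; rewrite -[LHS]/(ev _ x y) -[X in - X]/(ev _ y x) !ev_space_b; ring.
Qed.

Lemma space_bP (e : 6.-tuple (dual W)) (v : 6.-tuple W) w : dual_lists e v ->
  w \in space_b e <-> skew w /\ eqs_b (B := bforms W) w (v`_2 - v`_5)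
    (v`_0 - v`_4) (v`_1 + v`_3) (v`_2 + v`_5) (v`_1 - v`_3) (v`_0 + v`_4).
Proof.
case: e v => -[|f1 [|f2 [|f3 [|f4 [|f5 [|f6 []]]]]]] // se [].
case=> [|v1 [|v2 [|v3 [|v4 [|v5 [|v6 []]]]]]] // ? D /=.
have bv := dual_lists_basis D erefl.
have S := sum_difference_table D.
have n2 : 2%:R != 0 :> K := char0 1.
have bd := sum_difference_basis bv.
split=> [/span_lc[[|k1 [|k2 [|k3 [|k4 [|k5 []]]]]] // _ ->] | [sw]].
  split; first exact: skew_space_b.
  by rewrite /eqs_b !ev_space_b !S; do ![split]; ring.
move: S bd.
move: (v3 - v6) (v1 - v5) (v2 + v4) (v3 + v6) (v2 - v4) (v1 + v5) => k c1 c2 c3 p1 p2.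
move=> S bd.
case=> [[kc1 kc2 kc3] [h11 h12 h13] [h21 h22 h23] h].
have k1 x y : ev w x y = - ev w y x := sw x y.
have n4 : 4%:R != 0 :> K := char0 3.
(* The coefficients solve the linear system for the five free entries; the table of values at sums
   and differences brings in the denominators 2 and 4. *)
pose G := lc [:: - ev w p2 p1 / 2%:R; - ev w p2 k / 2%:R; ev w c2 c3 / 2%:R;
    (ev w c1 c2 + ev w p2 p1) / 4%:R; (ev w c1 c3 + ev w p2 k) / 4%:R] (space_b_gens (Tuple se)).
suff -> : w = G by apply: lc_span.
have sG : skew G by apply: skew_space_b.
have evG x y : ev G x y = _ := ev_space_b se _ _ _ _ _ x y.
apply: (skew_ext6 bd sw sG); rewrite evG !S {sG evG G}.
- by rewrite kc1; ring.
- by rewrite kc2; ring.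
- by rewrite kc3; ring.
- by rewrite h; field; rewrite ?n4 ?n2.
- by rewrite (k1 k p2); field; rewrite ?n4 ?n2.
- by field; rewrite ?n4 ?n2.
- by field; rewrite ?n4 ?n2.
- by rewrite (k1 c1 p1) h11; ring.
- by rewrite (k1 c1 p2) h21; ring.
- by field; rewrite ?n4 ?n2.
- by rewrite (k1 c2 p1) h12; ring.
- by rewrite (k1 c2 p2) h22; ring.
- by rewrite (k1 c3 p1) h13; ring.
- by rewrite (k1 c3 p2) h23; ring.
by rewrite (k1 p1 p2); field; rewrite ?n4 ?n2.
Qed.

End Spaces.

Section Homogeneity.
Variables (K : fieldType) (W : vectType K) (B : forms W).
Implicit Types (w : B) (k c p : W) (m : K).

(** Absorbs the common factor that remains when a map is normalized to determinant 1. *)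
Lemma eqs_a_scale m w k c1 c2 c3 p1 p2 : eqs_a w k c1 c2 c3 p1 p2 ->
  eqs_a w (m *: k) (m *: c1) (m *: c2) (m *: c3) (m *: p1) (m *: p2).
Proof.
rewrite /eqs_a !evZl !evZr => -[[-> -> ->] [-> -> -> ->] -> -> ->].
by rewrite !mulr0.
Qed.

Lemma eqs_b_scale m w k c1 c2 c3 p1 p2 : eqs_b w k c1 c2 c3 p1 p2 ->
  eqs_b w (m *: k) (m *: c1) (m *: c2) (m *: c3) (m *: p1) (m *: p2).
Proof.
rewrite /eqs_b !evZl !evZr => -[[-> -> ->] [-> -> ->] [-> -> ->] ->].
by rewrite !mulr0.
Qed.

End Homogeneity.

Section Equivalence.
Variables (K : fieldType) (W : vectType K).
Hypothesis char0 : forall n, n.+1%:R != 0 :> K.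
Hypothesis dimW : \dim {:W} = 6%N.
Implicit Types (w : bform W) (g : 'End(W)) (e : 6.-tuple (dual W)) (v b : 6.-tuple W).
Local Notation ev := (@ev K W (bforms W)).

Definition pull_covectors g e : 6.-tuple (dual W) := map_tuple (fun f => (f \o g)%VF) e.
Definition pull_vectors g v : 6.-tuple W := map_tuple (g^-1)%VF v.

Lemma pull_vectorsE g v i : (i < 6)%N -> (pull_vectors g v)`_i = (g^-1)%VF v`_i.
Proof. by move=> i6; rewrite (nth_map 0) ?size_tuple. Qed.

Lemma pull_dual_lists g e v : lker g == 0%VS -> dual_lists e v ->
  dual_lists (pull_covectors g e) (pull_vectors g v).
Proof.
move=> lg D i j i6 j6; rewrite pull_vectorsE // (nth_map 0) ?size_tuple //.
by rewrite comp_lfunE lker0_lfunVK // D.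
Qed.

Lemma skew_act g w : lker g == 0%VS -> skew (act g w) <-> skew w.
Proof.
move=> lg; split=> s u x; last by rewrite !actE s.
by have := s (g u) (g x); rewrite !actE !lker0_lfunK.
Qed.

Lemma act_space_a g e v w : lker g == 0%VS -> dual_lists e v ->
  act g w \in space_a e <-> w \in space_a (pull_covectors g e).
Proof.
move=> lg D; rewrite (space_aP char0 dimW _ D).
rewrite (space_aP char0 dimW _ (pull_dual_lists lg D)) !pull_vectorsE //.
by rewrite skew_act // /eqs_a !ev_act.
Qed.

Lemma act_space_b g e v w : lker g == 0%VS -> dual_lists e v ->
  act g w \in space_b e <-> w \in space_b (pull_covectors g e).
Proof.
move=> lg D; rewrite (space_bP char0 dimW _ D).
rewrite (space_bP char0 dimW _ (pull_dual_lists lg D)) !pull_vectorsE //.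
by rewrite skew_act // -!linearB -!linearD /eqs_b !ev_act.
Qed.

End Equivalence.

Section Transport.
Variables (K : fieldType) (W : vectType K).
Hypothesis closedK : forall p : {poly K}, size p != 1%N -> exists x, root p x.
Hypothesis char0 : forall n, n.+1%:R != 0 :> K.
Hypothesis dimW : \dim {:W} = 6%N.
Implicit Types (w : bform W) (g : 'End(W)) (e : 6.-tuple (dual W)) (v b : 6.-tuple W).
Implicit Types (A : {vspace bform W}).
Local Notation ev := (@ev K W (bforms W)).

(** The map sending [b] to [v] is multiplied by a sixth root of its inverse determinant, at the
    price of the common factor [m]. *)
Lemma special_map v b : basis_of {:W} v -> basis_of {:W} b ->
  exists2 g, inSL g & exists2 m, m != 0 & forall i, (i < 6)%N -> (g^-1)%VF v`_i = m *: b`_i.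
Proof.
move=> bv bb; have [f fE] := linear_of_free b v.
have {}fE : map f b = v by rewrite fE ?(basis_free bb) // !size_tuple.
pose g0 : 'End(W) := linfun f.
have g0E i : (i < 6)%N -> g0 b`_i = v`_i.
  by move=> i6; rewrite lfunE -fE (nth_map 0) ?size_tuple.
have k0 : lker g0 == 0%VS.
  rewrite -dimv_eq0 -(eqn_add2r (\dim (limg g0))) -[lker g0]capfv limg_ker_dim add0n.
  suff -> : limg g0 = fullv by [].
  rewrite -{1}(span_basis bb) limg_span -(span_basis bv) -fE; congr <<_>>%VS.
  by apply: eq_map => u; rewrite lfunE.
have d0 := lker_dt k0.
have [|c /rootP] := closedK (p := 'X^6 - ((dt g0)^-1)%:P); first by rewrite size_XnsubC.
rewrite !(hornerE, hornerXn) => /eqP; rewrite subr_eq0 => /eqP c6.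
have c0 : c != 0.
  by apply: contraNneq d0 => c0; move: c6; rewrite c0 expr0n => /esym/eqP; rewrite invr_eq0.
pose g := c *: g0.
have SLg : inSL g.
  suff : dt g = 1 by [].
  by rewrite dtZ dimW c6 mulVf.
exists g => //; exists c^-1 => [|i i6]; first by rewrite invr_eq0.
apply: (lker0P (inSL_lker SLg)); rewrite lker0_lfunVK ?inSL_lker //.
by rewrite linearZ /= scale_lfunE g0E // scalerA mulVf ?scale1r.
Qed.

Lemma SL_equiv_space_a e A k c1 c2 c3 p1 p2 : basis_of fullv e ->
  \dim A = 5%N -> (forall w, w \in A -> skew w) ->
  basis_of {:W} [:: k; c1; c2; c3; p1; p2] ->
  {in A, forall w, eqs_a (B := bforms W) w k c1 c2 c3 p1 p2} ->
  SL_equiv A (space_a e).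
Proof.
move=> be dA skA bas eqA; have [v D] := dual_vectors be.
have bv := dual_lists_basis dimW D (size_tuple v).
(* Inverts the assignment of basis vectors in [space_aP]. *)
pose b := [tuple p1; p2; c3; c1; c2; k].
have bb : basis_of {:W} b.
  apply: (basis_change bas) => // u ub; apply: memv_span; move: ub.
  by rewrite !inE; do 5?case/orP; move=> ->; rewrite ?orbT.
have [g SLg [m m0 gE]] := special_map bv bb; exists g => //.
have lg := inSL_lker SLg.
have D' := pull_dual_lists lg D.
have -> : A = space_a (pull_covectors g e).
  apply/eqP; rewrite eqEdim dA (leq_trans (dim_span _)) // andbT; apply/subvP => w Aw.
  apply/(space_aP char0 dimW _ D'); split; first exact: skA.
  by rewrite !pull_vectorsE // !gE //; apply/eqs_a_scale/eqA.
by move=> w; apply/idP/idP => /(act_space_a char0 dimW _ lg D).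
Qed.

Lemma SL_equiv_space_b e A k c1 c2 c3 p1 p2 : basis_of fullv e ->
  \dim A = 5%N -> (forall w, w \in A -> skew w) ->
  basis_of {:W} [:: k; c1; c2; c3; p1; p2] ->
  {in A, forall w, eqs_b (B := bforms W) w k c1 c2 c3 p1 p2} ->
  SL_equiv A (space_b e).
Proof.
move=> be dA skA bas eqA; have [v D] := dual_vectors be.
have bv := dual_lists_basis dimW D (size_tuple v).
(* Inverts the sums and differences of [space_bP] up to the factor 2, which [eqs_b_scale] removes
   together with [m]. *)
pose b := [tuple c1 + p2; c2 + p1; c3 + k; c2 - p1; p2 - c1; c3 - k].
have n2 : 2%:R != 0 :> K := char0 1.
have E3 (x y : W) : x + y + (x - y) = 2%:R *: x.
  by rewrite addrACA subrr addr0 scaler_nat.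
have E2 (x y : W) : x + y + (y - x) = 2%:R *: y by rewrite [x + y]addrC E3.
have E1 (x y : W) : x + y - (y - x) = 2%:R *: x by rewrite opprB E3.
have E4 (x y : W) : x + y - (x - y) = 2%:R *: y by rewrite opprB E2.
have bb : basis_of {:W} b.
  apply: (basis_change bas) => //; set E := <<_>>%VS.
  have bE u : u \in val b -> u \in E by apply: memv_span.
  have h x : 2%:R *: x \in E -> x \in E.
    by move=> /(memvZ (2%:R)^-1); rewrite scalerA mulVf ?scale1r.
  move=> u; rewrite !inE; do 5?case/orP; move=> /eqP ->; apply: h;
    [rewrite -(E4 c3) | rewrite -(E1 _ p2) | rewrite -(E3 _ p1) | rewrite -(E3 _ k)
    | rewrite -(E4 c2) | rewrite -(E2 c1)];
    by (apply: memvB || apply: memvD); apply: bE; rewrite /= !inE eqxx ?orbT.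
have [g SLg [m m0 gE]] := special_map bv bb; exists g => //.
have lg := inSL_lker SLg.
have D' := pull_dual_lists lg D.
have -> : A = space_b (pull_covectors g e).
  apply/eqP; rewrite eqEdim dA (leq_trans (dim_span _)) // andbT; apply/subvP => w Aw.
  apply/(space_bP char0 dimW _ D'); split; first exact: skA.
  rewrite !pull_vectorsE // !gE // -!scalerBr -!scalerDr /= E4 E1 E3 E3 E4 E2.
  exact/eqs_b_scale/eqs_b_scale/eqA.
by move=> w; apply/idP/idP => /(act_space_b char0 dimW _ lg D).
Qed.

(** Moving the basis instead of the space: the intersection with the Grassmannian then only has to
    be computed for [space_a] of an arbitrary basis. *)
Lemma SL_equiv_a_pull e A : basis_of fullv e -> SL_equiv A (space_a e) ->
  exists e' v', dual_lists e' (v' : 6.-tuple W) /\ A = space_a (e' : 6.-tuple (dual W)).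
Proof.
move=> be [g SLg gA]; have [v D] := dual_vectors be; have lg := inSL_lker SLg.
exists (pull_covectors g e), (pull_vectors g v); split; first exact: pull_dual_lists.
apply/vspaceP => w; rewrite -gA.
by apply/idP/idP => /(act_space_a char0 dimW _ lg D).
Qed.

Lemma SL_equiv_b_pull e A : basis_of fullv e -> SL_equiv A (space_b e) ->
  exists e' v', dual_lists e' (v' : 6.-tuple W) /\ A = space_b (e' : 6.-tuple (dual W)).
Proof.
move=> be [g SLg gA]; have [v D] := dual_vectors be; have lg := inSL_lker SLg.
exists (pull_covectors g e), (pull_vectors g v); split; first exact: pull_dual_lists.
apply/vspaceP => w; rewrite -gA.
by apply/idP/idP => /(act_space_b char0 dimW _ lg D).
Qed.

End Transport.

(** * Intersections with the Grassmannian *)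

Section Rank2.
Variables (K : fieldType) (W : vectType K).
Hypothesis char0 : forall n, n.+1%:R != 0 :> K.
Hypothesis dimW : \dim {:W} = 6%N.
Implicit Types (w : bform W) (a b f g : dual W) (F : {vspace dual W}).
Local Notation ev := (@ev K W (bforms W)).
Local Notation pf4 := (@pf4 K W (bforms W)).

Lemma dim_lker_rank w : (\dim (lker w) + form_rank w = 6)%N.
Proof. by rewrite /form_rank -[lker w]capfv limg_ker_dim dimW. Qed.

Lemma rank2_pf4 w x y z t : skew w -> form_rank w = 2%N -> pf4 w x y z t = 0.
Proof.
move=> sw rw; apply: (@pf4_eq0 _ _ (bforms W) char0) => //.
by have := dim_lker_rank w; rewrite rw -[6%N]/(4 + 2)%N dimW -[ker _]/(lker w) => /addIn ->.
Qed.

Lemma wedge_suml I (r : seq I) (c : I -> K) (f : I -> dual W) b :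
  wedge (\sum_(i <- r) c i *: f i) b = \sum_(i <- r) c i *: wedge (f i) b.
Proof.
apply/lfunP => u; apply/lfunP => x; rewrite wedgeE !sum_lfunE mulr_suml mulr_sumr -sumrB.
apply: eq_bigr => i _; rewrite !scale_lfunE wedgeE /GRing.scale /=; ring.
Qed.

Lemma wedgeC a b : wedge a b = - wedge b a.
Proof.
by apply/lfunP => u; apply/lfunP => x; rewrite !opp_lfunE !wedgeE; ring.
Qed.

Lemma wedge_ext2 F a b : a \in F -> b \in F -> wedge a b \in ext2 F.
Proof.
move=> aF bF; rewrite (coord_vbasis aF) wedge_suml; apply: memv_suml => i _.
apply: memvZ; rewrite wedgeC memvN (coord_vbasis bF) wedge_suml.
apply: memv_suml => j _; apply: memvZ; rewrite wedgeC memvN; apply: memv_span.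
by apply: allpairs_f; rewrite mem_nth ?size_tuple.
Qed.

(** The image lies in the span of [a] and [b], and rank 1 is excluded by parity. *)
Lemma rank_wedge a b : wedge a b != 0 -> form_rank (wedge a b) = 2%N.
Proof.
move=> w0; have := dim_lker_rank (wedge a b).
have le2 : (form_rank (wedge a b) <= 2)%N.
  apply: leq_trans (dim_span [:: a; b]); apply: dimvS; apply/subvP => f /memv_imgP[u _ ->].
  by rewrite lfunE memvB // memvZ // memv_span // !inE eqxx ?orbT.
have n5 : \dim (lker (wedge a b)) <> 5%N.
  by apply: (@dim_ker_neq5 _ _ (bforms W)) => //; apply: skew_wedge.
have n0 : form_rank (wedge a b) != 0%N.
  apply: contra w0; rewrite dimv_eq0 => /eqP l0; apply/eqP/lfunP => u.
  by apply/eqP; rewrite zero_lfunE -memv0 -l0 memv_img ?memvf.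
move: le2 n5 n0; case: form_rank => [|[|[|]]] // _ n5 _.
by rewrite addn1 => -[/n5].
Qed.

End Rank2.

Section PlaneSections.
Variables (K : fieldType) (W : vectType K).
Hypothesis char0 : forall n, n.+1%:R != 0 :> K.
Hypothesis dimW : \dim {:W} = 6%N.
Implicit Types (w : bform W) (a b f g : dual W) (F : {vspace dual W}).
Local Notation ev := (@ev K W (bforms W)).
Local Notation pf4 := (@pf4 K W (bforms W)).

(** [Q] is the matrix of [2 (s t - r^2)]. The conic [s t = r^2] is the Pfaffian condition on the
    forms with coordinates [(r, s, t)] in the plane of [space_a_meets]. *)
Lemma conic_matrix : exists Q : 'M[K]_3, [/\ Q^T = Q, Q \in unitmx &
  forall x : 'rV[K]_3, x *m Q *m x^T = 0 <->
    x 0 (lift ord0 ord0) * x 0 (lift ord0 (lift ord0 ord0)) = x 0 ord0 ^+ 2].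
Proof.
have n2 : 2%:R != 0 :> K := char0 1.
pose M (c : K) : 'M[K]_3 := \matrix_(i, j)
  nth 0 (nth [::] [:: [:: c; 0; 0]; [:: 0; 0; 1]; [:: 0; 1; 0]] i) j.
exists (M (- 2%:R)); split.
- by apply/matrixP => -[[|[|[|//]]] ?] [[|[|[|//]]] ?]; rewrite !mxE.
- apply: (mulmx1_unit (B := M (- (2%:R)^-1)) _).1.
  apply/matrixP => -[[|[|[|//]]] ?] [[|[|[|//]]] ?]; rewrite !mxE !big_ord_recl big_ord0 !mxE /=;
    by rewrite ?mulrNN ?mulfV // !(mulr0, mul0r, mulr1, addr0, add0r).
move=> x; set r := x 0 ord0; set s := x 0 _; set t := x 0 (lift ord0 (lift ord0 ord0)).
have E : (x *m M (- 2%:R) *m x^T) 0 0 = 2%:R * (s * t - r ^+ 2).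
  by rewrite !(mxE, big_ord_recl, big_ord0) /= -/r -/s -/t; ring.
split=> [h|st].
  move/eqP: E; rewrite h mxE eq_sym mulf_eq0 (negPf n2) subr_eq0 => /eqP; exact.
by apply/matrixP => i j; rewrite !ord1 E st subrr mulr0 mxE.
Qed.

Lemma space_a_meets (e : 6.-tuple (dual W)) (v : 6.-tuple W) : dual_lists e v ->
  meets_Gr2_in_plane_conic (space_a e).
Proof.
case: e v => -[|f1 [|f2 [|f3 [|f4 [|f5 [|f6 []]]]]]] // se [].
case=> [|v1 [|v2 [|v3 [|v4 [|v5 [|v6 []]]]]]] // ? D.
have T := dual_table D.
set A := space_a _; set F := <<[:: f1; f2; f4; f5]>>%VS.
pose G1 := wedge f1 f4 + wedge f2 f5; pose G4 := wedge f1 f2; pose G5 := wedge f4 f5.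
have lc0 (V : vectType K) (x1 x2 x3 x4 x5 : V) (r s t : K) :
    lc [:: r; s; t] [:: x1; x4; x5] = lc [:: r; 0; 0; s; t] [:: x1; x2; x3; x4; x5].
  by rewrite /= !scale0r !add0r.
have GE (r s t : K) : lc [:: r; s; t] [:: G1; G4; G5] =
  lc [:: r; 0; 0; s; t] (space_a_gens (Tuple se)) := lc0 _ _ _ _ _ _ r s t.
have evG (r s t : K) x y := etrans (congr1 (fun w => ev w x y) (GE r s t))
  (ev_space_a se r 0 0 s t x y).
have fF f : f \in [:: f1; f2; f4; f5] -> f \in F by apply: memv_span.
have [F1 F2] : f1 \in F /\ f2 \in F by rewrite !fF // !inE eqxx ?orbT.
have [F4 F5] : f4 \in F /\ f5 \in F by rewrite !fF // !inE eqxx ?orbT.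
have UF : {in [:: G1; G4; G5], forall w, w \in ext2 F}.
  by move=> w; rewrite !inE => /or3P[] /eqP ->; rewrite ?memvD // wedge_ext2.
have UA : {in [:: G1; G4; G5], forall w, w \in A}.
  move=> w; rewrite !inE => h; apply: memv_span.
  by move: h => /or3P[] /eqP ->; rewrite !inE eqxx ?orbT.
have freeU : free [:: G1; G4; G5].
  apply: lc_free => -[|r [|s [|t []]]] // _ w0.
  have h x y : ev (lc [:: r; s; t] [:: G1; G4; G5]) x y = 0 by rewrite w0 (@ev0 _ _ (bforms W)).
  move: (h v1 v4) (h v1 v2) (h v4 v5); rewrite !evG !T => h1 h2 h3.
  by congr [:: _; _; _];
    [rewrite -[RHS]h1 | rewrite -[RHS]h2 | rewrite -[RHS]h3]; ring.
have dimF : \dim F = 4%N.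
  suff /eqP : free [:: f1; f2; f4; f5] by [].
  apply: lc_free => -[|r [|s [|t [|l []]]]] // _ w0.
  have h x : lc [:: r; s; t; l] [:: f1; f2; f4; f5] x = 0 by rewrite w0 zero_lfunE.
  move: (h v1) (h v2) (h v4) (h v5).
  rewrite /= !(add_lfunE, scale_lfunE, zero_lfunE) !T /GRing.scale /= => h1 h2 h3 h4.
  by congr [:: _; _; _; _];
    [rewrite -[RHS]h1 | rewrite -[RHS]h2 | rewrite -[RHS]h3 | rewrite -[RHS]h4]; ring.
exists F, <<[:: G1; G4; G5]>>%VS; split => //.
- by apply/span_subvP => w wU; rewrite memv_cap UF ?UA.
- move=> w; split=> [[Aw [sw rw]]|[Uw [_ rw]]]; last first.
    have Aw : w \in A by apply: subvP Uw; apply/span_subvP.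
    by split => //; split => //; have /(space_aP char0 dimW _ D)[] := Aw.
  have Uw : w \in <<[:: G1; G4; G5]>>%VS.
    have [[|r [|s [|t [|l [|m []]]]]] // _ wE] := span_lc Aw.
    (* The Pfaffian on these four vectors is [s^2]; likewise [t^2] below. *)
    have s0 : s = 0.
      have := rank2_pf4 char0 dimW v1 v5 v6 v3 sw rw.
      rewrite wE /pf4 !ev_space_a !T => h; apply/eqP; rewrite -sqrf_eq0; apply/eqP.
      by rewrite -[RHS]h; ring.
    have t0 : t = 0.
      have := rank2_pf4 char0 dimW v2 v4 v3 v6 sw rw.
      rewrite wE /pf4 !ev_space_a !T => h; apply/eqP; rewrite -sqrf_eq0; apply/eqP.
      by rewrite -[RHS]h; ring.
    by rewrite wE s0 t0 -GE lc_span.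
  split => //; split => //; apply: subvP Uw; exact/span_subvP.
have [Q [QT uQ QE]] := conic_matrix.
exists [tuple G1; G4; G5], Q; split => // [|x x0]; first by rewrite /basis_of eqxx freeU.
rewrite {}QE; set r := x 0 ord0; set s := x 0 (lift ord0 ord0).
set t := x 0 (lift ord0 (lift ord0 ord0)).
have sumE (V : vectType K) (x1 x2 x3 : V) :
    \sum_i x 0 i *: tnth [tuple x1; x2; x3] i = lc [:: r; s; t] [:: x1; x2; x3].
  by rewrite !big_ord_recl big_ord0.
rewrite sumE.
set w := (X in in_Gr2_of F X).
have w0 : w != 0.
  apply: contra x0 => /eqP /(free_lc (k := [:: r; s; t]) freeU)/(_ erefl)[r0 s0 t0].
  apply/eqP/rowP => -[[|[|[|//]]] i]; rewrite !mxE; [rewrite -r0 | rewrite -s0 | rewrite -t0];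
    by congr (x _ _); apply: val_inj.
split=> [[_ rw]|st].
  have sw : skew w by rewrite /w GE; apply: skew_space_a.
  have := rank2_pf4 char0 dimW v1 v2 v4 v5 sw rw.
  rewrite /w /pf4 !evG !T => h; apply/eqP; rewrite -subr_eq0; apply/eqP.
  by rewrite -[RHS]h; ring.
have [a [b [aF bF wE]]] : exists a b, [/\ a \in F, b \in F & w = wedge a b].
  have [s0|s0] := eqVneq s 0.
    have r0 : r = 0 by apply/eqP; rewrite -sqrf_eq0 -st s0 mul0r.
    exists (t *: f4), f5; split; rewrite ?memvZ //; apply: (@ev_ext _ _ (bforms W)) => x' y.
    by rewrite /w evG r0 s0 ev_wedge !scale_lfunE /GRing.scale /=; ring.
  (* The explicit factorization of a point of the conic with [s] nonzero, where [t = r^2 / s]. *)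
  exists (f1 - (r / s) *: f5), (s *: f2 + r *: f4); split; rewrite ?memvB ?memvD ?memvZ //.
  apply: (@ev_ext _ _ (bforms W)) => x' y.
  rewrite /w; have -> : t = r ^+ 2 / s by rewrite -st mulrC mulKf.
  rewrite evG ev_wedge !(add_lfunE, opp_lfunE, scale_lfunE) /GRing.scale /=.
  by field.
by rewrite wE in w0 *; split; [exact: wedge_ext2 | exact: rank_wedge].
Qed.

Lemma span2P (w1 w2 w : bform W) : w \in <<[:: w1; w2]>>%VS <->
  exists x y, w = x *: w1 + y *: w2.
Proof.
split=> [/span_lc[[|x [|y []]]] // _ -> | [x [y ->]]].
  by exists x, y; rewrite /= addr0.
by rewrite memvD // memvZ // memv_span // !inE eqxx ?orbT.
Qed.

Lemma dim_span2 (w1 w2 : bform W) : (forall x y, x *: w1 + y *: w2 = 0 -> x = 0 /\ y = 0) ->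
  \dim <<[:: w1; w2]>> = 2%N.
Proof.
move=> h; suff /eqP : free [:: w1; w2] by [].
by apply: lc_free => -[|x [|y []]] // _; rewrite /= addr0 => /h[-> ->].
Qed.

Lemma space_b_meets (e : 6.-tuple (dual W)) (v : 6.-tuple W) : dual_lists e v ->
  meets_Gr2_in_disjoint_lines (space_b e).
Proof.
case: e v => -[|f1 [|f2 [|f3 [|f4 [|f5 [|f6 []]]]]]] // se [].
case=> [|v1 [|v2 [|v3 [|v4 [|v5 [|v6 []]]]]]] // ? D.
have S := sum_difference_table D; set A := space_b _.
(* The lines are [g x y], divisible by [f1 - f5], and [h x y], divisible by [f1 + f5]. The
   coefficients -2 replace [f1 - f5], [f2 + f4], [f3 + f6] by [f1 + f5], [f2 - f4], [f3 - f6]. *)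
pose g x y : bform W := lc [:: 0; 0; 0; x; y] (space_b_gens (Tuple se)).
pose h x y : bform W := lc [:: - 2%:R * x; - 2%:R * y; 0; x; y] (space_b_gens (Tuple se)).
pose w1 := wedge (f1 - f5) (f2 + f4); pose w2 := wedge (f1 - f5) (f3 + f6).
pose w3 := wedge (f1 + f5) (f2 - f4); pose w4 := wedge (f1 + f5) (f3 - f6).
have lfE := (add_lfunE, opp_lfunE, scale_lfunE).
have gE x y : g x y = wedge (f1 - f5) (x *: (f2 + f4) + y *: (f3 + f6)).
  apply: (@ev_ext _ _ (bforms W)) => u t.
  by rewrite ev_space_b ev_wedge !lfE /GRing.scale /=; ring.
have hE x y : h x y = wedge (f1 + f5) (x *: (f2 - f4) + y *: (f3 - f6)).
  apply: (@ev_ext _ _ (bforms W)) => u t.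
  by rewrite ev_space_b ev_wedge !lfE /GRing.scale /=; ring.
have wD a b1 b2 (x y : K) :
    x *: wedge a b1 + y *: wedge a b2 = wedge a (x *: b1 + y *: b2).
  apply: (@ev_ext _ _ (bforms W)) => u t.
  rewrite (@evD _ _ (bforms W)) !(@evZ _ _ (bforms W)) !ev_wedge !lfE /GRing.scale /=; ring.
have L1P w : w \in <<[:: w1; w2]>>%VS <-> exists x y, w = g x y.
  by rewrite span2P; split=> -[x [y E]]; exists x, y; rewrite E ?gE wD.
have L2P w : w \in <<[:: w3; w4]>>%VS <-> exists x y, w = h x y.
  by rewrite span2P; split=> -[x [y E]]; exists x, y; rewrite E ?hE wD.
have c40 (x : K) : 4%:R * x = 0 -> x = 0.
  by move/eqP; rewrite mulf_eq0 (negPf (char0 3)) => /eqP.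
have g0 x y : ev (g x y) (v1 - v5) (v2 + v4) = 4%:R * x /\
    ev (g x y) (v1 - v5) (v3 + v6) = 4%:R * y.
  by rewrite !ev_space_b !S; split; ring.
have h0 x y : ev (h x y) (v1 + v5) (v2 - v4) = 4%:R * x /\
    ev (h x y) (v1 + v5) (v3 - v6) = 4%:R * y.
  by rewrite !ev_space_b !S; split; ring.
have gh0 x y : ev (g x y) (v1 + v5) (v2 - v4) = 0 /\ ev (g x y) (v1 + v5) (v3 - v6) = 0.
  by rewrite !ev_space_b !S; split; ring.
have ev00 u t : ev 0 u t = 0 := @ev0 _ _ (bforms W) u t.
exists <<[:: w1; w2]>>%VS, <<[:: w3; w4]>>%VS; split.
- apply: dim_span2 => x y; rewrite wD -gE => E; have [] := g0 x y.
  by rewrite E !ev00 => /esym/c40 -> /esym/c40 ->.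
- apply: dim_span2 => x y; rewrite wD -hE => E; have [] := h0 x y.
  by rewrite E !ev00 => /esym/c40 -> /esym/c40 ->.
- apply/eqP; rewrite -subv0; apply/subvP => w.
  rewrite memv_cap => /andP[/L1P[x [y ->]] /L2P[x' [y' E]]].
  have [e1 e2] := gh0 x y; have [] := h0 x' y'; rewrite -E e1 e2.
  move=> /esym/c40 x0 /esym/c40 y0; rewrite E hE x0 y0 !scale0r addr0 memv0.
  by apply/eqP/lfunP => u; apply/lfunP => t; rewrite wedgeE !zero_lfunE; ring.
move=> w; split=> [[Aw [sw rw]] | [w0 wL]].
  have w0 : w != 0.
    by apply: contra_eq_neq rw => ->; rewrite /form_rank lim0g dimv0.
  split=> //; have [[|k1 [|k2 [|k3 [|k4 [|k5 []]]]]] // _ wE] := span_lc Aw.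
  have pf x y z t := rank2_pf4 char0 dimW x y z t sw rw.
  have k30 : k3 = 0.
    apply/eqP; rewrite -sqrf_eq0; apply/eqP/c40.
    rewrite -[RHS](pf (v3 - v6) (v2 - v4) (v2 + v4) (v3 + v6)).
    by rewrite wE /pf4 !ev_space_b !S; ring.
  have cp (c q : W) (a b : K) :
      (-1) * (4%:R * (a * b)) = pf4 w (v1 - v5) c (v1 + v5) q -> a = 0 \/ b = 0.
    by rewrite pf mulN1r => /eqP; rewrite oppr_eq0 => /eqP/c40/eqP; rewrite mulf_eq0
      => /orP[] /eqP; [left | right].
  have e11 : k1 = 0 \/ 2%:R * k4 + k1 = 0.
    by apply: (cp (v2 + v4) (v2 - v4)); rewrite wE /pf4 !ev_space_b !S; ring.
  have e21 : k2 = 0 \/ 2%:R * k4 + k1 = 0.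
    by apply: (cp (v2 + v4) (v3 - v6)); rewrite wE /pf4 !ev_space_b !S; ring.
  have e12 : k1 = 0 \/ 2%:R * k5 + k2 = 0.
    by apply: (cp (v3 + v6) (v2 - v4)); rewrite wE /pf4 !ev_space_b !S; ring.
  have e22 : k2 = 0 \/ 2%:R * k5 + k2 = 0.
    by apply: (cp (v3 + v6) (v3 - v6)); rewrite wE /pf4 !ev_space_b !S; ring.
  (* All products of an entry of [(k1, k2)] with an entry of [(2 k4 + k1, 2 k5 + k2)] vanish, so one
     of the two pairs is zero; each case is one of the lines. *)
  have [[k10 k20]|[k14 k25]] :
      k1 = 0 /\ k2 = 0 \/ 2%:R * k4 + k1 = 0 /\ 2%:R * k5 + k2 = 0 by tauto.
    by left; apply/L1P; exists k4, k5; rewrite k30 k10 k20 in wE; exact: wE.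
  right; apply/L2P; exists k4, k5.
  have e1 : k1 = - 2%:R * k4 by rewrite -(addKr (2%:R * k4) k1) k14 addr0 mulNr.
  have e2 : k2 = - 2%:R * k5 by rewrite -(addKr (2%:R * k5) k2) k25 addr0 mulNr.
  by rewrite k30 e1 e2 in wE; exact: wE.
have [a [b wE]] : exists a b, w = wedge a b.
  by case: wL => [/L1P | /L2P] [x [y ->]]; [rewrite gE | rewrite hE]; do 2!eexists.
split; last by rewrite wE in w0 *; split; [exact: skew_wedge | exact: rank_wedge].
by case: wL => [/L1P | /L2P] [x [y ->]]; apply: lc_span.
Qed.

End PlaneSections.

Theorem theorem1p2 (R : realType) (W : vectType R[i])
    (dimW : \dim {:W} = 6%N)
    (e : 6.-tuple (dual W)) (basis_e : basis_of fullv e)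
    (A : {vspace bform W})
    (system_A : linear_system 4 A)
    (stable_A : stable 4 A)
    (rank_A : generic_rank_le4 A) :
  (SL_equiv A (space_a e) \/ SL_equiv A (space_b e)) /\
  (SL_equiv A (space_a e) -> meets_Gr2_in_plane_conic A) /\
  (SL_equiv A (space_b e) -> meets_Gr2_in_disjoint_lines A).
Proof.
have [dimA skA] := system_A.
have char0 n : n.+1%:R != 0 :> R[i] by rewrite pnatr_eq0.
have closedR (p : {poly R[i]}) : size p != 1%N -> exists x, root p x by move/closed_rootP.
split; last split.
- have rkA w : w \in A -> (2 <= \dim (lker w))%N.
    move/rank_A => r4; rewrite -(leq_add2r (form_rank w)) (dim_lker_rank dimW).
    by rewrite addnC (leq_add2r 2 _ 4).
  have ndA P Q : (P <= Q)%VS -> (0 < \dim P)%N -> (\dim P + \dim Q = 6)%N ->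
      ~ (forall w, w \in A -> {in P & Q, forall u v, w u v = 0}).
    by rewrite -dimW; apply: stable_nondegenerate stable_A skA.
  have [k [c1 [c2 [c3 [p1 [p2 [bas eqs]]]]]]] :=
    normal_form (B := bforms W) closedR char0 dimW dimA skA rkA ndA.
  by case: eqs => eqs; [left | right]; [apply: SL_equiv_space_a eqs | apply: SL_equiv_space_b eqs].
- case/(SL_equiv_a_pull char0 dimW basis_e) => e' [v [D ->]].
  exact: space_a_meets D.
case/(SL_equiv_b_pull char0 dimW basis_e) => e' [v [D ->]].
exact: space_b_meets D.
Qed.
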